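(* Let $G$ be a pure braid group $PB_n$, $n\ge3$, or a non-abelian partially commutative group $G(\Gamma)$, with a finite generating set $X$. Then for every $k,m>0$ there exists an algorithm $\mathcal C_{k,m}$ that solves the SCSP* in $G$ on an exponentially generic subset of the set of all inputs $I_{k,m}$ for SCSP*. Furthermore, $\mathcal C_{k,m}$ belongs to the complexity class $O(n^2)$ (here $n$ denotes the input size).
   Context: The braid group $B_n$ has generators $\sigma_1,\dots,\sigma_{n-1}$ and relations $\sigma_i\sigma_j\sigma_i=\sigma_j\sigma_i\sigma_j$ if $|i-j|=1$, $\sigma_i\sigma_j=\sigma_j\sigma_i$ if $|i-j|>1$. $PB_n$ is the kernel of the epimorphism from $B_n$ onto the symmetric group on $n$ letters sending $\sigma_i$ to the transposition $(i,i+1)$. For a finite graph $\Gamma=(V,E)$ with $V=\{v_1,\dots,v_r\}$, $G(\Gamma)=\langle v_1,\dots,v_r\mid v_iv_j=v_jv_i\text{ for }(v_i,v_j)\in E\rangle$. $F(X)$ is the free group on $X$, words being evaluated in $G$. SCSP* (Simultaneous Conjugacy Search Problem relative to a subgroup) in $G$: an input in $I_{k,m}$ is a pair $(T,b)$ with $T=(a_1,\dots,a_k,u_1,\dots,u_m)\in F(X)^{k+m}$, $b=(v_1,\dots,v_m)\in F(X)^m$, such that the system $u_i^x=v_i$ ($i=1,\dots,m$; $u^x=x^{-1}ux$) has a solution $x$ in $\langle a_1,\dots,a_k\rangle\le G$; the task is to find such a solution. Genericity: the size $s$ of a tuple in $F(X)^{k+m}$ is the total or the maximal length of its components (either choice may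 be used); $\mathcal B_r=\{u\in F(X)^{k+m}: s(u)\le r\}$; $D\subseteq F(X)^{k+m}$ is exponentially generic if $1-|\mathcal B_r\cap D|/|\mathcal B_r|\le C\delta^r$ for some $C>0$, $\delta\in(0,1)$ and all $r$. A set of inputs is exponentially generic in $I_{k,m}$ if it contains all inputs $(T,b)$ with $T\in D$ for some exponentially generic $D\subseteq F(X)^{k+m}$. *)

(* Defs.v *)
From HB Require Import structures.
From mathcomp Require Import all_boot all_order all_algebra all_fingroup.
From mathcomp Require Import generic_quotient finmap zify.
From mathcomp Require Import boolp classical_sets cardinality reals.
Set Implicit Arguments.
Unset Strict Implicit.
Unset Printing Implicit Defensive.

Local Open Scope group_scope.
Local Open Scope quotient_scope.
Local Open Scope classical_set_scope.
Local Open Scope fset_scope.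

(* The letter (i, false) stands for the generator i, (i, true) for its
   inverse. *)
Definition letter (I : Type) : Type := (I * bool)%type.
Definition word (I : Type) : Type := seq (letter I).
Definition inv_letter (I : Type) (l : letter I) : letter I := (l.1, ~~ l.2).
Definition inv_word (I : Type) (w : word I) : word I :=
  rev (map (@inv_letter I) w).

Definition eval_letter (G : groupType) (I : Type) (f : I -> G) (l : letter I)
  : G := if l.2 then (f l.1)^-1 else f l.1.
Definition eval (G : groupType) (I : Type) (f : I -> G) (w : word I) : G :=
  \prod_(l <- w) eval_letter f l.

Definition subgroup_gen (G : groupType) (I : Type) (a : I -> G) : set G :=
  range (eval a).

Definition incl (G : groupType) (X : {fset G}) : X -> G := val.
Arguments incl {G} X _.

Definition isomorphic (G H : groupType) : Prop :=
  exists f : {multiplicative G -> H}, bijective f.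

(* The free group on I, as its set of reduced words. *)

Definition reduced (I : eqType) (w : word I) : bool :=
  sorted (fun l l' => l' != inv_letter l) w.
Definition freeword (I : eqType) : Type := {w : word I | reduced w}.

Inductive pres_eq (I : Type) (R : word I -> word I -> Prop) :
    word I -> word I -> Prop :=
| pres_rel u v : R u v -> pres_eq R u v
| pres_cancel l : pres_eq R [:: l; inv_letter l] [::]
| pres_refl u : pres_eq R u u
| pres_sym u v : pres_eq R u v -> pres_eq R v u
| pres_trans u v w : pres_eq R u v -> pres_eq R v w -> pres_eq R u w
| pres_cat u u' v v' :
    pres_eq R u u' -> pres_eq R v v' -> pres_eq R (u ++ v) (u' ++ v').

Definition pres_eqb (I : Type) (R : word I -> word I -> Prop) : rel (word I) :=
  fun u v => `[< pres_eq R u v >].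

Lemma pres_eqb_refl I R : reflexive (@pres_eqb I R).
Proof. by move=> u; apply/asboolP; exact: pres_refl. Qed.

Lemma pres_eqb_sym I R : symmetric (@pres_eqb I R).
Proof.
by move=> u v; apply/asboolP/asboolP => h; exact: pres_sym.
Qed.

Lemma pres_eqb_trans I R : transitive (@pres_eqb I R).
Proof.
by move=> v u w /asboolP h1 /asboolP h2; apply/asboolP; apply: pres_trans h2.
Qed.

Canonical pres_equiv (I : choiceType) (R : word I -> word I -> Prop) :=
  EquivRel (@pres_eqb I R) (@pres_eqb_refl I R) (@pres_eqb_sym I R)
    (@pres_eqb_trans I R).

Definition presented (I : choiceType) (R : word I -> word I -> Prop) : Type :=
  {eq_quot (pres_equiv R)}.

HB.instance Definition _ (I : choiceType) (R : word I -> word I -> Prop) :=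
  Choice.on (presented R).
HB.instance Definition _ (I : choiceType) (R : word I -> word I -> Prop) :=
  EqQuotient.on (presented R).

Section PresentedGroup.
Context (I : choiceType) (R : word I -> word I -> Prop).
Local Notation P := (presented R).
Local Notation "u ~ v" := (pres_eq R u v) (at level 70).

Lemma presentedP (u v : word I) : \pi_P u = \pi_P v <-> u ~ v.
Proof.
split; first by move/eqmodP => /= /asboolP.
by move=> h; apply/eqmodP/asboolP.
Qed.

Lemma repr_presented (u : word I) : repr (\pi_P u) ~ u.
Proof. by apply/presentedP; rewrite reprK. Qed.

Lemma inv_word_cat (u v : word I) :
  inv_word (u ++ v) = inv_word v ++ inv_word u.
Proof. by rewrite /inv_word map_cat rev_cat. Qed.

Lemma inv_letterK : involutive (@inv_letter I).
Proof. by case=> i b; rewrite /inv_letter /= negbK. Qed.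

Lemma inv_wordK : involutive (@inv_word I).
Proof.
move=> u; rewrite /inv_word map_rev revK -map_comp.
by rewrite (eq_map (g := id)) ?map_id// => l /=; rewrite inv_letterK.
Qed.

Lemma pres_mulwV (u : word I) : u ++ inv_word u ~ [::].
Proof.
elim: u => [|l u IH]; first exact: pres_refl.
rewrite -cat1s inv_word_cat -catA (catA u).
apply: (pres_trans (v := [:: l] ++ ([::] ++ [:: inv_letter l]))).
  apply: pres_cat; first exact: pres_refl.
  by apply: pres_cat => //; exact: pres_refl.
exact: pres_cancel.
Qed.

Lemma pres_mulVw (u : word I) : inv_word u ++ u ~ [::].
Proof. by have := pres_mulwV (inv_word u); rewrite inv_wordK. Qed.

Definition pres_one : P := \pi_P [::].
Definition pres_mul (x y : P) : P := \pi_P (repr x ++ repr y).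
Definition pres_inv (x : P) : P := \pi_P (inv_word (repr x)).

Lemma pres_mulA : associative pres_mul.
Proof.
move=> x y z; apply/presentedP.
apply: (pres_trans (v := repr x ++ (repr y ++ repr z))).
  by apply: pres_cat; [exact: pres_refl | exact: repr_presented].
rewrite catA; apply: pres_cat; last exact: pres_refl.
by apply: pres_sym; exact: repr_presented.
Qed.

Lemma pres_mul1 : left_id pres_one pres_mul.
Proof.
move=> x; rewrite -[RHS]reprK; apply/presentedP.
apply: (pres_cat (u' := [::])); [exact: repr_presented | exact: pres_refl].
Qed.

Lemma pres_mulr1 : right_id pres_one pres_mul.
Proof.
move=> x; rewrite -[RHS]reprK; apply/presentedP; rewrite -[X in _ ~ X]cats0.
by apply: pres_cat; [exact: pres_refl | exact: repr_presented].
Qed.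

Lemma pres_mulV : left_inverse pres_one pres_inv pres_mul.
Proof.
move=> x; apply/presentedP; apply: pres_trans (pres_mulVw (repr x)).
by apply: pres_cat; [exact: repr_presented | exact: pres_refl].
Qed.

Lemma pres_mulrV : right_inverse pres_one pres_inv pres_mul.
Proof.
move=> x; apply/presentedP; apply: pres_trans (pres_mulwV (repr x)).
by apply: pres_cat; [exact: pres_refl | exact: repr_presented].
Qed.

HB.instance Definition _ := isGroup.Build (presented R)
  pres_mulA pres_mul1 pres_mulr1 pres_mulV pres_mulrV.

Definition pres_gen (i : I) : P := \pi_P [:: (i, false)].

(* The homomorphism induced by f : I -> H; it is meaningful when f satisfies
   the relations R, in which case it does not depend on representatives. *)
Definition pres_lift (H : groupType) (f : I -> H) (x : P) : H :=
  eval f (repr x).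

Section Lift.
Context (H : groupType) (f : I -> H).
Hypothesis fR : forall u v, R u v -> eval f u = eval f v.

Lemma eval_cat (u v : word I) : eval f (u ++ v) = eval f u * eval f v.
Proof. by rewrite /eval big_cat. Qed.

Lemma eval_pres_eq (u v : word I) : u ~ v -> eval f u = eval f v.
Proof.
elim=> {u v} [u v /fR//|l|//|//|u v w _ -> _ ->//|u u' v v' _ IHu _ IHv].
  rewrite /eval !big_cons big_nil mulg1 /eval_letter /=.
  by case: l.2 => /=; rewrite ?mulVg ?mulgV.
by rewrite !eval_cat IHu IHv.
Qed.

Lemma pres_lift_pi (u : word I) : pres_lift f (\pi_P u) = eval f u.
Proof. exact: eval_pres_eq (repr_presented u). Qed.

Lemma pres_liftM : {morph pres_lift f : x y / x * y}.
Proof. by move=> x y; rewrite [LHS]pres_lift_pi eval_cat. Qed.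

Lemma pres_lift1 : pres_lift f 1 = 1.
Proof. by rewrite [LHS]pres_lift_pi /eval big_nil. Qed.

End Lift.
End PresentedGroup.

Inductive braid_rel (n : nat) : word 'I_n.-1 -> word 'I_n.-1 -> Prop :=
| braid_near (i j : 'I_n.-1) : (i.+1 == j) || (j.+1 == i) ->
    braid_rel [:: (i, false); (j, false); (i, false)]
              [:: (j, false); (i, false); (j, false)]
| braid_far (i j : 'I_n.-1) : (i.+1 < j)%N || (j.+1 < i)%N ->
    braid_rel [:: (i, false); (j, false)] [:: (j, false); (i, false)].

Definition braid (n : nat) : Type := presented (@braid_rel n).

Lemma braid_ord_proof (n : nat) (i : 'I_n.-1) : (i.+1 < n)%N.
Proof. by rewrite -ltn_predRL. Qed.

Definition braid_transposition (n : nat) (i : 'I_n.-1) : 'S_n :=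
  tperm (widen_ord (leq_pred n) i) (Ordinal (braid_ord_proof i)).

Definition braid_perm (n : nat) : braid n -> 'S_n :=
  pres_lift (@braid_transposition n).

Lemma tperm_braid (T : finType) (x y z : T) : x != y -> x != z -> y != z ->
  tperm x y * tperm y z * tperm x y = tperm y z * tperm x y * tperm y z.
Proof.
move=> xy xz yz.
have -> : tperm x y * tperm y z * tperm x y = tperm y z ^ tperm x y.
  by rewrite conjgE tpermV mulgA.
have -> : tperm y z * tperm x y * tperm y z = tperm x y ^ tperm y z.
  by rewrite conjgE tpermV mulgA.
by rewrite !tpermJ !tpermR tpermD// tpermL tpermD// eq_sym.
Qed.

Lemma braid_transposition_rel (n : nat) (u v : word 'I_n.-1) :
  braid_rel u v ->
  eval (@braid_transposition n) u = eval (@braid_transposition n) v.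
Proof.
have tE (i j : 'I_n.-1) : j = i.+1 :> nat ->
    let t := @braid_transposition n in t i * t j * t i = t j * t i * t j.
  move=> ij t; rewrite /t /braid_transposition.
  have -> : Ordinal (braid_ord_proof i) = widen_ord (leq_pred n) j.
    exact: val_inj.
  by apply: tperm_braid; rewrite -val_eqE /= ij; apply/eqP; lia.
case=> i j; rewrite /eval !big_cons big_nil /eval_letter /= !mulg1 ?mulgA.
  by case/orP => /eqP ij; [|apply/esym]; exact: tE.
move=> ij; have {ij} : [&& i != j :> nat, i != j.+1 :> nat,
    i.+1 != j & i.+1 != j.+1]%N by lia.
case/and4P=> h1 h2 h3 h4; rewrite conjgC /braid_transposition tpermJ.
by rewrite !tpermD// -val_eqE/= eq_sym.
Qed.

Definition is_pure (n : nat) : pred (braid n) := fun x => braid_perm x == 1.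

Lemma is_pure_group_closed (n : nat) : group_closed (@is_pure n).
Proof.
have M := pres_liftM (@braid_transposition_rel n).
have o1 := pres_lift1 (@braid_transposition_rel n).
split=> [|x y]; rewrite !unfold_in /is_pure /braid_perm; first by rewrite o1.
move=> /eqP x1 /eqP y1; rewrite M x1 mul1g; apply/eqP.
by rewrite -[LHS]mul1g -[X in X * _]y1 -M mulgV.
Qed.

Definition pure_braid (n : nat) : Type := {x : braid n | is_pure x}.
HB.instance Definition _ (n : nat) := SubChoice.on (pure_braid n).
HB.instance Definition _ (n : nat) :=
  SubChoice_isSubGroup.Build (braid n) (@is_pure n) (pure_braid n)
    (@is_pure_group_closed n).

Inductive commutation_rel (V : Type) (e : rel V) : word V -> word V -> Prop :=
| commutation_edge (v w : V) : e v w ->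
    commutation_rel e [:: (v, false); (w, false)] [:: (w, false); (v, false)].

Definition partially_commutative (V : finType) (e : rel V) : Type :=
  presented (commutation_rel e).

(* Deterministic multitape Turing machines with input and output words over
   Sigma.  The tape symbols are None (blank), Some (inl s) for s in Sigma, and
   Some (inr w) for w an auxiliary symbol. *)

Inductive direction := Left | Stay | Right.

Definition direction_code (d : direction) : 'I_3 :=
  match d with Left => inord 0 | Stay => inord 1 | Right => inord 2 end.
Definition direction_decode (i : 'I_3) : direction :=
  match val i with 0 => Left | 1 => Stay | _ => Right end.
Lemma direction_codeK : cancel direction_code direction_decode.
Proof. by case; rewrite /direction_decode /= inordK. Qed.
HB.instance Definition _ := Finite.copy direction (can_type direction_codeK).

Definition tape_symbol (Sigma work : finType) : finType :=
  option (Sigma + work)%type.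

(* A machine has tapes.+1 tapes. *)
Record machine (Sigma : finType) := Machine {
  tapes : nat;
  work : finType;
  state : finType;
  start : state;
  halting : pred state;
  delta : state -> tapes.+1.-tuple (tape_symbol Sigma work) ->
          state * tapes.+1.-tuple (tape_symbol Sigma work * direction)
}.

(* The tape (l, r) reads rev l ++ r, surrounded by blanks on both sides, with
   the head on the first symbol of r. *)
Definition tape (Sigma work : finType) : Type :=
  (seq (tape_symbol Sigma work) * seq (tape_symbol Sigma work))%type.

Definition tape_read (Sigma work : finType) (t : tape Sigma work) :
  tape_symbol Sigma work := head None t.2.

Definition tape_act (Sigma work : finType) (t : tape Sigma work)
    (a : tape_symbol Sigma work * direction) : tape Sigma work :=
  let: (l, r) := t in
  match a.2 with
  | Left => (behead l, head None l :: a.1 :: behead r)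
  | Stay => (l, a.1 :: behead r)
  | Right => (a.1 :: l, behead r)
  end.

Definition config (Sigma : finType) (M : machine Sigma) : Type :=
  (state M * (tapes M).+1.-tuple (tape Sigma (work M)))%type.

Definition step (Sigma : finType) (M : machine Sigma) (c : config M) :
    config M :=
  if halting c.1 then c else
  let: (q, acts) := delta c.1 (map_tuple (@tape_read _ _) c.2) in
  (q, [tuple tape_act (tnth c.2 i) (tnth acts i) | i < (tapes M).+1]).

Definition initial (Sigma : finType) (M : machine Sigma) (s : seq Sigma) :
    config M :=
  (start M,
   [tuple ([::], if i == ord0 then [seq Some (inl x) | x <- s] else [::])
     | i < (tapes M).+1]).

Definition run (Sigma : finType) (M : machine Sigma) (s : seq Sigma)
  (t : nat) : config M := iter t (@step Sigma M) (initial M s).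

Definition halts_within (Sigma : finType) (M : machine Sigma) (s : seq Sigma)
  (t : nat) : bool := halting (run M s t).1.

Fixpoint input_prefix (Sigma work : finType)
    (r : seq (tape_symbol Sigma work)) : seq Sigma :=
  if r is Some (inl x) :: r' then x :: input_prefix r' else [::].

(* The output is the longest word over Sigma found on tape 0 from the head
   rightwards once the machine has halted. *)
Definition outputs (Sigma : finType) (M : machine Sigma) (s o : seq Sigma) :
    Prop :=
  exists t, halts_within M s t /\
    input_prefix (tnth (run M s t).2 ord0).2 = o.

Definition tuple_size (A : finType) (N : nat) (T : N.-tuple (freeword A)) :
  nat := \max_(w <- T) size (val w).

Definition size_ball (A : finType) (N r : nat) : set (N.-tuple (freeword A)) :=
  [set T | (tuple_size T <= r)%N].

Lemma finite_size_ball (A : finType) (N r : nat) :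
  finite_set (@size_ball A N r).
Proof.
pose d : freeword A := exist (@reduced A) [::] isT.
pose f (t : N.-tuple {bseq r of letter A}) : N.-tuple (freeword A) :=
  map_tuple (fun b => insubd d (bseqval b)) t.
apply: (@sub_finite_set _ _ (f @` setT)); last first.
  exact: finite_image finite_finset.
move=> T /= Tr; exists (map_tuple (fun w => insub_bseq r (val w)) T) => //.
apply/eq_from_tnth => j; rewrite !tnth_map.
have jr : (size (val (tnth T j)) <= r)%N.
  apply: leq_trans Tr; rewrite /tuple_size big_tuple.
  exact: (leq_bigmax (F := fun i => size (val (tnth T i)))).
apply/val_inj; rewrite /insub_bseq /insubd insubT//= insubT /=; last exact.
exact: valP.
Qed.

Definition exponentially_generic (R : realType) (A : finType) (N : nat)
    (D : set (N.-tuple (freeword A))) : Prop :=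
  exists C delta : R, [/\ (0 < C)%R, (0 < delta < 1)%R &
    forall r : nat,
      (1 - #|` fset_set (@size_ball A N r `&` D)|%:R
           / #|` fset_set (@size_ball A N r)|%:R <= C * delta ^+ r)%R].

(* In the simultaneous conjugacy search problem relative to a subgroup, a pair
   (T, b) has T = (a_1, .., a_k, u_1, .., u_m) and b = (v_1, .., v_m). *)

Section SCSP.
Context (G : groupType) (A : finType) (x : A -> G) (k m : nat).

Definition scsp_pair : Type :=
  ((k + m).-tuple (freeword A) * m.-tuple (freeword A))%type.

Definition feval (w : freeword A) : G := eval x (val w).

Definition scsp_solution (i : scsp_pair) : set G :=
  [set g | subgroup_gen (fun j : 'I_k => feval (tnth i.1 (lshift m j))) g /\
           forall j : 'I_m, feval (tnth i.1 (rshift k j)) ^ g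
                            = feval (tnth i.2 j)].

Definition scsp_inputs : set scsp_pair :=
  [set i | exists g, scsp_solution i g].

Definition generic_inputs (R : realType) (S : set scsp_pair) : Prop :=
  exists D : set ((k + m).-tuple (freeword A)), exponentially_generic R D /\
    forall i, scsp_inputs i -> D i.1 -> S i.

Definition scsp_words (i : scsp_pair) : seq (freeword A) := i.1 ++ i.2.

Definition input_size (i : scsp_pair) : nat :=
  \sum_(w <- scsp_words i) size (val w).

(* Each word is followed by the separator None. *)
Definition encode (i : scsp_pair) : seq (option (letter A)) :=
  flatten [seq rcons (map Some (val w)) None | w <- scsp_words i].

Definition solves_on (M : machine (option (letter A))) (S : set scsp_pair) :
    Prop :=
  forall i, S i -> exists w : word A,
    outputs M (encode i) (map Some w) /\ scsp_solution i (eval x w).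

Definition quadratic_time (M : machine (option (letter A))) : Prop :=
  exists t : nat -> nat,
    (exists c n0 : nat, forall n, (n0 <= n)%N -> (t n <= c * n ^ 2)%N) /\
    forall i, scsp_inputs i -> halts_within M (encode i) (t (input_size i)).

End SCSP.
Arguments scsp_inputs {G A} x k m _.

(* Main.v *)
(* Let W be the free product of three groups of order 2, whose elements are the
   words in three letters without equal neighbours; inversion reverses words.
   The group G has a morphism to W whose image contains all words of even
   length: for G(Gamma) send two generators that are not adjacent to 01 and 12
   and the other ones to 1; for PB_n record the crossings among three strands.

   A ping-pong family of words shows that the l2 norm of the image in W of the
   uniform distribution on the reduced words of length r over X decays
   exponentially.  Hence, for generic (a_1, ..., a_k, u_1, ..., u_m), the images
   in W of the a_i, of u_1 and of their inverses are long and have pairwise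
   distinct short prefixes.  For such tuples, conjugating the image of u_1 by the
   letters of a reduced word in the a_i increases the length at every step, and
   the last letter is recovered from the conjugate as the only one that can be
   removed with a decrease of length.  So a solution is peeled off from the
   image of v_1 alone: each trial takes linear time, and linearly many suffice. *)

Require Import Defs.
From mathcomp Require Import all_boot finmap.
From mathcomp Require Import classical_sets reals.
From mathcomp Require Import all_order all_algebra all_fingroup.
From mathcomp Require Import generic_quotient boolp cardinality.
From mathcomp Require Import zify ring lra.
Set Implicit Arguments.
Unset Strict Implicit.
Unset Printing Implicit Defensive.
Import Order.TTheory GRing.Theory Num.Theory.

(** * Reduced words in a free product of groups of order two *)

(** The generating set X is arbitrary: single letters may have trivial or equal images, so a random
    reduced word need not advance at every letter. The estimate therefore works with long blocks of
    letters, and by counting alone: the squared l2 norm of a multiset is its number of collisions, a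
    natural number. For d blocks in ping-pong position, the union of d translates of a multiset has
    at most 2 sqrt d times its norm, instead of d times. The value d = 6 is the least with 4 d <= (d
    - 1)^2; it saves one translate out of d, and this saving, repeated for each new block, is the
    exponential decay. A bound on single points becomes a bound on prefixes because a path that
    enters the cone of a prefix enters it near its vertex. The machine must also stop in quadratic
    time on inputs that are not generic, so the number of passes is fixed in advance by the length
    of the image of v_1. *)

Section CoxeterWords.
Context (A : eqType).
Implicit Types (a : A) (s u v : seq A).

Definition irr s := sorted (fun a b => a != b) s.

(** Left multiplication of a reduced word by a generator of order two. *)
Definition push a s :=
  if s is b :: s' then if a == b then s' else a :: s else [:: a].

Definition nf u := foldr push [::] u.

Lemma irr_push a s : irr s -> irr (push a s).
Proof.
case: s => //= b s; case: eqP => [_|/eqP ab bs]; last by rewrite /= ab.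
by apply: path_sorted.
Qed.

Lemma pushK a s : irr s -> push a (push a s) = s.
Proof.
case: s => [_|b s] /=; first by rewrite eqxx.
case: (eqVneq a b) => [->|ab] /=; last by rewrite eqxx.
by case: s => //= c s /andP[/negPf ->].
Qed.

Lemma irr_foldr_push u s : irr s -> irr (foldr push s u).
Proof. by move=> si; elim: u => //= a u /irr_push. Qed.

Lemma nf_irr u : irr (nf u).
Proof. exact: irr_foldr_push. Qed.

Lemma push_irr_cons a s : irr (a :: s) -> push a s = a :: s.
Proof. by case: s => //= b s /andP[/negPf ->]. Qed.

Lemma nf_id s : irr s -> nf s = s.
Proof.
elim: s => // a s IH as_; rewrite /nf /= -/(nf s) IH ?push_irr_cons//.
exact: path_sorted as_.
Qed.

Lemma nf_cat u v : nf (u ++ v) = foldr push (nf v) u.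
Proof. by rewrite /nf foldr_cat. Qed.

Lemma foldr_push_nf u s : irr s -> foldr push s (nf u) = foldr push s u.
Proof.
move=> si; elim: u => //= a u <-.
rewrite /nf /= -/(nf u); case: (nf u) => //= b t.
case: eqP => [->|//]; rewrite pushK//; exact: irr_foldr_push.
Qed.

Lemma nf_nf_catl u v : nf (nf u ++ v) = nf (u ++ v).
Proof. by rewrite !nf_cat foldr_push_nf ?nf_irr. Qed.

Lemma nf_nf_catr u v : nf (u ++ nf v) = nf (u ++ v).
Proof. by rewrite !nf_cat (nf_id (nf_irr v)). Qed.

Lemma nf_cat_nf u v : nf (nf u ++ nf v) = nf (u ++ v).
Proof. by rewrite nf_nf_catl nf_nf_catr. Qed.

Lemma nf_cons a u : nf (a :: u) = push a (nf u).
Proof. by []. Qed.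

Lemma nf_cancel a u v : nf (u ++ a :: a :: v) = nf (u ++ v).
Proof. by rewrite !nf_cat !nf_cons pushK ?nf_irr. Qed.

Lemma nf_cat3_nf u v w : nf (nf u ++ nf v ++ nf w) = nf (u ++ v ++ w).
Proof.
by rewrite nf_nf_catl -nf_nf_catr nf_cat_nf nf_nf_catr.
Qed.

Lemma nf_rev u : nf (rev u) = rev (nf u).
Proof.
elim: u => // a u IH.
have irrR s : irr s -> irr (rev s).
  by rewrite /irr rev_sorted; apply: sub_sorted => x y; rewrite eq_sym.
rewrite rev_cons -cats1 -nf_nf_catl IH /nf /= -!/(nf _).
case E: (nf u) => [|b t] //=.
have := nf_irr u; rewrite E => bt; have ti := path_sorted bt.
case: eqP => [->|/eqP ab].
  by rewrite rev_cons -cats1 -catA nf_cancel cats0 nf_id//; exact: irrR.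
rewrite cats1 -rev_cons nf_id//; apply: irrR.
by rewrite /irr /= ab.
Qed.

Lemma irr_rev s : irr (rev s) = irr s.
Proof.
have irrR t : irr t -> irr (rev t).
  by rewrite /irr rev_sorted; apply: sub_sorted => x y; rewrite eq_sym.
by apply/idP/idP => /irrR; rewrite ?revK.
Qed.

Lemma nf_invl u v : nf (rev u ++ u ++ v) = nf v.
Proof.
elim: u v => // a u IH v.
by rewrite rev_cons -cats1 -catA nf_cancel IH.
Qed.

Lemma nf_invr u v : nf (u ++ rev u ++ v) = nf v.
Proof. by rewrite -{1}(revK u) nf_invl. Qed.

Lemma nf_midV u s v : nf (u ++ s ++ rev s ++ v) = nf (u ++ v).
Proof. by rewrite nf_cat nf_invr -nf_cat. Qed.

Lemma irr_catl u v : irr (u ++ v) -> irr u.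
Proof. by case: u => // a u; rewrite /irr /= cat_path => /andP[]. Qed.

Lemma size_push a s : size (push a s) <= (size s).+1.
Proof. by case: s => //= b s; case: ifP => //= _; lia. Qed.

Lemma size_nf u : size (nf u) <= size u.
Proof. by elim: u => //= a u IH; apply: leq_trans (size_push _ _) _. Qed.

(* Right multiplication by u changes a reduced word only in its last
   [size u] letters. *)
Lemma take_nf_catr u v : irr u ->
  take (size u - size v) (nf (u ++ v)) = take (size u - size v) u.
Proof.
elim: v u => [|a v IH] u ui; first by rewrite cats0 nf_id.
case/lastP: u ui => [_|u b ui]; first by rewrite !take0.
rewrite size_rcons /= subSS.
rewrite -[in LHS]cat1s catA -nf_nf_catl.
have -> : nf (rcons u b ++ [:: a]) =
    if a == b then u else rcons (rcons u b) a.
  rewrite -[rcons u b ++ _]revK nf_rev cats1 rev_rcons rev_rcons /nf /= -/(nf _).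
  have ri : irr (b :: rev u) by rewrite -rev_rcons irr_rev.
  rewrite (nf_id (path_sorted ri : irr (rev u))) (push_irr_cons ri) /=.
  by case: ifP => _; rewrite ?rev_cons revK.
case: eqP => [_|/eqP ab].
  rewrite IH; last by move: ui; rewrite -cats1 => /irr_catl.
  by rewrite -cats1 takel_cat//; lia.
have ui' : irr (rcons (rcons u b) a).
  by rewrite -irr_rev !rev_rcons /irr /= ab; move: ui; rewrite -irr_rev rev_rcons.
have := IH _ ui'; rewrite !size_rcons => /(congr1 (take (size u - size v))).
rewrite !take_takel; [|lia|lia] => ->.
by rewrite -[rcons (rcons _ _) _]cats1 takel_cat// size_rcons; lia.
Qed.

(* The cancellation in [rev u ++ v] is the common prefix of u and v. *)
Lemma nf_rev_cat L u v : irr u -> irr v -> L <= size u ->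
  take L u != take L v ->
  exists2 c, c < L & nf (rev u ++ v) = rev (drop c u) ++ drop c v.
Proof.
elim: L u v => [u v _ _ _|L IH [|a u] v ui vi //]; first by rewrite !take0 eqxx.
move=> /= Lu; case: v vi => [_ _|b v /= vi].
  by exists 0 => //; rewrite /= !cats0 nf_id// irr_rev.
case: (eqVneq a b) => [<-|ab _].
  move=> uv; have {}uv : take L u != take L v by apply: contra_neq uv => ->.
  have [c cL E] := IH _ _ (path_sorted ui) (path_sorted vi) Lu uv.
  exists c.+1 => //=; rewrite -E rev_cons -cats1 -catA.
  exact: nf_cancel.
exists 0 => //=; rewrite nf_id//.
have : irr (rev (a :: u)) by rewrite irr_rev.
rewrite rev_cons /irr => h; rewrite cat_rcons.
move: h; case: (rev u) => [|c w] /=; first by rewrite ab.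
by rewrite rcons_path cat_path /= ab => /andP[-> ->].
Qed.

(** Fewer than L letters cancel, because v does not begin with the first L letters of the inverse of
    u; the first L letters of u are out of reach of this cancellation. *)
Lemma take_nf_cat L u v : irr u -> irr v -> 2 * L <= size u ->
  take L v != take L (rev u) -> take L (nf (u ++ v)) = take L u.
Proof.
move=> ui vi Lu uv; have rui : irr (rev u) by rewrite irr_rev.
have Lr : L <= size (rev u) by rewrite size_rev; lia.
rewrite eq_sym in uv; have [c cL] := nf_rev_cat rui vi Lr uv.
rewrite revK => ->; rewrite rev_drop revK size_rev.
rewrite takel_cat; last by rewrite size_take; case: ifP; lia.
by rewrite take_takel//; lia.
Qed.

(** At each end of v fewer than L letters of u cancel, out of at least 2 L, so the length grows. The
    two prefix clauses make the step repeatable: the result and its inverse begin like the inverse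
    of u, whatever v was. *)
Lemma conj_nf L u v : irr u -> irr v -> 2 * L <= size u -> 2 * L <= size v ->
  take L u != take L v -> take L u != take L (rev v) ->
  let w := nf (rev u ++ v ++ u) in
  [/\ size v < size w, take L w = take L (rev u) &
      take L (rev w) = take L (rev u)].
Proof.
move=> ui vi Lu Lv uv urv w.
have [|c cL E] := nf_rev_cat ui vi _ uv; first lia.
set t := rev (drop c u) ++ drop c v in E.
have ti : irr t by rewrite -E nf_irr.
have st : size t = size u - c + (size v - c).
  by rewrite size_cat size_rev !size_drop.
have rt : take L (rev t) = take L (rev v).
  rewrite rev_cat revK takel_cat ?size_rev ?size_drop; last lia.
  by rewrite rev_drop take_takel//; lia.
have trt : take L (rev t) != take L u by rewrite rt eq_sym.
have rti : irr (rev t) by rewrite irr_rev.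
have [|c' cL' E'] := nf_rev_cat rti ui _ trt; first by rewrite size_rev st; lia.
have wE : w = rev (drop c' (rev t)) ++ drop c' u.
  by rewrite -E' revK -E nf_nf_catl -catA.
have pt : take L t = take L (rev u).
  rewrite takel_cat ?size_rev ?size_drop; last lia.
  by rewrite rev_drop take_takel//; lia.
split.
- by rewrite wE size_cat size_rev !size_drop size_rev st; lia.
- rewrite wE takel_cat ?size_rev ?size_drop ?size_rev ?st; last lia.
  rewrite rev_drop revK size_rev take_takel ?pt// st; lia.
- rewrite wE rev_cat revK takel_cat ?size_rev ?size_drop; last lia.
  by rewrite rev_drop take_takel//; lia.
Qed.

End CoxeterWords.

(** * Recovering a conjugator by peeling *)

Section Substitution.
Context (X : choiceType) (A : eqType) (fl : letter X -> seq A).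
Hypothesis flV : forall l, fl (inv_letter l) = rev (fl l).

Definition flat (w : word X) : seq A := flatten (map fl w).

Lemma flat_cat u v : flat (u ++ v) = flat u ++ flat v.
Proof. by rewrite /flat map_cat flatten_cat. Qed.

Lemma flat_inv w : flat (inv_word w) = rev (flat w).
Proof.
elim: w => // l w IH; rewrite -cat1s inv_word_cat !flat_cat IH rev_cat.
by congr (_ ++ _); rewrite /flat /= !cats0.
Qed.

Lemma size_flat (B : nat) w : (forall l, size (fl l) <= B) ->
  size (flat w) <= B * size w.
Proof.
move=> flB; elim: w => //= l w IH; rewrite /flat /= size_cat -/(flat w).
by rewrite mulnS leq_add.
Qed.

Lemma reduced_cons l (w : word X) :
  reduced (l :: w) = (if w is l' :: _ then l' != inv_letter l else true) &&
                     reduced w.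
Proof. by case: w. Qed.

End Substitution.

Section Peeling.
Context (X I : choiceType) (A : eqType) (fl : letter X -> seq A) (raw : I -> word X).
Hypothesis flV : forall l, fl (inv_letter l) = rev (fl l).
Implicit Types (s t : letter I) (w : word I).

Definition raw_letter s : word X :=
  if s.2 then inv_word (raw s.1) else raw s.1.
Definition raw_word w : word X := flatten (map raw_letter w).

Lemma raw_letter_inv s : raw_letter (inv_letter s) = inv_word (raw_letter s).
Proof.
by case: s => i [] //=; rewrite /raw_letter/= (inv_wordK (raw i)).
Qed.

Lemma raw_word_rcons w s : raw_word (rcons w s) = raw_word w ++ raw_letter s.
Proof. by rewrite /raw_word map_rcons flatten_rcons. Qed.

(** [vo] holds the remaining conjugate and the part of the conjugator found so far. The last letter
    comes off first, so letters are put in front of the output. *)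
Definition peel_step s (vo : seq A * word X) : seq A * word X :=
  let V := nf (flat fl (raw_letter s) ++ vo.1 ++ rev (flat fl (raw_letter s))) in
  if size V < size vo.1 then (V, raw_letter s ++ vo.2) else vo.

Definition peel_pass (ls : seq (letter I)) vo :=
  foldl (fun vo s => peel_step s vo) vo ls.

Let gen s := nf (flat fl (raw_letter s)).

(** The last clause includes [t = inv_letter s]: a generator must not begin like its own inverse. *)
Definition prefix_separated L (U : seq A) :=
  [/\ irr U, 2 * L <= size U,
      forall s, 2 * L <= size (gen s),
      forall s, take L (gen s) != take L U /\ take L (gen s) != take L (rev U) &
      forall s t, s != t -> take L (gen s) != take L (gen t)].

Context (L : nat) (U : seq A).
Hypothesis sepU : prefix_separated L U.

Let conjU w := nf (rev (flat fl (raw_word w)) ++ U ++ flat fl (raw_word w)).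

Let gen_inv s : gen (inv_letter s) = rev (gen s).
Proof. by rewrite /gen raw_letter_inv flat_inv// nf_rev. Qed.

Let conjU_rcons w s : conjU (rcons w s) = nf (rev (gen s) ++ conjU w ++ gen s).
Proof.
rewrite /conjU /gen raw_word_rcons flat_cat rev_cat -!catA.
by rewrite -nf_rev nf_cat3_nf -!catA.
Qed.

Let conjU_nil : conjU [::] = U.
Proof. by case: sepU => ui *; rewrite /conjU /= cats0 nf_id. Qed.

Let conjU_peel w s :
  nf (flat fl (raw_letter s) ++ conjU w ++ rev (flat fl (raw_letter s))) =
  conjU (rcons w (inv_letter s)).
Proof.
by rewrite conjU_rcons gen_inv revK -nf_rev nf_cat3_nf [in RHS]nf_cat
  nf_cat nf_nf_catl.
Qed.

Let conjU_rconsK w s : conjU (rcons (rcons w s) (inv_letter s)) = conjU w.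
Proof.
rewrite /conjU !raw_word_rcons raw_letter_inv !flat_cat flat_inv//.
rewrite !rev_cat revK -!catA nf_invr.
set a := flat fl _; set b := flat fl _.
by have := nf_midV (rev a ++ U ++ a) b [::]; rewrite !cats0 -!catA.
Qed.

Let size_conjU w s : reduced (rcons w s) ->
  size (conjU w) < size (conjU (rcons w s)).
Proof.
case: sepU => ui Usz gsz gU gg.
have gi t : irr (gen t) by exact: nf_irr.
(* Growth alone is not inductive. The ends of the conjugate must be known too, and they are those
   imposed by the last conjugating letter. *)
suff : reduced (rcons w s) ->
    [/\ 2 * L <= size (conjU w), size (conjU w) < size (conjU (rcons w s)),
        take L (conjU (rcons w s)) = take L (gen (inv_letter s)) &
        take L (rev (conjU (rcons w s))) = take L (gen (inv_letter s))].
  by move=> h /h[].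
elim/last_ind: w s => [|w t IH] s red.
  have [g1 g2] := gU s; rewrite conjU_rcons conjU_nil gen_inv.
  by have [h1 h2 h3] := conj_nf (gi s) ui (gsz s) Usz g1 g2.
have redt : reduced (rcons w t).
  by move: red; rewrite /reduced -cats1 => /cat_sorted2[].
have [h0 h1 h2 h3] := IH t redt.
have st : s != inv_letter t.
  move: red; rewrite /reduced -!cats1 -catA /= => /cat_sorted2[_] /=.
  by case/andP.
have sz : 2 * L <= size (conjU (rcons w t)) by apply: leq_trans (ltnW h1).
rewrite [conjU (rcons (rcons w t) s)]conjU_rcons gen_inv.
have g1 : take L (gen s) != take L (conjU (rcons w t)) by rewrite h2 gg.
have g2 : take L (gen s) != take L (rev (conjU (rcons w t))).
  by rewrite h3 gg.
by have [] := conj_nf (gi s) (nf_irr _) (gsz s) sz g1 g2.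
Qed.

(* State of the peeling of [raw_word w0]: the suffix of [w0] that was already
   removed from the conjugator has been written to the output. *)
Let peeling w0 w vo :=
  [/\ reduced w, vo.1 = conjU w & raw_word w ++ vo.2 = raw_word w0].

Let peel_step_rcons w0 w s vo : peeling w0 (rcons w s) vo ->
  peeling w0 w (peel_step s vo).
Proof.
case: vo => V O [/= red -> E]; rewrite /peel_step /= conjU_peel conjU_rconsK.
rewrite size_conjU//; split=> //=.
  by move: red; rewrite /reduced -cats1 => /cat_sorted2[].
by rewrite -E raw_word_rcons -catA.
Qed.

(** Trying a wrong letter amounts to appending its inverse without cancellation; the conjugate grows
    and the trial is rejected. *)
Let peel_step_id w0 w s vo : peeling w0 w vo -> reduced (rcons w (inv_letter s)) ->
  peel_step s vo = vo.
Proof.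
case: vo => V O [/= red -> _] redws; rewrite /peel_step /= conjU_peel.
by rewrite ltnNge (ltnW (size_conjU redws)).
Qed.

Let peeling_step w0 w s vo : peeling w0 w vo ->
  peeling w0 w (peel_step s vo) \/
  exists2 w', size w' < size w & peeling w0 w' (peel_step s vo).
Proof.
move=> pw; case/lastP: w pw => [|w t] pw.
  by left; rewrite (peel_step_id pw).
case: (eqVneq s t) pw => [<-|st] pw.
  by right; exists w; [rewrite size_rcons | exact: peel_step_rcons].
left; rewrite (peel_step_id pw)//.
case: pw => red _ _; move: red; rewrite /reduced.
case: w => [|a w] /=; first by rewrite andbT (inj_eq (can_inj (@inv_letterK I))).
rewrite !rcons_path last_rcons => /andP[-> ->] /=.
by rewrite (inj_eq (can_inj (@inv_letterK I))).
Qed.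

Let peeling_pass w0 w ls vo : peeling w0 w vo ->
  exists2 w', size w' <= size w & peeling w0 w' (peel_pass ls vo).
Proof.
elim: ls w vo => [|s ls IH] w vo pw; first by exists w.
case: (peeling_step s pw) => [/IH//|[w' lt /IH[w'' le pw'']]].
by exists w'' => //; apply: leq_trans le (ltnW lt).
Qed.

(** The last letter of w occurs in the pass. When its turn comes it is removed, unless w has become
    shorter before. *)
Let peeling_pass_full w0 w ls vo : (forall s, s \in ls) ->
  peeling w0 w vo -> w != [::] ->
  exists2 w', size w' < size w & peeling w0 w' (peel_pass ls vo).
Proof.
case/lastP: w => // w s lsP; move: (lsP s) => {lsP}.
elim: ls vo => //= t ls IH vo; rewrite inE => sls pw _.
case: (peeling_step t pw) => [pw'|[w' lt /(peeling_pass ls)[w'' le pw'']]].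
  case/predU1P: sls => [ts|sls]; last first.
    by apply: IH sls pw' _; rewrite -size_eq0 size_rcons.
  move: pw; rewrite ts => /peel_step_rcons /(peeling_pass ls)[w' le pw''].
  by exists w' => //; rewrite size_rcons ltnS.
by exists w'' => //; apply: leq_ltn_trans le lt.
Qed.

Lemma peel_correct ls w n : (forall s, s \in ls) -> reduced w ->
  size (nf (rev (flat fl (raw_word w)) ++ U ++ flat fl (raw_word w))) <= n ->
  (iter n (peel_pass ls) (conjU w, [::])).2 = raw_word w.
Proof.
move=> lsP redw szn.
(* Each letter of w lengthens the conjugate by at least one. *)
have wn : size w <= n.
  apply: leq_trans szn; elim/last_ind: w redw => //= w s IH redw.
  rewrite size_rcons; apply: leq_ltn_trans (size_conjU redw); apply: IH.
  by move: redw; rewrite /reduced -cats1 => /cat_sorted2[].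
suff : exists2 w', size w' <= size w - n &
    peeling w w' (iter n (peel_pass ls) (conjU w, [::])).
  move=> [w']; have -> : size w - n = 0 by lia.
  by case: w' => // _ [] _ _.
elim: n {szn wn} => [|n [w' le pw']].
  by exists w; rewrite ?subn0//; split=> //=; rewrite cats0.
case: (eqVneq w' [::]) pw' => [w'0|w'0] pw'.
  have [w'' le' pw''] := peeling_pass ls pw'.
  by exists w'' => //; move: le'; rewrite w'0 /=; lia.
have [w'' lt pw''] := peeling_pass_full lsP pw' w'0.
by exists w'' => //; lia.
Qed.

End Peeling.

(** * Collisions and ping-pong *)

Section Collisions.
Context (T : eqType).
Implicit Types (s t : seq T).

(* The square of the l2 norm of the counting function of a multiset is the
   number of its collisions. *)
Definition dot s t : nat := \sum_(x <- s) count_mem x t.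

Lemma count_mem_sum (x : T) s : count_mem x s = \sum_(y <- s) (y == x).
Proof. by rewrite -sum1_count big_mkcond; apply: eq_bigr => y _ /=; case: (y == x). Qed.

Lemma dotC s t : dot s t = dot t s.
Proof.
rewrite /dot; under eq_bigr do rewrite count_mem_sum.
rewrite exchange_big; apply: eq_bigr => x _; rewrite count_mem_sum.
by apply: eq_bigr => y _; rewrite eq_sym.
Qed.

Lemma dot_catl s s' t : dot (s ++ s') t = dot s t + dot s' t.
Proof. by rewrite /dot big_cat. Qed.

Lemma dot_catr s t t' : dot s (t ++ t') = dot s t + dot s t'.
Proof. by rewrite dotC dot_catl dotC (dotC t'). Qed.

Lemma dot_flattenl (ss : seq (seq T)) t :
  dot (flatten ss) t = \sum_(s <- ss) dot s t.
Proof. by rewrite /dot big_flatten. Qed.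

Lemma dot_flattenr s (tt : seq (seq T)) :
  dot s (flatten tt) = \sum_(t <- tt) dot s t.
Proof. by rewrite dotC dot_flattenl; apply: eq_bigr => t _; rewrite dotC. Qed.

Lemma dot_perm s s' : perm_eq s s' -> dot s s = dot s' s'.
Proof.
move=> ss'; rewrite /dot (perm_big _ ss') /=; apply: eq_bigr => x _.
by move/seq.permP: ss' => ->.
Qed.

(** Passes from a multiset to its support, which gives [dot] in coordinates. *)
Lemma sum_count_mem s (U : seq T) (F : T -> nat) : uniq U -> {subset s <= U} ->
  \sum_(x <- s) F x = \sum_(x <- U) count_mem x s * F x.
Proof.
move=> uU sU; under [RHS]eq_bigr do rewrite count_mem_sum big_distrl /=.
rewrite exchange_big /= big_seq [RHS]big_seq; apply: eq_bigr => y ys.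
rewrite (bigD1_seq y) ?sU//= eqxx mul1n big1 ?addn0// => z zy.
by rewrite eq_sym (negPf zy).
Qed.

Lemma dot_sum_undup s t :
  dot s t = \sum_(x <- undup (s ++ t)) count_mem x s * count_mem x t.
Proof.
apply: sum_count_mem; first exact: undup_uniq.
by move=> x xs; rewrite mem_undup mem_cat xs.
Qed.

Lemma dot_double s t : 2 * dot s t <= dot s s + dot t t.
Proof.
have h u : {subset u <= s ++ t} ->
    dot u u = \sum_(x <- undup (s ++ t)) count_mem x u * count_mem x u.
  move=> us; apply: sum_count_mem; first exact: undup_uniq.
  by move=> x xu; rewrite mem_undup us.
have ss : {subset s <= s ++ t} by move=> x xs; rewrite mem_cat xs.
have ts : {subset t <= s ++ t} by move=> x xs; rewrite mem_cat xs orbT.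
rewrite (h s ss) (h t ts) dot_sum_undup.
rewrite big_distrr -big_split /=; apply: leq_sum => x _.
by rewrite !mulnn; exact: (nat_Cauchy _ _).1.
Qed.

Lemma dot_map (T' : eqType) (f : T' -> T) (s : seq T') :
  {in s &, injective f} ->
  dot (map f s) (map f s) = \sum_(x <- s) count_mem x s.
Proof.
move=> fi; rewrite /dot big_map big_seq [RHS]big_seq; apply: eq_bigr => x xs.
by rewrite count_map; apply: eq_in_count => y ys /=; rewrite (inj_in_eq fi).
Qed.

Lemma dot_disjoint s t : {in s, forall x, x \notin t} -> dot s t = 0.
Proof.
move=> st; rewrite /dot big_seq big1 // => x xs.
by apply/count_memPn; exact: st.
Qed.

Lemma dot_filter (p : pred T) s : dot (filter p s) (filter p s) =
  \sum_(x <- s | p x) count_mem x s.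
Proof.
rewrite /dot big_filter; apply: eq_bigr => x px.
rewrite count_filter; apply: eq_count => y /=.
by case: eqP => // ->; rewrite px.
Qed.

(** The copies of x collide with one another. *)
Lemma count_mem_le_dot x s : count_mem x s ^ 2 <= dot s s.
Proof.
have -> : count_mem x s ^ 2 = \sum_(y <- s | y == x) count_mem y s.
  rewrite (eq_bigr (fun=> count_mem x s)); last by move=> y /eqP ->.
  by rewrite big_const_seq iter_addn_0 -mulnn mulnC.
by rewrite /dot [leqRHS](bigID (pred1 x)) /= leq_addr.
Qed.

End Collisions.

Section PingPong.
Context (T : eqType) (I : eqType) (l : seq I) (G : I -> T -> T) (s : seq T).
Context (att rep : I -> pred T).
Hypothesis ul : uniq l.
Hypothesis Ginj : {in l, forall i, {in s &, injective (G i)}}.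
Hypothesis Gatt : {in l, forall i, {in s, forall x, ~~ rep i x -> att i (G i x)}}.
Hypothesis att_disj : {in l &, forall i j, forall x, att i x -> att j x -> i = j}.
Hypothesis rep_disj : {in l &, forall i j, forall x, rep i x -> rep j x -> i = j}.

Let img p i := map (G i) (filter (p i) s).
Let nrep i x := ~~ rep i x.

Let dot_img (p : I -> pred T) i : i \in l ->
  dot (img p i) (img p i) = dot (filter (p i) s) (filter (p i) s).
Proof.
move=> il; rewrite dot_map// => x y; rewrite !mem_filter => /andP[_ xs] /andP[_ ys].
exact: Ginj.
Qed.

(** Cauchy-Schwarz costs a factor [size l], but the repelling sets are disjoint, so each element of
    s is used at most once. *)
Let dot_rep : dot (flatten (map (img rep) l)) (flatten (map (img rep) l)) <=
  size l * dot s s.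
Proof.
suff h : 2 * dot (flatten (map (img rep) l)) (flatten (map (img rep) l)) <=
    2 * (size l * \sum_(i <- l) dot (img rep i) (img rep i)).
  rewrite -(leq_pmul2l (m := 2))//; apply: leq_trans h _.
  rewrite !leq_mul2l /=; apply/orP; right.
  rewrite big_seq; under eq_bigr => i il do rewrite dot_img// dot_filter big_mkcond.
  rewrite -big_seq exchange_big /=; apply: leq_sum => x _.
  have [/hasP[i il ix]|/hasPn nr] := boolP (has (fun i => rep i x) l).
    rewrite (bigD1_seq i)//= ix big_seq_cond big1 ?addn0// => j /andP[jl ji].
    by case: ifP => // jx; move: ji; rewrite (rep_disj il jl ix jx) eqxx.
  by rewrite big_seq big1 // => i il; rewrite (negPf (nr i il)).
rewrite dot_flattenl big_map big_distrr /=.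
apply: leq_trans (_ : \sum_(i <- l) \sum_(j <- l)
   (dot (img rep i) (img rep i) + dot (img rep j) (img rep j)) <= _).
  apply: leq_sum => i _; rewrite dot_flattenr big_map big_distrr /=.
  by apply: leq_sum => j _; exact: dot_double.
under eq_bigr do rewrite big_split /=.
rewrite big_split /=.
rewrite (eq_bigr (fun i => size l * dot (img rep i) (img rep i))); last first.
  by move=> i _; rewrite big_const_seq count_predT iter_addn_0 mulnC.
rewrite -big_distrr /= [X in _ + X]big_const_seq count_predT iter_addn_0.
by rewrite mul2n -addnn (mulnC _ (size l)).
Qed.

(** Outside the repelling sets the images lie in disjoint attracting sets, hence are orthogonal, and
    the squared norms add up. *)
Let dot_nrep : dot (flatten (map (img nrep) l)) (flatten (map (img nrep) l)) <=
  size l * dot s s.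
Proof.
rewrite dot_flattenl big_map.
have -> : size l * dot s s = \sum_(i <- l) dot s s.
  by rewrite big_const_seq count_predT iter_addn_0 mulnC.
rewrite big_seq [leqRHS]big_seq; apply: leq_sum => i il.
rewrite dot_flattenr big_map (bigD1_seq i)//= big_seq_cond big1 ?addn0.
  by rewrite dot_img// dot_filter [leqRHS](bigID (nrep i)) /= leq_addr.
move=> j /andP[jl ji]; apply: dot_disjoint => _ /mapP[x + ->].
rewrite mem_filter => /andP[nx xs]; apply/negP => /mapP[y].
rewrite mem_filter => /andP[ny ys] E; move/eqP: ji; apply; apply/esym.
by apply: (att_disj il jl (Gatt il xs nx)); rewrite E; apply: Gatt.
Qed.

(** Each translate is split into the image of the repelling part and that of its complement. Both
    totals have squared norm at most [size l * dot s s], and the squared norm of a sum of two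
    vectors is at most twice the sum of theirs; hence the 4. *)
Lemma dot_ping_pong :
  dot (flatten [seq map (G i) s | i <- l]) (flatten [seq map (G i) s | i <- l])
    <= 4 * size l * dot s s.
Proof.
set E := flatten (map (img rep) l); set F := flatten (map (img nrep) l).
have pEF : perm_eq (flatten [seq map (G i) s | i <- l]) (E ++ F).
  rewrite /E /F; elim: (l) => //= i l' IH.
  have h : perm_eq (map (G i) s) (img rep i ++ img nrep i).
    by rewrite /img -map_cat perm_map// perm_sym perm_filterC.
  apply/seq.permP => p; move/seq.permP/(_ p): h; move/seq.permP/(_ p): IH.
  by rewrite !count_cat => -> ->; lia.
rewrite (dot_perm pEF) dot_catl !dot_catr (dotC F E).
have := dot_double E F; have := dot_rep; have := dot_nrep.
rewrite -/E -/F; lia.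
Qed.
End PingPong.

(** * The l2 norm in an ordered field *)

Section Norm.
Context (R : realFieldType) (T : eqType).
Implicit Types (s t : seq T) (a b : R).
Local Open Scope ring_scope.

(** Squares on both sides avoid roots, which a [realFieldType] may lack. *)
Definition norm_le s a : Prop := (dot s s)%:R <= a ^+ 2.

Lemma norm_le_mono s a b : 0 <= a -> a <= b -> norm_le s a -> norm_le s b.
Proof.
move=> a0 ab; rewrite /norm_le => h; apply: le_trans h _.
by rewrite ler_sqr ?nnegrE// (le_trans a0).
Qed.

(* Weighted AM-GM, applied to the difference of multiples of the two counting
   functions. *)
Lemma dot_AMGM s t a b :
  2 * a * b * (dot s t)%:R <= b ^+ 2 * (dot s s)%:R + a ^+ 2 * (dot t t)%:R.
Proof.
have h u : {subset u <= s ++ t} ->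
    dot u u = (\sum_(x <- undup (s ++ t)) count_mem x u * count_mem x u)%N.
  move=> us; apply: sum_count_mem; first exact: undup_uniq.
  by move=> x xu; rewrite mem_undup us.
have ss : {subset s <= s ++ t} by move=> x xs; rewrite mem_cat xs.
have ts : {subset t <= s ++ t} by move=> x xs; rewrite mem_cat xs orbT.
rewrite (h s ss) (h t ts) dot_sum_undup.
rewrite !natr_sum !mulr_sumr -big_split /=; apply: ler_sum => x _.
rewrite !natrM -subr_ge0; set c := _%:R; set d := _%:R.
have -> : b ^+ 2 * (c * c) + a ^+ 2 * (d * d) - 2 * a * b * (c * d) =
  (b * c - a * d) ^+ 2 by ring.
exact: sqr_ge0.
Qed.

(** Triangle inequality; the mixed term is bounded by [dot_AMGM], weighted with the two bounds
    themselves. *)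
Lemma norm_le_cat s t a b : 0 < a -> 0 < b -> norm_le s a -> norm_le t b ->
  norm_le (s ++ t) (a + b).
Proof.
rewrite /norm_le => a0 b0 sa tb.
rewrite dot_catl !dot_catr (dotC t s) !natrD.
have h : a * b * (2 * (dot s t)%:R) <= a * b * (2 * (a * b)).
  have := dot_AMGM s t a b.
  have : b ^+ 2 * (dot s s)%:R <= b ^+ 2 * a ^+ 2 by rewrite ler_pM2l ?exprn_gt0.
  have : a ^+ 2 * (dot t t)%:R <= a ^+ 2 * b ^+ 2 by rewrite ler_pM2l ?exprn_gt0.
  by nra.
by rewrite ler_pM2l ?mulr_gt0// in h; nra.
Qed.

Lemma norm_le_nil a : norm_le [::] a.
Proof. by rewrite /norm_le /dot big_nil sqr_ge0. Qed.

Lemma norm_le_flatten (ss : seq (seq T)) a : 0 < a ->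
  {in ss, forall s, norm_le s a} -> norm_le (flatten ss) ((size ss)%:R * a).
Proof.
move=> a0; elim: ss => [|s ss IH] h; first exact: norm_le_nil.
have hs : norm_le s a by apply: h; exact: mem_head.
have {}IH := IH (fun t ts => h t (mem_behead (s := s :: ss) ts)).
rewrite /= mulrS mulrDl mul1r.
case: ss {h} IH => [|t ss] IH; first by rewrite /= cats0 mul0r addr0.
by apply: norm_le_cat => //; rewrite mulr_gt0// ltr0n.
Qed.

Lemma norm_le_perm s t a : perm_eq s t -> norm_le s a -> norm_le t a.
Proof. by move=> st; rewrite /norm_le (dot_perm st). Qed.

Lemma count_mem_le_norm x s a : 0 <= a -> norm_le s a ->
  (count_mem x s)%:R <= a.
Proof.
move=> a0; rewrite /norm_le => sa.
rewrite -ler_sqr ?nnegrE ?ler0n// -natrX; apply: le_trans sa.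
by rewrite ler_nat count_mem_le_dot.
Qed.

End Norm.

Arguments reduced : simpl never.

Lemma flatten_map_flatten (S T : Type) (f : S -> seq T) (ss : seq (seq S)) :
  flatten (map f (flatten ss)) = flatten [seq flatten (map f s) | s <- ss].
Proof. by elim: ss => //= s ss IH; rewrite map_cat flatten_cat IH. Qed.

(** * Enumeration of reduced words and of their initial blocks *)

Section ReducedWords.
Context (X : finType).
Implicit Types (l : letter X) (w b : word X).

Definition succ l : seq (letter X) := [seq l' <- enum {: letter X} | l' != inv_letter l].
Definition degree := #|{: letter X}|.-1.

(* The reduced words of length [n.+1] that start with [l]. *)
Fixpoint words n l : seq (word X) :=
  [seq l :: w | w <- if n is n'.+1 then flatten [seq words n' l' | l' <- succ l]
                     else [:: [::]]].

(* The pairs [(b, l')] such that [rcons b l'] is reduced of length [n.+2] and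
   starts with [l]. *)
Fixpoint blocks n l : seq (word X * letter X) :=
  if n is n'.+1 then
    flatten [seq [seq (l :: p.1, p.2) | p <- blocks n' l'] | l' <- succ l]
  else [seq ([:: l], l') | l' <- succ l].

Lemma size_succ l : size (succ l) = degree.
Proof.
rewrite size_filter /degree cardE (eq_count (a2 := predC1 (inv_letter l)))//.
by rewrite -(count_predC (pred1 (inv_letter l))) count_uniq_mem ?enum_uniq// mem_enum.
Qed.

Lemma mem_succ l l' : (l' \in succ l) = (l' != inv_letter l).
Proof. by rewrite mem_filter mem_enum andbT. Qed.

Lemma uniq_succ l : uniq (succ l).
Proof. by rewrite filter_uniq ?enum_uniq. Qed.

(** A block carries the letter that follows it, so its continuations are all reduced words with a
    known first letter, independently of the rest of the block. *)
Lemma words_split n n' l : words (n + n'.+1) l =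
  flatten [seq [seq p.1 ++ w | w <- words n' p.2] | p <- blocks n l].
Proof.
elim: n l => [|n IH] l.
  by rewrite /= map_flatten -!map_comp; congr flatten; apply: eq_map.
rewrite addSn /= flatten_map_flatten map_flatten -!map_comp.
congr flatten; apply: eq_map => l' /=.
rewrite IH map_flatten -!map_comp; congr flatten; apply: eq_map => p /=.
by rewrite -map_comp.
Qed.

Lemma size_flatten_const (S T : eqType) (f : S -> seq T) (s : seq S) n :
  {in s, forall x, size (f x) = n} -> size (flatten (map f s)) = size s * n.
Proof.
move=> h; rewrite size_flatten /shape -map_comp sumnE big_map big_seq.
by rewrite (eq_bigr (fun=> n))// -big_seq big_const_seq count_predT iter_addn_0 mulnC.
Qed.

Lemma size_words n l : size (words n l) = degree ^ n.
Proof.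
elim: n l => //= n IH l; rewrite size_map (@size_flatten_const _ _ _ _ (degree ^ n)).
  by rewrite size_succ expnS.
by move=> l' _; rewrite IH.
Qed.

Lemma size_blocks n l : size (blocks n l) = degree ^ n.+1.
Proof.
elim: n l => [|n IH] l /=; first by rewrite size_map size_succ expn1.
rewrite (@size_flatten_const _ _ _ _ (degree ^ n.+1)) ?size_succ -?expnS//.
by move=> l' _; rewrite size_map.
Qed.

Lemma mem_words n l w : (w \in words n l) =
  [&& size w == n.+1, ohead w == Some l & reduced w].
Proof.
elim: n l w => [|n IH] l w /=.
  rewrite inE; apply/eqP/and3P => [->|[]]; first by rewrite /= eqxx.
  by case: w => [|l1 [|]] //= _ /eqP[->].
apply/mapP/and3P => [[u /flattenP[s /mapP[l' l'l ->]]]|].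
  rewrite IH => /and3P[/eqP su hu ru] ->; rewrite /= su eqxx; split=> //.
  rewrite reduced_cons ru andbT; case: u su hu {ru} => //= l1 u _ /eqP[->].
  by rewrite -mem_succ.
case: w => [|l1 w] []//; rewrite [size _]/= [ohead _]/= eqSS => sw /eqP[->].
rewrite reduced_cons => /andP[+ rw].
case: w sw rw => // l2 w sw rw l2l; exists (l2 :: w) => //.
apply/flattenP; exists (words n l2); last by rewrite IH sw rw /= eqxx.
by apply/mapP; exists l2; rewrite ?mem_succ.
Qed.

Lemma mem_blocks n l b l' : ((b, l') \in blocks n l) =
  [&& size b == n.+1, ohead b == Some l & reduced (rcons b l')].
Proof.
elim: n l b l' => [|n IH] l b l' /=.
  apply/mapP/and3P => [[l1 l1l [-> ->]]|].
    by rewrite /= eqxx; split=> //; rewrite /reduced /= andbT -mem_succ.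
  case: b => [|l1 [|? ?]] []//= _ /eqP[->]; rewrite /reduced /= andbT => h.
  by exists l'; rewrite ?mem_succ.
apply/flattenP/and3P => [[s /mapP[l1 l1l ->] /mapP[[b' l2]]]|].
  rewrite IH => /and3P[/eqP sb hb rb] [-> ->]; rewrite /= sb eqxx; split=> //.
  rewrite reduced_cons rb andbT; case: b' sb hb {rb} => //= l3 u _ /eqP[->].
  by rewrite -mem_succ.
case: b => [|l1 b] []//; rewrite [size _]/= [ohead _]/= eqSS => sb /eqP[->].
rewrite reduced_cons => /andP[+ rb].
case: b sb rb => // l2 b sb rb l2l.
exists [seq (l :: p.1, p.2) | p <- blocks n l2].
  by apply/mapP; exists l2; rewrite ?mem_succ.
by apply/mapP; exists (l2 :: b, l') => //; rewrite IH sb rb /= eqxx.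
Qed.

Lemma uniq_flatten_map (S T : eqType) (f : S -> seq T) (s : seq S) :
  uniq s -> {in s, forall x, uniq (f x)} ->
  {in s &, forall x y, x != y -> {in f x, forall z, z \notin f y}} ->
  uniq (flatten (map f s)).
Proof.
elim: s => //= x s IH /andP[xs us] uf dis; rewrite cat_uniq.
rewrite (uf x (mem_head _ _)) IH//=; first 1 last.
- by move=> y ys; apply: uf; rewrite inE ys orbT.
- by move=> y z ys zs; apply: dis; rewrite inE ?ys ?zs orbT.
rewrite andbT; apply/hasPn => z /flattenP[t /mapP[y ys ->] zy].
have yx : y != x by apply: contraNneq xs => <-.
by apply: (dis y x) zy => //; rewrite inE ?eqxx ?ys ?orbT.
Qed.

Lemma uniq_words n l : uniq (words n l).
Proof.
elim: n l => // n IH l; rewrite /= map_inj_uniq; last by move=> u v [].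
apply: uniq_flatten_map => //; first exact: uniq_succ.
move=> l1 l2 _ _ l12 w; rewrite !mem_words => /and3P[-> /eqP -> ->] /=.
by rewrite andbT; apply: contra l12 => /eqP[->].
Qed.

Lemma uniq_blocks n l : uniq (blocks n l).
Proof.
elim: n l => [|n IH] l /=.
  by rewrite map_inj_uniq ?uniq_succ// => u v [].
apply: uniq_flatten_map => //; first exact: uniq_succ.
  by move=> l' _; rewrite map_inj_uniq// => -[u u'] [v v'] /= [-> ->].
move=> l1 l2 _ _ l12 w /mapP[[b1 m1] + ->] /=.
rewrite mem_blocks => /and3P[_ /eqP b1l _].
apply/negP => /mapP[[b2 m2]]; rewrite mem_blocks => /and3P[_ /eqP b2l _] [E _].
by move: b1l; rewrite E b2l => -[] E'; rewrite E' eqxx in l12.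
Qed.

End ReducedWords.

(** * Contraction of the l2 norm by one block *)

Section Contraction.
Context (R : realFieldType) (X : finType) (A : eqType) (fl : letter X -> seq A).
Implicit Types (l : letter X) (w b : word X).
Local Open Scope ring_scope.

Definition images n l : seq (seq A) := map (fun w => nf (flat fl w)) (words n l).

(* A ping-pong family: the block b sends what its repelling set rep b misses
   into its attracting set att b.  Its d members all have the same length, the
   same first letter and the same following letter x1. *)
Definition special n x1 (d : nat) : Prop :=
  forall l, exists sp : seq (word X),
  exists rep att : word X -> pred (seq A),
  [/\ uniq sp, size sp = d,
      {in sp, forall b, (b, x1) \in blocks n l},
      {in sp, forall b x, irr x -> ~~ rep b x ->
         att b (nf (flat fl b ++ x))} &
      {in sp &, forall b b' x, att b x -> att b' x -> b = b'} /\
      {in sp &, forall b b' x, rep b x -> rep b' x -> b = b'}].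

Lemma nf_catl_inj (u : seq A) : {in irr (A := A) &, injective (fun x => nf (u ++ x))}.
Proof.
move=> x y xi yi E; rewrite -(nf_id xi) -(nf_id yi).
by rewrite -(nf_invl u x) -(nf_invl u y) -nf_nf_catr E nf_nf_catr.
Qed.

(** The special blocks contribute at most 2 sqrt d a, which is at most (d - 1) a from d = 6 on.
    Every other block is an injective translation and contributes at most a. In total one a is
    saved. *)
Lemma norm_le_image_contract n x1 d n' (a : R) : (6 <= d)%N -> special n x1 d ->
  0 < a -> (forall l, norm_le (images n' l) a) ->
  forall l, norm_le (images (n + n'.+1) l)
    (((degree X) ^ n.+1)%:R * a - a).
Proof.
move=> d6 spec a0 na l; have [sp [rep [att [usp ssp spb Gatt [adisj rdisj]]]]] := spec l.
set spp := [seq (b, x1) | b <- sp].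
set rest := [seq p <- blocks n l | p \notin spp].
have uspp : uniq spp by rewrite map_inj_uniq// => b b' [].
have pb : perm_eq (blocks n l) (spp ++ rest).
  rewrite -(perm_filterC (mem spp)) perm_cat2r.
  apply: uniq_perm; [exact: filter_uniq (uniq_blocks _ _)|exact: uspp|].
  move=> p; rewrite mem_filter /=; apply: andb_idr => /mapP[b bsp ->].
  exact: spb.
have srest : (size rest + d = degree X ^ n.+1)%N.
  by rewrite -(size_blocks n l) (perm_size pb) size_cat size_map ssp addnC.
set G := fun (b : word X) (x : seq A) => nf (flat fl b ++ x).
have iE : images (n + n'.+1) l =
    flatten [seq map (G p.1) (images n' p.2) | p <- blocks n l].
  rewrite /images words_split map_flatten -map_comp; congr flatten.
  apply: eq_map => p /=; rewrite -!map_comp; apply: eq_map => w /=.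
  by rewrite /G flat_cat nf_nf_catr.
have irrI n1 l1 : {in images n1 l1, forall x, irr x}.
  by move=> x /mapP[w _ ->]; exact: nf_irr.
have Ginj b n1 l1 : {in images n1 l1 &, injective (G b)}.
  by move=> x y /irrI xi /irrI yi; exact: nf_catl_inj.
have pI : perm_eq
    (flatten [seq map (G b) (images n' x1) | b <- sp] ++
     flatten [seq map (G p.1) (images n' p.2) | p <- rest])
    (images (n + n'.+1) l).
  rewrite iE perm_sym; have := perm_flatten
    (perm_map (fun p => map (G p.1) (images n' p.2)) pb).
  by rewrite map_cat flatten_cat /spp -map_comp.
apply: norm_le_perm pI _.
have n1 : norm_le (flatten [seq map (G b) (images n' x1) | b <- sp])
    ((d%:R - 1) * a).
  rewrite /norm_le; have := @dot_ping_pong _ _ sp G (images n' x1) att rep usp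
    (fun b _ => Ginj b n' x1) _ _ _.
  rewrite ssp => h; have {}h : (dot (flatten [seq map (G b) (images n' x1) | b <- sp])
    (flatten [seq map (G b) (images n' x1) | b <- sp]) <=
      4 * d * dot (images n' x1) (images n' x1))%N.
    apply: h => //.
    - by move=> b bsp x /irrI; exact: Gatt.
  move: h; rewrite -(ler_nat R) => h; apply: le_trans h _.
  rewrite !natrM exprMn.
  have d6' : (6 : R) <= d%:R by rewrite (ler_nat R 6).
  have := na x1; rewrite /norm_le => h.
  have h4 : 4 * d%:R <= (d%:R - 1) ^+ 2 :> R by nra.
  by apply: ler_pM => //; rewrite ?mulr_ge0 ?ler0n.
have -> : ((degree X) ^ n.+1)%:R * a - a = (d%:R - 1) * a + (size rest)%:R * a.
  by rewrite -srest natrD; ring.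
case: (posnP (size rest)) => [s0|s0].
  by rewrite s0 mul0r addr0 (size0nil s0) /= cats0.
apply: norm_le_cat => //.
- by rewrite mulr_gt0// subr_gt0 (ltr_nat R 1); lia.
- by rewrite mulr_gt0// ltr0n.
rewrite -(size_map (fun p => map (G p.1) (images n' p.2))).
apply: norm_le_flatten => // s /mapP[p _ ->]; rewrite /norm_le dot_map; last exact: Ginj.
exact: na.
Qed.

End Contraction.

(** * Ping-pong words *)

Section Patterns.

(* The periodic word 2 (01)^j 2 (01)^j ..., with p = 2 j + 1. *)
Definition color (p i : nat) : 'I_3 :=
  if i %% p == 0 then inord 2 else if odd (i %% p) then inord 0 else inord 1.
Definition pattern p n : seq 'I_3 := mkseq (color p) n.

Lemma color2 p i : (color p i == inord 2) = (p %| i).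
Proof.
rewrite /color /dvdn; case: (_ == 0); first by rewrite eqxx.
by case: odd; apply/eqP => /(congr1 val); rewrite /= !inordK.
Qed.

Lemma color_succ p i : odd p -> 1 < p -> color p i != color p i.+1.
Proof.
move=> op p1; have d01 : inord 0 != inord 1 :> 'I_3.
  by apply/eqP => /(congr1 val); rewrite /= !inordK.
have d02 : inord 0 != inord 2 :> 'I_3.
  by apply/eqP => /(congr1 val); rewrite /= !inordK.
have d12 : inord 1 != inord 2 :> 'I_3.
  by apply/eqP => /(congr1 val); rewrite /= !inordK.
have E : (i %% p).+1 %% p = i.+1 %% p by rewrite -addn1 modnDml addn1.
have -> : color p i.+1 = color p (i %% p).+1 by rewrite /color E.
have -> : color p i = color p (i %% p) by rewrite /color modn_mod.
have : i %% p < p by rewrite ltn_mod; lia.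
move: (i %% p) => j jp; rewrite /color (modn_small jp).
case: (ltngtP j.+1 p) => jp'; [|lia|].
- rewrite (modn_small jp') /=; case: j {jp jp'} => [|j] /=; first by rewrite eq_sym.
  by case: (odd j); rewrite /= // eq_sym.
- rewrite jp' modnn eqxx; case: j {jp} jp' => [|j] jp' /=; first by lia.
  have oj : odd j by move: op; rewrite -jp' /= negbK.
  by rewrite oj.
Qed.

Lemma irr_pattern p n : odd p -> 1 < p -> irr (pattern p n).
Proof.
move=> op p1; apply/(sortedP (inord 0)) => i; rewrite size_mkseq => i1.
by rewrite !nth_mkseq ?(ltnW i1)// color_succ.
Qed.

(** On a window of length W, f is the indicator of a residue class modulo p. The shift b is unknown
    because cancellation displaces the pattern. *)
Definition marked W (f : nat -> bool) p :=
  exists b, forall i, i < W -> f i = (p %| b + i).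

(** A window of length 2 p contains two marked positions at distance p; seen with the other period,
    this distance is a multiple of q. *)
Lemma marked_inj W f p q : 0 < p -> 0 < q -> p + p <= W -> q + q <= W ->
  marked W f p -> marked W f q -> p = q.
Proof.
move=> p0 q0; move: p q p0 q0; suff h p q : 0 < p -> p + p <= W ->
    marked W f p -> marked W f q -> q %| p.
  move=> p q p0 q0 pW qW fp fq; apply/eqP; rewrite eqn_dvd.
  by rewrite (h q p)// (h p q).
move=> p0 pW [b fb] [c fc].
pose t := (p - b %% p) %% p.
have tp : t < p by rewrite ltn_mod.
have pt : p %| b + t.
  rewrite /t /dvdn modnDmr -modnDml subnKC ?modnn//.
  by rewrite ltnW// ltn_mod.
have tW : t < W by lia.
have tpW : t + p < W by lia.
have h1 : q %| c + t by rewrite -(fc _ tW) (fb _ tW).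
have : q %| c + (t + p) by rewrite -(fc _ tpW) (fb _ tpW) addnA dvdn_addl.
by rewrite addnA dvdn_addr.
Qed.

(* Up to a shift, the middle part of a reduced word survives multiplication by
   short words. *)
Lemma nf_window (A : eqType) (x0 : A) B (P v S : seq A) : irr v ->
  size P <= B -> size S <= B -> 2 * B <= size v ->
  size v <= size (nf (P ++ v ++ S)) + 2 * B /\
  exists a, forall i, 2 * B + i < size v - 2 * B ->
    nth x0 (nf (P ++ v ++ S)) (2 * B + i) = nth x0 v (a + i) /\
    a + i < size v.
Proof.
move=> vi PB SB vB; set g1 := nf (P ++ v).
have gE : nf (P ++ v ++ S) = nf (g1 ++ S) by rewrite nf_nf_catl -catA.
have g1i : irr g1 := nf_irr _.
have e1 := @take_nf_catr _ (rev v) (rev P) _.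
rewrite irr_rev -rev_cat nf_rev -/g1 !size_rev in e1.
move/(_ vi)/(congr1 rev): e1; rewrite !take_rev !revK => e1.
have sz1 : size v - size P <= size g1.
  have := congr1 size e1; rewrite !size_drop; lia.
have sz1' : size g1 <= size P + size v.
  by apply: leq_trans (size_nf _) _; rewrite size_cat.
have e2 := take_nf_catr S g1i.
have sz2 : size g1 - size S <= size (nf (g1 ++ S)).
  have := congr1 size e2; rewrite !size_take.
  by case: ifP; case: ifP; lia.
split; first by rewrite gE; lia.
exists (size P + (2 * B - (size g1 - (size v - size P)))) => i iB.
split; last lia.
rewrite gE -(nth_take x0 (n0 := size g1 - size S)); last lia.
rewrite e2 nth_take; last lia.
have -> : 2 * B + i = (size g1 - (size v - size P)) +
   (2 * B - (size g1 - (size v - size P)) + i) by lia.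
rewrite -nth_drop e1 nth_drop; congr nth; lia.
Qed.

Lemma nf_pattern_marked B p n W (P S : seq 'I_3) : odd p -> 1 < p ->
  size P <= B -> size S <= B -> 4 * B + W <= n ->
  let g := nf (P ++ pattern p n ++ S) in
  marked W (fun i => nth (inord 0) g (2 * B + i) == inord 2) p /\
  marked W (fun i => nth (inord 0) (rev g) (2 * B + i) == inord 2) p.
Proof.
move=> op p1 PB SB nB g; have vi := irr_pattern n op p1.
have sv : size (pattern p n) = n by rewrite size_mkseq.
split.
  have [|_ [a ha]] := nf_window (inord 0) vi PB SB; first by rewrite sv; lia.
  exists a => i iW; rewrite sv in ha; have [|-> ai] := ha i; first lia.
  by rewrite nth_mkseq// color2.
have rvi : irr (rev (pattern p n)) by rewrite irr_rev.
have rg : rev g = nf (rev S ++ rev (pattern p n) ++ rev P).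
  by rewrite -nf_rev !rev_cat -catA.
have [|||_ [a ha]] := @nf_window _ (inord 0) B (rev S) _ (rev P) rvi.
- by rewrite size_rev.
- by rewrite size_rev.
- by rewrite size_rev sv; lia.
(* Reading backwards negates the offset; multiplying by p - 1 does the same modulo p within the
   natural numbers. *)
exists (p.-1 * (n - a.+1)) => i iW; rewrite size_rev sv in ha.
have [|h ai] := ha i; first lia.
rewrite rg h nth_rev ?sv// nth_mkseq; last lia.
rewrite color2.
have : p %| (p.-1 * (n - a.+1) + i) + (n - (a + i).+1).
  have -> : (p.-1 * (n - a.+1) + i) + (n - (a + i).+1) = p * (n - a.+1).
    have -> : n - (a + i).+1 = n - a.+1 - i by lia.
    rewrite -addnA subnKC; last by lia.
    by rewrite -mulSnr prednK// ltnW.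
  exact: dvdn_mulr.
by move=> pd; apply/idP/idP => h'; move: pd; rewrite ?(dvdn_addr _ h')// ?(dvdn_addl _ h').
Qed.

End Patterns.

Section Special.
Context (X : finType) (fl : letter X -> seq 'I_3).
Hypothesis flV : forall l, fl (inv_letter l) = rev (fl l).
Hypothesis rank : 4 <= #|{: letter X}|.
Hypothesis surj : forall u : seq 'I_3, ~~ odd (size u) ->
  exists e : word X, nf (flat fl e) = nf u.
Implicit Types (l : letter X) (w e : word X).

Lemma avoid_letters l1 l2 : exists y : letter X, y != l1 /\ y != l2.
Proof.
case: (pickP (fun y : letter X => (y != l1) && (y != l2))) => [y /andP[]|h].
  by exists y.
have : #|{: letter X}| <= #|[set l1; l2]|.
  apply: subset_leq_card; apply/fintype.subsetP => y _.
  by move: (h y); rewrite !inE; case: eqP => // _; case: eqP.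
by rewrite cards2; case: eqP; lia.
Qed.

Definition cancel_letter l w : word X :=
  if w is l' :: w' then if l' == inv_letter l then w' else l :: w else [:: l].
Definition free_reduce w : word X := foldr cancel_letter [::] w.

Lemma reduced_free_reduce w : reduced (free_reduce w).
Proof.
elim: w => //= l w; case: (free_reduce w) => //= l' w'.
case: ifP => [_|h r]; last by rewrite reduced_cons h.
by rewrite reduced_cons => /andP[].
Qed.

Lemma nf_flat_free_reduce w : nf (flat fl (free_reduce w)) = nf (flat fl w).
Proof.
have cancel l u : nf (flat fl (cancel_letter l u)) = nf (fl l ++ flat fl u).
  case: u => [|l' u] //=; case: eqP => [->|_] //.
  by rewrite /flat /= -/(flat fl u) flV nf_invr.
elim: w => //= l w IH; rewrite cancel -nf_nf_catr IH nf_nf_catr.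
by [].
Qed.

(* Words that concatenate without free cancellation. *)
Definition closed_at x1 e := exists2 e', e = x1 :: e' &
  path (fun l l' => l' != inv_letter l) x1 e' /\ last x1 e' = x1.

(** A lift of the pattern exists by [surj], but its first and last letters are unknown. Two more
    letters on each side make it start and end with x1 without cancellation, at the price of short
    words P and S around the pattern. *)
Lemma padding x1 B p : (forall l, size (fl l) <= B) -> odd p -> 1 < p ->
  forall n, ~~ odd n -> 0 < n ->
  exists e, closed_at x1 e /\ exists P S, [/\ size P <= 2 * B, size S <= 2 * B &
    nf (flat fl e) = nf (P ++ pattern p n ++ S)].
Proof.
move=> flB op p1 n on n0.
have [|e0 e0E] := surj (u := pattern p n); first by rewrite size_mkseq.
have vi := irr_pattern n op p1.
set e1 := free_reduce e0.
have e1E : nf (flat fl e1) = pattern p n by rewrite nf_flat_free_reduce e0E nf_id.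
have re1 : reduced e1 := reduced_free_reduce e0.
case: e1 e1E re1 => [E|l e E re].
  by move: n0; rewrite -(size_mkseq (color p) n) -/(pattern p n) -E.
have [y [yx yl]] := avoid_letters (inv_letter x1) (inv_letter l).
have [z [zx zl]] := avoid_letters (inv_letter x1) (inv_letter (last l e)).
exists ([:: x1; y] ++ (l :: e) ++ [:: z; x1]); split.
  exists (y :: (l :: e) ++ [:: z; x1]) => //; rewrite /= cat_path last_cat /=.
  have invC (a b : letter X) : a != inv_letter b -> b != inv_letter a.
    by apply: contra => /eqP ->; rewrite (inv_letterK a).
  rewrite yx zl (invC _ _ yl) (invC _ _ zx) !andbT.
  by split=> //; move: re; rewrite /reduced /= => ->.
exists (flat fl [:: x1; y]), (flat fl [:: z; x1]); split.
- by rewrite mulnC; exact: size_flat.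
- by rewrite mulnC; exact: size_flat.
- by rewrite !flat_cat -E nf_cat [in RHS]nf_cat nf_nf_catl.
Qed.

Lemma inv_letter_neq l : l != inv_letter l.
Proof. by case: l => x []; apply/eqP => -[]. Qed.

Lemma closed_cat x1 u v : closed_at x1 u -> closed_at x1 v -> closed_at x1 (u ++ v).
Proof.
move=> [u' -> [pu lu]] [v' -> [pv lv]]; exists (u' ++ x1 :: v') => //.
by rewrite cat_path last_cat /= pu lu lv pv inv_letter_neq.
Qed.

Lemma closed_flatten x1 (E : nat -> word X) (j : nat) js :
  (forall i, closed_at x1 (E i)) -> closed_at x1 (flatten (map E (j :: js))).
Proof.
move=> cE; elim: js j => [|i js IH] j; first by rewrite /= cats0.
by rewrite map_cons /=; apply: closed_cat => //; exact: IH.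
Qed.

(** Induction from the right: a factor loses fewer than L letters to what follows, since what
    follows begins like the next factor. *)
Lemma take_nf_product (E : nat -> word X) L x j js (P : pred nat) :
  (forall i, 2 * L <= size (nf (flat fl (E i)))) ->
  {in P &, forall i i', i != i' ->
    take L (nf (flat fl (E i))) != take L (rev (nf (flat fl (E i'))))} ->
  irr x -> uniq (j :: js) -> all P (j :: js) ->
  take L x != take L (rev (nf (flat fl (E (last j js))))) ->
  take L (nf (flat fl (flatten (map E (j :: js))) ++ x)) =
    take L (nf (flat fl (E j))).
Proof.
move=> szE sepE xi; elim: js j => [|i js IH] j.
  by move=> _ _ h; rewrite /= cats0 -nf_nf_catl take_nf_cat// nf_irr.
move=> uj /= /andP[Pj Pis] h.
have {}IH := IH i _ Pis h.
have ij : i != j by move: uj; rewrite /= inE negb_or eq_sym => /andP[/andP[]].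
move: uj => /= /andP[_ /IH{}IH].
rewrite flat_cat -catA -nf_cat_nf take_nf_cat ?nf_irr// IH.
by apply: sepE => //; case/andP: Pis.
Qed.

(** Six words E j carry patterns of different periods, so their ends are distinct. Each block
    multiplies all six in one of the six cyclic orders: the lengths agree, as a common n in
    [special] demands, yet the first and last factors differ. Block i attracts towards the prefix of
    factor i + 1 and repels what begins like the inverse of factor i. *)
Lemma exists_special : exists n x1, special fl n x1 6.
Proof.
have [x1 _] : exists x1 : letter X, true.
  by have /card_gt0P[x _] : 0 < #|{: letter X}| by [lia]; exists x.
pose B0 := \max_(l : letter X) size (fl l).
have flB l : size (fl l) <= B0 by exact: leq_bigmax.
pose B := 2 * B0.
(* Twice the largest period: 2 j + 3 with j < 6 goes up to 13. *)
have [W WE] : exists W, W = 26 by exists 26.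
pose L := 2 * B + W.
(* An even length is needed for [surj]. The two lower bounds preserve the window at either end, and
   2 L letters, after multiplication by P and S. *)
have [N [oN N0 N1 N2]] : exists N, [/\ ~~ odd N, 0 < N, 4 * B + W <= N &
    2 * B + 2 * L <= N].
  exists (2 * (4 * B + W)); split; [by rewrite oddM|lia|lia|rewrite /L; lia].
have op (j : nat) : odd (j.*2 + 3) by rewrite oddD odd_double.
have p1 (j : nat) : 1 < j.*2 + 3 by lia.
have padj (j : nat) : exists e, closed_at x1 e /\ exists P S, [/\ size P <= B,
    size S <= B & nf (flat fl e) = nf (P ++ pattern (j.*2 + 3) N ++ S)].
  exact: padding flB (op j) (p1 j) N oN N0.
have {padj} [E Eprop] := boolp.choice padj.
have Eclosed i : closed_at x1 (E i) by case: (Eprop i).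
pose g j := nf (flat fl (E j)).
have gi j : irr (g j) by exact: nf_irr.
have gsz j : 2 * L <= size (g j).
  rewrite /g; have [_ [P [S [PB SB ->]]]] := Eprop j.
  have vi := irr_pattern N (op j) (p1 j).
  have sv : size (pattern (j.*2 + 3) N) = N by rewrite size_mkseq.
  have [|h _] := nf_window (inord 0) vi PB SB; first by rewrite sv; lia.
  by rewrite -(leq_add2r (2 * B)); apply: leq_trans h; rewrite sv addnC.
pose mk (s : seq 'I_3) i := nth (inord 0) (take L s) (2 * B + i) == inord 2.
have mkE s p : marked W (fun i => nth (inord 0) s (2 * B + i) == inord 2) p ->
    marked W (mk s) p.
  by move=> [b h]; exists b => i iW; rewrite -h// /mk nth_take// /L ltn_add2l.
have gm j : marked W (mk (g j)) (j.*2 + 3) /\ marked W (mk (rev (g j))) (j.*2 + 3).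
  rewrite /g; have [_ [P [S [PB SB ->]]]] := Eprop j.
  have [h1 h2] := nf_pattern_marked (op j) (p1 j) PB SB N1.
  by split; apply: mkE.
have sep s s' (i j : nat) : i < 6 -> j < 6 -> i != j ->
    marked W (mk s) (i.*2 + 3) -> marked W (mk s') (j.*2 + 3) ->
    take L s != take L s'.
  move=> i6 j6 ij mi mj; apply: contra ij => /eqP E0.
  have mj' : marked W (mk s) (j.*2 + 3) by move: mj; rewrite /mk E0.
  have : i.*2 + 3 = j.*2 + 3 by apply: (marked_inj _ _ _ _ mi mj'); lia.
  by move/addIn/double_inj ->.
pose js i := rot i.+1 (iota 0 6).
have jsE i : i < 6 -> exists r, [/\ js i = i.+1 %% 6 :: r, last (i.+1 %% 6) r = i,
    uniq (js i) & all (fun j => j < 6) (js i)].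
  by rewrite /js; do 6?[case: i => [|i]; first by move=> _; eexists; split].
pose F i := flatten (map E (js i)).
have Fclosed i : i < 6 -> closed_at x1 (F i).
  move=> i6; have [r [rE _ _ _]] := jsE i i6.
  by rewrite /F rE; exact: closed_flatten.
have Fsize i : size (F i) = size (flatten (map E (iota 0 6))).
  rewrite /F !size_flatten /shape -!map_comp; apply: perm_sumn.
  by apply: perm_map; rewrite perm_rot.
pose rp i (x : seq 'I_3) := take L x == take L (rev (g i)).
have Fatt i x : i < 6 -> irr x -> ~~ rp i x ->
    take L (nf (flat fl (F i) ++ x)) = take L (g (i.+1 %% 6)).
  move=> i6 xi ni; have [r [rE rl ur ar]] := jsE i i6.
  rewrite /F rE; apply: (take_nf_product (P := fun j => j < 6)) => //.
  - move=> j j' j6 j'6 jj'; apply: sep jj' _ _ => //; first by case: (gm j).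
    by case: (gm j').
  - by rewrite -rE.
  - by rewrite -rE.
  - by rewrite rl.
exists (size (flatten (map E (iota 0 6)))).+1, x1 => l.
(* The prescribed first letter l is joined to x1 by a letter cancelling with neither. Attraction is
   then tested after removing the common factor l y. *)
have [y [yl yx]] := avoid_letters (inv_letter l) (inv_letter x1).
pose b i : word X := l :: y :: F i.
have bE i : flat fl (b i) = flat fl [:: l; y] ++ flat fl (F i).
  by rewrite -flat_cat.
pose at' i (x : seq 'I_3) :=
  take L (nf (rev (flat fl [:: l; y]) ++ x)) == take L (g (i.+1 %% 6)).
have batt i x : i < 6 -> irr x -> ~~ rp i x -> at' i (nf (flat fl (b i) ++ x)).
  move=> i6 xi ni; rewrite /at' nf_nf_catr bE -catA nf_invl.
  by apply/eqP; exact: Fatt.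
have rp_inj i j x : i < 6 -> j < 6 -> rp i x -> rp j x -> i = j.
  move=> i6 j6 /eqP h1 /eqP h2; apply/eqP; case: eqP => // /eqP ij.
  have := sep (rev (g i)) (rev (g j)) i j i6 j6 ij.
  by rewrite -h1 h2 eqxx; case: (gm i) => _ mi; case: (gm j) => _ mj; apply.
have at_inj i j x : i < 6 -> j < 6 -> at' i x -> at' j x -> i = j.
  move=> i6 j6 /eqP h1 /eqP h2.
  have ij : i.+1 %% 6 = j.+1 %% 6.
    apply/eqP; case: eqP => // /eqP ij.
    have := sep (g (i.+1 %% 6)) (g (j.+1 %% 6)) _ _ _ _ ij.
    rewrite -h1 h2 eqxx !ltn_mod => /(_ isT isT).
    by case: (gm (i.+1 %% 6)) => mi _; case: (gm (j.+1 %% 6)) => mj _; apply.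
  by move: i6 j6 ij; clear; do 6?[case: i => [|i]//]; do 6?[case: j => [|j]//].
have rp0 i : ~~ rp i [::].
  have L0 : 0 < L by rewrite /L WE addn_gt0 orbT.
  have le : L <= size (rev (g i)).
    by rewrite size_rev; apply: leq_trans (gsz i); rewrite leq_pmull.
  by apply/eqP => /(congr1 size); rewrite (size_takel le) => E0; rewrite -E0 in L0.
have b_inj i j : i < 6 -> j < 6 -> b i = b j -> i = j.
  move=> i6 j6 bij; have h1 := batt i [::] i6 isT (rp0 i).
  have h2 := batt j [::] j6 isT (rp0 j).
  by apply: (at_inj _ _ _ i6 j6 h1); rewrite bij.
pose sp := map b (iota 0 6).
pose ix w := index w sp.
have usp : uniq sp.
  rewrite map_inj_in_uniq ?iota_uniq// => i j; rewrite !mem_iota /=.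
  by move=> i6 j6; exact: b_inj.
have sps : size sp = 6 by rewrite size_map.
have spE w : w \in sp -> ix w < 6 /\ w = b (ix w).
  move=> wsp; have : index w sp < 6 by rewrite -sps index_mem.
  move=> i6; split=> //; rewrite -{1}(nth_index [::] wsp).
  by rewrite (nth_map 0) ?size_iota// nth_iota.
exists sp, (fun w => rp (ix w)), (fun w => at' (ix w)); split=> //.
- move=> w /spE[i6 ->]; rewrite mem_blocks /= -(Fsize (ix w)) !eqxx /=.
  have [u -> [pu lu]] := Fclosed _ i6.
  rewrite rcons_cons 2!reduced_cons yl /=.
  rewrite /reduced /= rcons_path pu lu inv_letter_neq andbT.
  by rewrite -(inj_eq (can_inj (@inv_letterK X))) inv_letterK eq_sym yx.
- move=> w /spE[i6 wE] x xi nr.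
  by have := batt (ix w) x i6 xi nr; rewrite -wE.
- split=> w w' /spE[i6 wE] /spE[j6 w'E] x h h'; rewrite wE w'E; congr b.
    exact: at_inj h h'.
  exact: rp_inj h h'.
Qed.

End Special.

(** * Counting, short words and geometric sums *)

Section Counting.
Context (T : eqType).

Lemma count_le_sum (p : pred T) (s U : seq T) :
  {in s, forall x, p x -> x \in U} -> count p s <= \sum_(g <- U) count_mem g s.
Proof.
move=> h; rewrite -sum1_count big_mkcond /=.
under [leqRHS]eq_bigr do rewrite count_mem_sum.
rewrite exchange_big /= big_seq [leqRHS]big_seq; apply: leq_sum => x xs.
case: ifP => // px; have xU := h x xs px.
by rewrite (big_rem x)//= eqxx.
Qed.

Lemma count_le_subset (p : pred T) (s U : seq T) : uniq s -> {subset s <= U} ->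
  count p s <= count p U.
Proof.
move=> us sU; rewrite -!size_filter; apply: uniq_leq_size; first exact: filter_uniq.
by move=> x; rewrite !mem_filter => /andP[-> /sU].
Qed.

Lemma count_cover3 (p p1 p2 p3 : pred T) (s : seq T) :
  (forall x, p x -> [|| p1 x, p2 x | p3 x]) ->
  count p s <= count p1 s + count p2 s + count p3 s.
Proof.
move=> h; elim: s => //= x s IH; have := h x.
by case: (p x); case: (p1 x); case: (p2 x); case: (p3 x) => //= h'; lia.
Qed.

Lemma count_flatten_sum (p : pred T) (ss : seq (seq T)) :
  count p (flatten ss) = \sum_(s <- ss) count p s.
Proof. by elim: ss => [|s ss IH]; rewrite ?big_nil// big_cons count_cat IH. Qed.

End Counting.

Section ShortWords.
Context (A : finType).
Fixpoint short_seqs m : seq (seq A) :=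
  if m is m'.+1 then [::] :: [seq a :: s | a <- enum A, s <- short_seqs m']
  else [::].

Lemma mem_short_seqs m (s : seq A) : (s \in short_seqs m) = (size s < m).
Proof.
elim: m s => //= m IH [|a s]; first by rewrite inE eqxx.
rewrite inE /= ltnS -IH; apply/allpairsP/idP => [[[b t] /= [_ ts [_ ->]]]//|sm].
by exists (a, s); rewrite mem_enum.
Qed.

Lemma size_short_seqs m : 2 <= #|A| -> size (short_seqs m) <= #|A| ^ m.
Proof.
move=> A2; suff : (size (short_seqs m)).+1 <= #|A| ^ m by apply: ltnW.
elim: m => //= m IH; rewrite size_allpairs -cardE expnS.
apply: leq_trans (leq_mul (leqnn #|A|) IH).
by rewrite mulnS -addn2 addnC leq_add2r.
Qed.

End ShortWords.

Section Powers.
Context (R : realFieldType).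
Local Open Scope ring_scope.

Lemma sumr_const_seq (I : Type) (s : seq I) (x : R) :
  \sum_(i <- s) x = (size s)%:R * x.
Proof. by rewrite big_const_seq count_predT iter_addr_0 mulr_natl. Qed.

Lemma bernoulli (x : R) n : 0 <= x -> x <= 1 -> 1 - n%:R * x <= (1 - x) ^+ n.
Proof.
move=> x0 x1; elim: n => [|n IH]; first by rewrite mul0r subr0 expr0.
rewrite exprS; apply: le_trans (ler_wpM2l _ IH); last by rewrite subr_ge0.
have : 0 <= n%:R * x ^+ 2 by rewrite mulr_ge0 ?ler0n ?sqr_ge0.
by rewrite -natr1; nra.
Qed.

(** Bernoulli's inequality replaces an exact root, which need not exist in R. *)
Lemma exists_root (x : R) n : (0 < n)%N -> 0 < x -> x < 1 ->
  exists y, [/\ x <= y, y < 1 & x <= y ^+ n].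
Proof.
move=> n0 x0 x1; exists (1 - (1 - x) / n%:R).
have n0' : 0 < n%:R :> R by rewrite ltr0n.
have le1 : (1 - x) / n%:R <= 1 - x.
  by rewrite ler_pdivrMr// ler_peMr ?ler1n// ?subr_ge0 ltW.
have h0 : 0 < (1 - x) / n%:R by rewrite divr_gt0// subr_gt0.
split; [lra|lra|].
have e : n%:R * ((1 - x) / n%:R) = 1 - x by rewrite mulrC divfK ?gt_eqF.
by have := bernoulli n (ltW h0); rewrite e subKr; apply; lra.
Qed.

Lemma sum_expr_le (x : R) n : 2 <= x -> \sum_(i < n.+1) x ^+ i <= 2 * x ^+ n.
Proof.
move=> x2; elim: n => [|n IH]; first by rewrite big_ord_recl big_ord0 !expr0; lra.
rewrite big_ord_recr /=; have : 0 <= x ^+ n by apply: exprn_ge0; lra.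
by rewrite exprS; nra.
Qed.

Lemma sum_expr_tail (x : R) m n : 0 <= x -> x < 1 ->
  \sum_(i < n | (m <= i)%N) x ^+ i <= x ^+ m / (1 - x).
Proof.
move=> x0 x1; have d : 0 < 1 - x by lra.
suff : \sum_(i < n | (m <= i)%N) x ^+ i <= (x ^+ m - x ^+ (maxn m n)) / (1 - x).
  move=> h; apply: le_trans h _; rewrite ler_pM2r ?invr_gt0//.
  by rewrite gerBl exprn_ge0.
elim: n => [|n IH]; first by rewrite big_ord0 maxn0 subrr mul0r.
rewrite big_mkcond big_ord_recr -big_mkcond /=; case: leqP => mn.
  apply: le_trans (lerD IH (lexx _)) _.
  rewrite (maxn_idPr mn) (maxn_idPr (leqW mn)).
  rewrite -(ler_pM2r d) mulrDl !mulfVK ?gt_eqF// exprS; lra.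
by rewrite addr0 (maxn_idPl (ltnW mn)) in IH *; rewrite (maxn_idPl mn).
Qed.

End Powers.

(** * Exponential decay of the mass of a point *)

Section PointBound.
Context (R : realFieldType) (X : finType) (fl : letter X -> seq 'I_3).
Hypothesis flV : forall l, fl (inv_letter l) = rev (fl l).
Hypothesis rank : (4 <= #|{: letter X}|)%N.
Hypothesis surj : forall u : seq 'I_3, ~~ odd (size u) ->
  exists e : word X, nf (flat fl e) = nf u.
Local Open Scope ring_scope.
Local Notation q := (degree X).

Lemma degree_ge3 : (3 <= q)%N.
Proof. by rewrite /degree -ltnS prednK// (leq_trans _ rank). Qed.

Lemma norm_le_size (T : eqType) (s : seq T) : norm_le s (size s)%:R (R := R).
Proof.
rewrite /norm_le -natrX ler_nat /dot -mulnn.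
apply: leq_trans (_ : (\sum_(x <- s) size s <= _)%N).
  by apply: leq_sum => x _; exact: count_size.
by rewrite big_const_seq count_predT iter_addn_0.
Qed.

(** A block of n0 + 1 letters multiplies the norm by at most q^(n0 + 1) - 1, that is, by q^(n0 + 1)
    (1 - e), and rho is chosen with rho^(n0 + 1) >= 1 - e. The norm then bounds every multiplicity.
    That rho is at least 1/2 serves later, to have q rho >= 1. *)
Lemma point_bound : exists C rho : R, [/\ 0 < C, 2^-1 <= rho, rho < 1 &
  forall n l g, (count_mem g (images fl n l))%:R <= C * (q%:R * rho) ^+ n].
Proof.
have q3 := degree_ge3.
have [n0 [x1 spec]] := exists_special flV rank surj.
have q0 : 0 < q%:R :> R by rewrite ltr0n; lia.
have q1 : 1 <= q%:R :> R by rewrite (ler_nat R 1); lia.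
pose e : R := (q%:R ^+ n0.+1)^-1.
have e0 : 0 < e by rewrite invr_gt0 exprn_gt0.
have e2 : e <= 2^-1.
  rewrite lef_pV2 ?posrE ?exprn_gt0 //.
  rewrite exprS -[2]mulr1; apply: ler_pM => //; first by rewrite (ler_nat R 2); lia.
  exact: exprn_ege1.
have [rho [r1 r2 r3]] : exists y, [/\ 1 - e <= y, y < 1 & 1 - e <= y ^+ n0.+1].
  by apply: exists_root => //; lra.
have rho0 : 0 < rho by lra.
have C0 : 0 < (rho ^+ n0.+1)^-1 by rewrite invr_gt0 exprn_gt0.
have L0 : 0 < q%:R * rho by rewrite mulr_gt0.
have LM : (q ^ n0.+1)%:R - 1 <= (q%:R * rho) ^+ n0.+1.
  rewrite exprMn natrX; apply: le_trans (ler_wpM2l _ r3); last by rewrite exprn_ge0// ltW.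
  by rewrite mulrBr mulr1 mulfV// gt_eqF// exprn_gt0.
(* With this constant the trivial bound q^n suffices for n <= n0, where contraction does not apply
   yet. *)
suff h n l : norm_le (images fl n l) ((rho ^+ n0.+1)^-1 * (q%:R * rho) ^+ n).
  exists (rho ^+ n0.+1)^-1, rho; split=> //; first lra.
  move=> n l g; apply: count_mem_le_norm (h n l).
  by rewrite mulr_ge0 ?exprn_ge0// ltW.
elim/ltn_ind: n l => n IH l; case: (ltnP n n0.+1) => nn0.
  have := norm_le_size (images fl n l); rewrite size_map size_words natrX.
  apply: norm_le_mono; first by rewrite exprn_ge0// ltW.
  rewrite exprMn mulrCA; apply: ler_peMr; first by rewrite exprn_ge0// ltW.
  rewrite ler_pdivlMl ?exprn_gt0// mulr1.
  by apply: ler_wiXn2l; [exact: ltW | exact: ltW | exact: ltnW].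
have nE : n = (n0 + (n - n0.+1).+1)%N by rewrite addnS -addSn subnKC.
rewrite nE; set n' := (n - n0.+1)%N in nE *.
have a0 : 0 < (rho ^+ n0.+1)^-1 * (q%:R * rho) ^+ n'.
  by rewrite mulr_gt0// exprn_gt0.
have n'n : (n' < n)%N by rewrite /n' ltn_subrL (leq_trans _ nn0).
have := norm_le_image_contract (leqnn 6) spec a0 (IH n' n'n) l.
apply: norm_le_mono.
  rewrite subr_ge0 ler_peMl//; first exact: ltW.
  by rewrite (ler_nat R 1) expn_gt0 (leq_trans _ q3).
rewrite -addSnnS exprD [in leRHS]mulrA [X in _ <= X * _]mulrC -[leRHS]mulrA.
rewrite -[X in _ - X]mul1r -mulrBl.
by rewrite ler_pM2r.
Qed.

End PointBound.

(** * Prefixes of images of random words *)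

Section Crossing.
Context (X : choiceType) (A : eqType) (fl : letter X -> seq A) (D : nat).
Hypothesis flD : forall l, size (fl l) <= D.
Implicit Types (w : word X).

Lemma flat_rcons w l : flat fl (rcons w l) = flat fl w ++ fl l.
Proof. by rewrite /flat map_rcons flatten_rcons. Qed.

(* The path of prefixes enters the cone of v close to its vertex. *)
Lemma prefix_crossing L (v : seq A) w : size v = L -> 0 < L ->
  take L (nf (flat fl w)) = v ->
  exists t, [/\ t < size w, L <= D * t.+1,
    take L (nf (flat fl (take t.+1 w))) = v &
    size (nf (flat fl (take t.+1 w))) <= L + D].
Proof.
move=> vL L0 wv.
pose p t := take L (nf (flat fl (take t w))) == v.
have p0 : ~~ p 0.
  by rewrite /p take0 /=; apply/eqP => /(congr1 size); rewrite vL /=; lia.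
have ex : exists t, p t by exists (size w); rewrite /p take_size wv.
case: (ex_minnP ex) => [[|t]] pt mint; first by rewrite pt in p0.
have tw : t < size w.
  rewrite ltnNge; apply/negP => wt.
  have /mint : p t by rewrite /p (take_oversize wt) wv.
  by rewrite ltnn.
exists t; split=> //; last 2 first.
- exact/eqP.
- have [l0 wt] : exists l0, take t.+1 w = rcons (take t w) l0.
    case: (w) tw => // l1 u tw; exists (nth l1 (l1 :: u) t).
    by rewrite (take_nth l1).
  rewrite wt flat_rcons -nf_nf_catl.
  set g := nf (flat fl _); set f := fl _; rewrite leqNgt; apply/negP => lt.
  have : p t; last by move=> /mint; rewrite ltnn.
  move/eqP: pt; rewrite /p wt flat_rcons -nf_nf_catl -/g -/f => pt.
  (* If the image after step t + 1 were longer than L + D, undoing the letter would leave its first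
     L letters intact, and the prefix v would have been there at time t already. *)
  have gE : g = nf (nf (g ++ f) ++ rev f).
    rewrite nf_nf_catl -catA; have := nf_midV g f [::]; rewrite !cats0 => ->.
    by rewrite nf_id// nf_irr.
  have h := take_nf_catr (rev f) (nf_irr (g ++ f)).
  rewrite -gE size_rev in h; move/(congr1 (take L)): h.
  have fD : size f <= D by exact: flD.
  by rewrite !take_takel ?pt; [move=> ->|lia|lia].
- have : size (take L (nf (flat fl (take t.+1 w)))) <= D * t.+1.
    rewrite size_take_min; apply: leq_trans (geq_minr _ _) _.
    apply: leq_trans (size_nf _) _; apply: leq_trans (size_flat _ flD) _.
    by rewrite leq_mul2l size_take_min geq_minl orbT.
  by rewrite (eqP pt) vL.
Qed.

End Crossing.

Section PrefixCount.
Context (R : realFieldType) (X : finType) (fl : letter X -> seq 'I_3) (D : nat).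
Hypothesis flV : forall l, fl (inv_letter l) = rev (fl l).
Hypothesis flD : forall l, size (fl l) <= D.
Hypothesis D0 : 0 < D.
Local Notation q := (degree X).
Hypothesis q3 : 3 <= q.
Context (C rho : R).
Local Open Scope ring_scope.
Hypothesis C0 : 0 < C.
Hypothesis rho2 : 2^-1 <= rho.
Hypothesis rho1 : rho < 1.
Hypothesis pointB : forall n l g,
  (count_mem g (images fl n l))%:R <= C * (q%:R * rho) ^+ n.
Local Notation Phi w := (nf (flat fl w)).

Lemma count_words_take t n l (P : pred (word X)) : (t <= n)%N ->
  count (fun w => P (take t.+1 w)) (words n l) =
  (count P (words t l) * q ^ (n - t))%N.
Proof.
elim: t n l P => [|t IH] n l P.
  rewrite subn0 /= addn0 => _.
  rewrite (eq_in_count (a2 := fun=> P [:: l])); last first.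
    by move=> w; rewrite mem_words; case: w => // l' w /and3P[_ /eqP[->] _] /=; rewrite take0.
  by case: (P _); rewrite ?count_predT ?size_words ?mul1n// count_pred0.
case: n => // n; rewrite ltnS subSS => tn /=.
rewrite !count_map !count_flatten_sum !big_map big_distrl /=; apply: eq_bigr => l' _.
exact: (IH n l' (fun w => P (l :: w)) tn).
Qed.

Let rho0 : 0 < rho. Proof. by apply: lt_le_trans rho2; rewrite invr_gt0 ltr0n. Qed.
Let q0 : 0 < q%:R :> R. Proof. by rewrite ltr0n (leq_trans _ q3). Qed.

(** There are at most 3^m short elements, and each is hit rarely. *)
Lemma count_small m n l :
  (count (fun w => size (Phi w) < m)%N (words n l))%:R <=
  3 ^+ m * (C * (q%:R * rho) ^+ n).
Proof.
have -> : count (fun w => size (Phi w) < m)%N (words n l) =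
  count (fun s => size s < m)%N (images fl n l) by rewrite count_map.
apply: le_trans (_ : (\sum_(g <- short_seqs 'I_3 m) count_mem g (images fl n l))%N%:R <= _).
  by rewrite ler_nat; apply: count_le_sum => s _; rewrite mem_short_seqs.
rewrite natr_sum; apply: le_trans (ler_sum _ (fun g _ => pointB n l g)) _.
rewrite sumr_const_seq ler_pM2r; last first.
  by rewrite mulr_gt0// exprn_gt0// mulr_gt0.
rewrite -natrX ler_nat; apply: leq_trans (size_short_seqs _ _) _; rewrite card_ord//.
Qed.

(** Sum over the times t at which the path may enter the cone of v. The image is then v followed by
    at most D letters, one of at most 3^(D + 1) points; and t >= k - 1, since a letter produces at
    most D of the D k letters of v. The point bounds form a geometric series. *)
Lemma count_prefix k (v : seq 'I_3) n l : (0 < k)%N -> size v = (D * k)%N ->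
  (count (fun w => take (D * k) (Phi w) == v) (words n l))%:R <=
  3 ^+ D.+1 * C / (1 - rho) * rho^-1 * q%:R ^+ n * rho ^+ k.
Proof.
move=> k0 vk; have L0 : (0 < D * k)%N by rewrite muln_gt0 D0.
pose Gv := [seq v ++ z | z <- short_seqs 'I_3 D.+1].
pose P t := fun w : word X => Phi (take t.+1 w) \in Gv.
apply: le_trans (_ : (\sum_(t < n.+1 | (k.-1 <= t)%N) count (P t) (words n l))%N%:R <= _).
  rewrite ler_nat; under eq_bigr do rewrite -sum1_count big_mkcond.
  rewrite exchange_big -sum1_count big_mkcond big_seq [leqRHS]big_seq /=.
  apply: leq_sum => w; rewrite mem_words => /and3P[/eqP sw _ _].
  case: eqP => // wv; have [t [tw kt tv tD]] := prefix_crossing flD vk L0 wv.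
  rewrite sw in tw; rewrite (bigD1 (Ordinal tw))/=; last first.
    by rewrite leq_mul2l in kt; case/orP: kt => [/eqP E|]; [by move: D0; rewrite E | by case: (k)].
  suff -> : P t w by [].
  rewrite /P; apply/mapP; exists (drop (D * k) (Phi (take t.+1 w))).
    by rewrite mem_short_seqs size_drop ltnS leq_subLR.
  by rewrite -tv cat_take_drop.
rewrite natr_sum.
apply: le_trans (_ : \sum_(t < n.+1 | (k.-1 <= t)%N) (3 ^+ D.+1 * C * q%:R ^+ n) * rho ^+ t <= _).
  apply: ler_sum => -[t tn] /= _; rewrite ltnS in tn.
  rewrite (count_words_take _ (fun w => Phi w \in Gv) tn).
  rewrite -(count_map (fun w => Phi w) (fun s => s \in Gv)) -/(images fl t l).
  apply: le_trans (_ : ((\sum_(g <- Gv) count_mem g (images fl t l)) * q ^ (n - t))%N%:R <= _).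
    by rewrite ler_nat leq_mul2r count_le_sum ?orbT.
  rewrite natrM natr_sum.
  apply: le_trans (ler_wpM2r _ (ler_sum _ (fun g _ => pointB t l g))) _; first by rewrite ler0n.
  rewrite sumr_const_seq size_map.
  have -> : q%:R ^+ n = q%:R ^+ t * q%:R ^+ (n - t) :> R by rewrite -exprD subnKC.
  rewrite exprMn natrX; set z := _%:R; set a := q%:R ^+ t; set b := _ ^+ (n - t).
  have -> : z * (C * (a * rho ^+ t)) * b = z * (C * a * b * rho ^+ t) by ring.
  have -> : 3 ^+ D.+1 * C * (a * b) * rho ^+ t = 3 ^+ D.+1 * (C * a * b * rho ^+ t).
    by ring.
  rewrite ler_pM2r; last by rewrite !mulr_gt0// exprn_gt0.
  by rewrite /z -natrX ler_nat; apply: leq_trans (size_short_seqs _ _) _; rewrite card_ord.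
rewrite -mulr_sumr.
apply: le_trans (ler_wpM2l _ (sum_expr_tail _ _ (ltW rho0) rho1)) _.
  by rewrite !mulr_ge0 ?exprn_ge0 ?ler0n// ltW.
have -> : rho ^+ k = rho * rho ^+ k.-1 by rewrite -exprS prednK.
rewrite le_eqVlt; apply/orP; left; apply/eqP.
have rn : rho != 0 by rewrite gt_eqF.
have dn : 1 - rho != 0 by rewrite subr_eq0 eq_sym lt_eqF.
by field; rewrite rn.
Qed.

Definition sphere n : seq (word X) :=
  if n is n'.+1 then flatten [seq words n' l | l <- enum {: letter X}]
  else [:: [::]].

Lemma mem_sphere n w : (w \in sphere n) = (size w == n) && reduced w.
Proof.
case: n => [|n] /=; first by rewrite inE; case: w.
apply/flattenP/andP => [[s /mapP[l _ ->]]|[sw rw]].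
  by rewrite mem_words => /and3P[].
case: w sw rw => // l w sw rw; exists (words n l); last by rewrite mem_words sw rw eqxx.
by apply/mapP; exists l; rewrite ?mem_enum.
Qed.

Lemma uniq_sphere n : uniq (sphere n).
Proof.
case: n => // n; apply: uniq_flatten_map; [exact: enum_uniq|by move=> *; exact: uniq_words|].
move=> l l' _ _ ll' w; rewrite !mem_words => /and3P[-> /eqP -> ->].
by rewrite andbT; apply: contra ll' => /eqP[->].
Qed.

Let card_letters : #|{: letter X}| = q.+1.
Proof.
rewrite /degree prednK//; apply: contraTT q3.
by rewrite -leqNgt leqn0 /degree => /eqP ->.
Qed.

(** The q + 1 first letters are at most 2 q. *)
Lemma count_sphereS (P : pred (word X)) n (b : R) :
  (forall l, (count P (words n l))%:R <= b) ->
  (count P (sphere n.+1))%:R <= 2 * q%:R * b.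
Proof.
move=> h; rewrite count_flatten_sum big_map natr_sum.
apply: le_trans (ler_sum _ (fun l _ => h l)) _.
rewrite sumr_const_seq -cardE card_letters.
have /card_gt0P[l _] : (0 < #|{: letter X}|)%N by rewrite card_letters.
have b0 : 0 <= b by apply: le_trans (h l); exact: ler0n.
apply: ler_wpM2r => //; rewrite -natrM ler_nat; lia.
Qed.

Lemma size_sphere_le n : (size (sphere n))%:R <= 2 * q%:R ^+ n :> R.
Proof.
case: n => [|n]; first by rewrite expr0 mulr1 (ler_nat R 1 2).
rewrite -(count_predT (sphere n.+1)) exprS mulrA; apply: count_sphereS => l.
by rewrite count_predT size_words natrX.
Qed.

Lemma size_sphere_ge n : q%:R ^+ n <= (size (sphere n))%:R :> R.
Proof.
case: n => [|n]; first by rewrite expr0.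
rewrite -natrX ler_nat size_flatten /shape -map_comp sumnE big_map /=.
rewrite (eq_bigr (fun=> q ^ n)%N); last by move=> l _; rewrite /= size_words.
rewrite big_const_seq count_predT iter_addn_0 -cardE card_letters expnSr.
by rewrite leq_mul2l leqnSn orbT.
Qed.

Lemma reduced_inv_word (w : word X) : reduced (inv_word w) = reduced w.
Proof.
rewrite /reduced /inv_word rev_sorted sorted_map.
apply: eq_sorted => l l'; rewrite /= (inj_eq (can_inj (@inv_letterK X))).
by rewrite eq_sym -(inj_eq (can_inj (@inv_letterK X))) inv_letterK.
Qed.

Lemma count_sphere_inv (P : pred (word X)) n :
  count (fun w => P (inv_word w)) (sphere n) = count P (sphere n).
Proof.
rewrite -(count_map (@inv_word X)); apply/seq.permP; apply: uniq_perm.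
- by rewrite map_inj_uniq ?uniq_sphere//; exact: can_inj (@inv_wordK X).
- exact: uniq_sphere.
- move=> w; rewrite -[w in LHS]inv_wordK mem_map; last exact: can_inj (@inv_wordK X).
  by rewrite !mem_sphere reduced_inv_word size_rev size_map.
Qed.

Lemma count_small_sphere m n :
  (count (fun w => size (Phi w) < m)%N (sphere n))%:R <=
  (4 * C + 1) * 3 ^+ m * (q%:R * rho) ^+ n.
Proof.
have p3 : 1 <= 3 ^+ m :> R by rewrite exprn_ege1// (ler_nat R 1 3).
case: n => [|n].
  rewrite expr0 mulr1; apply: (@le_trans _ _ 1).
    by rewrite (ler_nat R _ 1); apply: leq_trans (count_size _ _) _.
  by rewrite -[leLHS]mulr1; apply: ler_pM => //; have := C0; lra.
apply: le_trans (count_sphereS (fun l => count_small m n l)) _.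
set a := 3 ^+ m in p3 *; rewrite exprS; set b := (q%:R * rho) ^+ n.
have b0 : 0 < b by rewrite exprn_gt0// mulr_gt0.
have -> : 2 * q%:R * (a * (C * b)) = (2 * q%:R * a * b) * C by ring.
have -> : (4 * C + 1) * a * (q%:R * rho * b) =
  (2 * q%:R * a * b) * ((2 * C + 2^-1) * rho) by field.
apply: ler_wpM2l.
  by rewrite !mulr_ge0// ?(ltW q0) ?(ltW b0)//; apply: le_trans p3.
have h : (2 * C + 2^-1) * 2^-1 <= (2 * C + 2^-1) * rho.
  by apply: ler_wpM2l rho2; have := C0; lra.
by apply: le_trans h; lra.
Qed.

Let Kp : R := 2 * (3 ^+ D.+1 * C / (1 - rho) * rho^-1).

Let Kp0 : 0 < Kp.
Proof.
by rewrite /Kp !mulr_gt0 ?exprn_gt0 ?invr_gt0 ?subr_gt0// ltr0n.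
Qed.

Let Kp1 : 0 <= 1 + 2 * Kp.
Proof. by apply: addr_ge0 => //; apply: mulr_ge0 => //; exact: ltW Kp0. Qed.

Lemma count_prefix_sphere k (v : seq 'I_3) n : (0 < k)%N -> size v = (D * k)%N ->
  (count (fun w => take (D * k) (Phi w) == v) (sphere n))%:R <=
  Kp * q%:R ^+ n * rho ^+ k.
Proof.
move=> k0 vk; case: n => [|n].
  rewrite /= addn0; case: eqP => [E|_]; last first.
    apply: mulr_ge0; last exact: exprn_ge0 (ltW rho0).
    by apply: mulr_ge0; [exact: ltW Kp0 | exact: exprn_ge0 (ltW q0)].
  by have := muln_gt0 D k; rewrite D0 k0 -vk -E.
apply: le_trans (count_sphereS (fun l => count_prefix n l k0 vk)) _.
by rewrite [q%:R ^+ n.+1]exprS /Kp le_eqVlt; apply/orP; left; apply/eqP; ring.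
Qed.

Lemma count_suffix_sphere k (v : seq 'I_3) n : (0 < k)%N -> size v = (D * k)%N ->
  (count (fun w => take (D * k) (rev (Phi w)) == v) (sphere n))%:R <=
  Kp * q%:R ^+ n * rho ^+ k.
Proof.
move=> k0 vk; rewrite -count_sphere_inv.
under eq_count => w do rewrite flat_inv// nf_rev revK.
exact: count_prefix_sphere.
Qed.

(** The second inequality limits cancellation, so the product begins like s and its inverse like the
    inverse of t; the first inequality separates these. *)
Lemma nf_cat_not_overlap L (s t : seq 'I_3) : irr s -> irr t ->
  (2 * L <= size s)%N -> (2 * L <= size t)%N ->
  take L s != take L (rev t) -> take L (rev s) != take L t ->
  take L (nf (s ++ t)) != take L (rev (nf (s ++ t))).
Proof.
move=> si ti sL tL h1 h2.
rewrite take_nf_cat//; last by rewrite eq_sym.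
by rewrite -nf_rev rev_cat take_nf_cat ?irr_rev ?size_rev ?revK.
Qed.

Definition self_overlap L w := take L (Phi w) == take L (rev (Phi w)).

(** The two ends of one word are not independent, so the word is cut in two. Admitting all pairs of
    reduced halves only enlarges the count and makes the halves independent. For a fixed second half
    with long image, the first half must have a short image or one with a prescribed prefix or
    suffix. *)
Lemma count_self_sphere k h h' (e : R) : (0 < k)%N -> 0 <= e -> rho ^+ k <= e ->
  let L := (D * k)%N in
  (forall n, n \in [:: h; h'] ->
     (count (fun w => size (Phi w) < 2 * L)%N (sphere n))%:R <= e * q%:R ^+ n) ->
  (count (self_overlap L) (sphere (h + h')))%:R <=
    (4 + 4 * Kp) * e * q%:R ^+ (h + h').
Proof.
move=> k0 e0 ke L small.
pose prod := [seq w1 ++ w2 | w2 <- sphere h', w1 <- sphere h].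
apply: le_trans (_ : (count (self_overlap L) prod)%:R <= _).
  rewrite ler_nat; apply: count_le_subset; first exact: uniq_sphere.
  move=> w; rewrite mem_sphere => /andP[/eqP sw rw].
  apply/allpairsP; exists (drop h w, take h w); rewrite /= cat_take_drop.
  rewrite !mem_sphere size_takel ?size_drop sw ?leq_addr// addKn !eqxx /=.
  by move: rw; rewrite /reduced -{1}(cat_take_drop h w) => /cat_sorted2[-> ->].
rewrite count_flatten_sum big_map natr_sum.
apply: le_trans (_ : \sum_(w2 <- sphere h')
   ((size (Phi w2) < 2 * L)%N%:R * (2 * q%:R ^+ h) +
    (1 + 2 * Kp) * e * q%:R ^+ h) <= _).
  apply: ler_sum => w2 _; rewrite count_map.
  have c0 : 0 <= (1 + 2 * Kp) * e * q%:R ^+ h.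
    by rewrite mulr_ge0 ?exprn_ge0 ?(ltW q0)// mulr_ge0.
  case: ltnP => w2L /=.
    rewrite mul1r; apply: le_trans (_ : (size (sphere h))%:R <= _).
      by rewrite ler_nat count_size.
    by apply: le_trans (size_sphere_le h) _; rewrite lerDl.
  rewrite mul0r add0r.
  set p := preim _ _.
  apply: le_trans (_ : (count (fun w => size (Phi w) < 2 * L)%N (sphere h) +
    count (fun w => take L (Phi w) == take L (rev (Phi w2))) (sphere h) +
    count (fun w => take L (rev (Phi w)) == take L (Phi w2)) (sphere h))%N%:R <= _).
    rewrite ler_nat; apply: count_cover3 => w.
    rewrite /p /= /self_overlap flat_cat -nf_cat_nf => b.
    case: ltnP => wL //=; case: eqP => //= /eqP h1; case: eqP => //= /eqP h2.
    by move: b; apply: contraTT => _; exact: nf_cat_not_overlap (nf_irr _) (nf_irr _) wL w2L h1 h2.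
  have L2 : (L <= 2 * L)%N by rewrite leq_pmull.
  have s1 : size (take L (rev (Phi w2))) = L.
    by rewrite size_takel// size_rev; exact: leq_trans w2L.
  have s2 : size (take L (Phi w2)) = L by rewrite size_takel//; exact: leq_trans w2L.
  rewrite !natrD.
  have b1 := small h (mem_head _ _).
  have b2 := count_prefix_sphere h k0 s1.
  have b3 := count_suffix_sphere h k0 s2.
  have bk : Kp * q%:R ^+ h * rho ^+ k <= Kp * e * q%:R ^+ h.
    rewrite mulrAC ler_wpM2r ?exprn_ge0 ?ler0n// ler_wpM2l//; exact: ltW.
  have b2' := le_trans b2 bk; have b3' := le_trans b3 bk.
  apply: le_trans (lerD (lerD b1 b2') b3') _.
  by rewrite le_eqVlt; apply/orP; left; apply/eqP; ring.
rewrite big_split /= -mulr_suml -natr_sum sumr_const_seq.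
have -> : (\sum_(w2 <- sphere h') (size (Phi w2) < 2 * L))%N =
    count (fun w => size (Phi w) < 2 * L)%N (sphere h').
  by rewrite -sum1_count [RHS]big_mkcond; apply: eq_bigr => w _; case: ltnP.
have b4 := small h' (mem_last h [:: h']).
have b5 := size_sphere_le h'.
set x := q%:R ^+ h; set y := q%:R ^+ h' in b4 b5.
have x0 : 0 < x by rewrite exprn_gt0.
have y0 : 0 < y by rewrite exprn_gt0.
rewrite exprD -/x -/y.
apply: le_trans (_ : (e * y) * (2 * x) + (2 * y) * ((1 + 2 * Kp) * e * x) <= _).
  apply: lerD; first by rewrite ler_wpM2r// mulr_ge0// ltW.
  by rewrite ler_wpM2r// mulr_ge0 ?(ltW x0)// mulr_ge0.
by rewrite le_eqVlt; apply/orP; left; apply/eqP; ring.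
Qed.

Definition ball r : seq (word X) := flatten [seq sphere n | n <- index_iota 0 r.+1].

Lemma mem_ball r w : (w \in ball r) = (size w <= r)%N && reduced w.
Proof.
apply/flattenP/andP => [[s /mapP[n]]|[wr rw]].
  by rewrite mem_index_iota => /= nr ->; rewrite mem_sphere => /andP[/eqP -> ->].
exists (sphere (size w)); last by rewrite mem_sphere eqxx.
by apply/mapP; exists (size w); rewrite // mem_index_iota.
Qed.

Lemma uniq_ball r : uniq (ball r).
Proof.
apply: uniq_flatten_map; [exact: iota_uniq|by move=> n _; exact: uniq_sphere|].
move=> n n' _ _ nn' w; rewrite !mem_sphere => /andP[/eqP -> ->].
by rewrite andbT.
Qed.

Lemma size_ball_ge r : q%:R ^+ r <= (size (ball r))%:R :> R.
Proof.
apply: le_trans (size_sphere_ge r) _; rewrite ler_nat.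
apply: uniq_leq_size; first exact: uniq_sphere.
by move=> w; rewrite mem_sphere mem_ball => /andP[/eqP -> ->]; rewrite leqnn.
Qed.

Lemma count_ball_le (P : pred (word X)) r (b : R) : 0 <= b ->
  (forall n, (n <= r)%N -> (count P (sphere n))%:R <= b * q%:R ^+ n) ->
  (count P (ball r))%:R <= 2 * b * q%:R ^+ r.
Proof.
move=> b0 h; rewrite count_flatten_sum big_map natr_sum big_mkord.
apply: le_trans (_ : \sum_(n < r.+1) b * q%:R ^+ n <= _).
  by apply: ler_sum => -[n nr] _; apply: h.
rewrite -mulr_sumr [2 * b]mulrC -mulrA ler_wpM2l// sum_expr_le//.
by rewrite (ler_nat R 2); apply: ltnW.
Qed.

Definition bad L w := (size (Phi w) < 2 * L)%N || self_overlap L w.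

Lemma ball_bounds cc : (3 ^+ (2 * D)) * rho ^+ cc <= rho ->
  exists K c, [/\ 0 < K, (0 < c)%N & forall r, (c <= r)%N ->
    let k := (r %/ c)%N in let L := (D * k)%N in
    (count (bad L) (ball r))%:R <= K * rho ^+ k * q%:R ^+ r /\
    forall v, size v = L ->
      (count (fun w => take L (Phi w) == v) (ball r))%:R <=
        K * rho ^+ k * q%:R ^+ r /\
      (count (fun w => take L (rev (Phi w)) == v) (ball r))%:R <=
        K * rho ^+ k * q%:R ^+ r].
Proof.
move=> ccP; pose c := (4 * cc + 4)%N.
pose K1 := 4 * C + 1; pose K2 := (4 + 4 * Kp) * K1 + K1.
have K10 : 1 <= K1 by rewrite lerDr; apply: mulr_ge0 => //; exact: ltW C0.
have KpK : 4 <= 4 + 4 * Kp by rewrite lerDl; apply: mulr_ge0 => //; exact: ltW Kp0.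
have K1' : 0 <= K1 by exact: le_trans K10.
have K20 : 0 <= K2.
  by apply: addr_ge0 => //; apply: mulr_ge0 => //; apply: le_trans KpK.
exists (4 + 2 * K2 + 2 * Kp), c; split.
- rewrite -addrA; apply: ltr_pwDl => //; apply: addr_ge0; apply: mulr_ge0 => //.
  exact: ltW Kp0.
- by rewrite /c addnS.
move=> r cr k L.
have k0 : (0 < k)%N by rewrite divn_gt0// /c addnS.
have rk : 0 < rho ^+ k by exact: exprn_gt0.
have qr0 : 0 < q%:R ^+ r :> R by exact: exprn_gt0.
have Kp0' := ltW Kp0.
have X0 : 0 <= rho ^+ k * q%:R ^+ r by rewrite mulr_ge0// ltW.
have small n : (cc * k <= n)%N ->
    (count (fun w => size (Phi w) < 2 * L)%N (sphere n))%:R <=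
    (K1 * rho ^+ k) * q%:R ^+ n.
  move=> nk; apply: le_trans (count_small_sphere (2 * L) n) _.
  rewrite -/K1; have -> : K1 * 3 ^+ (2 * L) * (q%:R * rho) ^+ n =
    K1 * q%:R ^+ n * (3 ^+ (2 * L) * rho ^+ n) by rewrite exprMn; ring.
  rewrite [leRHS]mulrAC; apply: ler_wpM2l.
    by apply: mulr_ge0 => //; apply: exprn_ge0; exact: ltW.
  rewrite -(subnKC nk) exprD mulrA.
  have -> : 3 ^+ (2 * L) * rho ^+ (cc * k) = (3 ^+ (2 * D) * rho ^+ cc) ^+ k :> R.
    by rewrite exprMn -!exprM /L mulnA.
  apply: le_trans (_ : rho ^+ k * 1 <= _); last by rewrite mulr1.
  apply: ler_pM; rewrite ?exprn_ge0 ?mulr_ge0 ?exprn_ge0 ?(ltW rho0)//.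
  - by apply: lerXn2r; rewrite ?nnegrE ?mulr_ge0 ?exprn_ge0 ?(ltW rho0).
  - by apply: exprn_ile1; rewrite ?(ltW rho0) ?(ltW rho1).
have sumK (b : R) : 0 <= b -> b <= 2 + K2 + Kp ->
    2 * (b * rho ^+ k) * q%:R ^+ r <=
    (4 + 2 * K2 + 2 * Kp) * rho ^+ k * q%:R ^+ r.
  move=> b0 bK; have -> : 2 * (b * rho ^+ k) * q%:R ^+ r =
    (2 * b) * (rho ^+ k * q%:R ^+ r) by ring.
  by rewrite -[leRHS]mulrA ler_wpM2r//; lra.
split; last first.
  move=> v vL.
  have KpK' : Kp <= 2 + K2 + Kp by rewrite lerDr addr_ge0.
  have b0 : 0 <= Kp * rho ^+ k by rewrite mulr_ge0// ltW.
  have le := sumK Kp Kp0' KpK'.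
  split; apply: le_trans le; apply: count_ball_le => // n _; rewrite mulrAC.
    exact: count_prefix_sphere.
  exact: count_suffix_sphere.
(* From length s0 on, both halves of a word have length at least cc k. Shorter words are negligible
   in the ball because s0 + k <= r and q rho >= 1. *)
pose s0 := (2 * (cc * k) + 2)%N.
have s0r : (s0 + k <= r)%N.
  apply: leq_trans (leq_divM r c); rewrite -/k /s0 /c.
  have -> : (k * (4 * cc + 4) = (2 * (cc * k) + 2 * k + k) + (2 * (cc * k) + k))%N.
    by rewrite mulnDr; ring.
  by apply: leq_trans (leq_addr _ _); rewrite leq_add2r leq_add2l leq_pmulr.
have bigs : (size (ball s0))%:R <= 4 * rho ^+ k * q%:R ^+ r.
  rewrite -(count_predT (ball s0)); apply: le_trans (count_ball_le (b := 2) _ _) _.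
  - by [].
  - by move=> n _; rewrite count_predT; exact: size_sphere_le.
  have -> : 2 * 2 = 4 :> R by ring.
  rewrite -mulrA ler_wpM2l//.
  have qr1 : 1 <= q%:R * rho.
    apply: le_trans (_ : 3 * 2^-1 <= _); first by lra.
    by apply: ler_pM; rewrite ?invr_ge0// (ler_nat R 3).
  have s0r' : (s0 <= r)%N by apply: leq_trans s0r; exact: leq_addr.
  rewrite -(subnK s0r') exprD mulrA -[leLHS]mul1r ler_wpM2r ?exprn_ge0 ?(ltW q0)//.
  apply: le_trans (_ : 1 <= (q%:R * rho) ^+ (r - s0)) _; first exact: exprn_ege1.
  rewrite exprMn mulrC ler_wpM2r ?exprn_ge0 ?(ltW q0)//.
  by apply: ler_wiXn2l; rewrite ?(ltW rho0) ?(ltW rho1)// leq_subRL.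
have bad_sphere n : (s0 <= n)%N ->
    (count (bad L) (sphere n))%:R <= K2 * rho ^+ k * q%:R ^+ n.
  move=> sn; pose h := (n %/ 2)%N.
  have hn : (h <= n)%N by exact: leq_div.
  have hk : (cc * k <= h)%N.
    by rewrite leq_divRL// mulnC; apply: leq_trans sn; exact: leq_addr.
  have hk' : (cc * k <= n - h)%N.
    apply: leq_trans hk _; rewrite leq_subRL// addnn -muln2; exact: leq_divM.
  apply: le_trans (_ : (count (self_overlap L) (sphere n) +
     count (fun w => size (Phi w) < 2 * L)%N (sphere n))%N%:R <= _).
    rewrite ler_nat; elim: (sphere n) => //= w s IH.
    by rewrite addnACA leq_add// /bad; case: (_ < _)%N; case: self_overlap.
  have -> : K2 * rho ^+ k * q%:R ^+ n =
      (4 + 4 * Kp) * (K1 * rho ^+ k) * q%:R ^+ n + K1 * rho ^+ k * q%:R ^+ n.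
    by rewrite /K2; ring.
  rewrite natrD; apply: lerD; last exact: small (leq_trans hk hn).
  have := @count_self_sphere k h (n - h)%N (K1 * rho ^+ k) k0.
  rewrite subnKC//; apply.
  - by rewrite mulr_ge0// ltW.
  - by rewrite ler_peMl// ltW.
  - by move=> n'; rewrite !inE => /orP[] /eqP ->; exact: small.
apply: le_trans (_ : (size (ball s0))%:R +
   (count (fun w => (s0 <= size w)%N && bad L w) (ball r))%:R <= _).
  rewrite -natrD ler_nat.
  apply: leq_trans (_ : count (fun w => size w < s0)%N (ball r) +
    count (fun w => (s0 <= size w)%N && bad L w) (ball r) <= _)%N.
    elim: (ball r) => //= w s IH.
    by rewrite addnACA leq_add//; case: ltnP => //= _; case: (bad L w).
  rewrite leq_add2r -size_filter; apply: uniq_leq_size.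
    by rewrite filter_uniq ?uniq_ball.
  move=> w; rewrite mem_filter !mem_ball => /andP[/ltnW -> /andP[_ ->]].
  by [].
have h2 : (count (fun w => (s0 <= size w)%N && bad L w) (ball r))%:R <=
    2 * (K2 * rho ^+ k) * q%:R ^+ r.
  apply: count_ball_le; first by rewrite mulr_ge0// ltW.
  move=> n _; case: (leqP s0 n) => [sn|ns].
    apply: le_trans (bad_sphere n sn); rewrite ler_nat; apply: sub_count => w.
    by case/andP.
  rewrite (@eq_in_count _ _ pred0) ?count_pred0.
    by rewrite !mulr_ge0 ?exprn_ge0// ltW.
  by move=> w; rewrite mem_sphere => /andP[/eqP -> _]; rewrite leqNgt ns.
apply: le_trans (lerD bigs h2) _.
have -> : 4 * rho ^+ k * q%:R ^+ r + 2 * (K2 * rho ^+ k) * q%:R ^+ r =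
    (4 + 2 * K2) * (rho ^+ k * q%:R ^+ r) by ring.
rewrite -[leRHS]mulrA ler_wpM2r// lerDl.
by apply: mulr_ge0 => //; exact: ltW Kp0.
Qed.

End PrefixCount.

(** * Genericity *)

Section Resampling.
Context (S : finType) (N : nat).

Definition resample (f : {ffun 'I_N -> S}) j x : {ffun 'I_N -> S} :=
  [ffun i => if i == j then x else f i].

(* Exchanging the fresh value and the j-th coordinate is an involution. *)
Lemma card_resample (j : 'I_N) (P : pred {ffun 'I_N -> S}) :
  #|P| * #|S| = \sum_(f : {ffun 'I_N -> S}) #|[pred x | P (resample f j x)]|.
Proof.
pose t (p : {ffun 'I_N -> S} * S) := (resample p.1 j p.2, p.1 j).
have tK : involutive t.
  case=> f x; rewrite /t /=; congr pair; last by rewrite ffunE eqxx.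
  by apply/ffunP => i; rewrite !ffunE; case: eqP => // ->.
have -> : #|P| * #|S| = \sum_(p : {ffun 'I_N -> S} * S) P (t p).1.
  rewrite (reindex_inj (inv_inj tK)).
  rewrite (eq_bigr (fun p : {ffun 'I_N -> S} * S => (P p.1 : nat))); last first.
    by move=> p _; rewrite tK.
  rewrite -(pair_bigA _ (fun (f : {ffun 'I_N -> S}) (x : S) => (P f : nat))) /=.
  under eq_bigr do rewrite sum_nat_const.
  rewrite -big_distrr /= mulnC; congr (_ * _).
  rewrite -sum1_card big_mkcond; apply: eq_bigr => f _.
  by rewrite unfold_in; case: (P f).
rewrite -(pair_bigA _ (fun (f : {ffun 'I_N -> S}) (x : S) => (P (resample f j x) : nat))) /=.
apply: eq_bigr => f _; rewrite -sum1_card [RHS]big_mkcond /=.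
by apply: eq_bigr => x _; rewrite unfold_in /=; case: (P _).
Qed.

End Resampling.

Section TupleBall.
Context (X : finType) (N r : nat).

Definition freeball : seq (freeword X) := pmap insub (ball X r).

Lemma map_val_freeball : map val freeball = ball X r.
Proof.
rewrite /freeball; have : all (@reduced X) (ball X r).
  by apply/allP => w; rewrite mem_ball => /andP[].
elim: (ball X r) => //= w s IH /andP[rw /IH{}IH].
by rewrite insubT /= IH.
Qed.

Lemma mem_freeball (w : freeword X) : (w \in freeball) = (size (val w) <= r).
Proof.
rewrite -(mem_map val_inj) map_val_freeball mem_ball; case: w => w rw /=.
by rewrite rw andbT.
Qed.

Lemma uniq_freeball : uniq freeball.
Proof. by rewrite -(map_inj_uniq val_inj) map_val_freeball uniq_ball. Qed.

Local Notation S := (seq_sub freeball).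

Lemma card_freeball : #|{: S}| = size (ball X r).
Proof. by rewrite card_seq_sub ?uniq_freeball// -map_val_freeball size_map. Qed.

Lemma perm_enum_freeball : perm_eq (map (@ssval _ freeball) (enum {: S})) freeball.
Proof.
apply: uniq_perm; rewrite ?uniq_freeball//.
  by rewrite (map_inj_uniq (val_inj : injective (@ssval _ freeball))) enum_uniq.
move=> w; apply/mapP/idP => [[x _ ->]|wb]; first exact: valP.
by exists (SeqSub wb); rewrite ?mem_enum.
Qed.

Lemma card_freeball_pred (P : pred (word X)) :
  #|[pred x : S | P (val (ssval x))]| = count P (ball X r).
Proof.
rewrite cardE size_filter -map_val_freeball count_map.
rewrite -(seq.permP perm_enum_freeball) count_map enumT.
by apply: eq_count.
Qed.

Definition tuple_of_ffun (f : {ffun 'I_N -> S}) : N.-tuple (freeword X) :=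
  [tuple ssval (f j) | j < N].

Lemma tuple_of_ffun_inj : injective tuple_of_ffun.
Proof.
move=> f g E; apply/ffunP => j; apply: val_inj.
by have := congr1 (fun t => tnth t j) E; rewrite !tnth_mktuple.
Qed.

Lemma tuple_size_le (T : N.-tuple (freeword X)) :
  (tuple_size T <= r) = [forall j, size (val (tnth T j)) <= r].
Proof.
rewrite /tuple_size big_tuple; apply/bigmax_leqP/forallP => h j //.
exact: h.
Qed.

Lemma size_ball_ffun (T : N.-tuple (freeword X)) : size_ball r T ->
  exists f, T = tuple_of_ffun f.
Proof.
rewrite /size_ball /= tuple_size_le => /forallP h.
have hb j : tnth T j \in freeball by rewrite mem_freeball.
exists [ffun j => SeqSub (hb j)]; apply: eq_from_tnth => j.
by rewrite tnth_mktuple ffunE.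
Qed.

Lemma tuple_of_ffun_ball f : size_ball r (tuple_of_ffun f).
Proof.
rewrite /size_ball /= tuple_size_le; apply/forallP => j.
by rewrite tnth_mktuple -mem_freeball; exact: (valP (f j)).
Qed.

(** Moves the count to functions into a finite type, where one coordinate can be resampled. *)
Lemma card_size_ball (D : set (N.-tuple (freeword X))) :
  #|` fset_set (size_ball r `&` D)%classic| =
  #|[pred f | `[< D (tuple_of_ffun f) >]]|.
Proof.
set P := [pred f | _].
have -> : fset_set (size_ball r `&` D)%classic =
    [fset x in [seq tuple_of_ffun f | f <- enum P]]%fset.
  apply/fsetP => T; rewrite in_fset_set; last first.
    by apply: sub_finite_set (@finite_size_ball X N r) => T' [].
  rewrite in_fsetE; apply/idP/mapP => [|[f]].
    rewrite in_setE => -[/size_ball_ffun[f ->] DT]; exists f => //.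
    rewrite mem_enum -topredE /=; exact/asboolP.
  rewrite mem_enum -topredE /= => /asboolP DT ->; rewrite in_setE; split=> //.
  exact: tuple_of_ffun_ball.
rewrite card_fseq undup_id ?size_map -?cardE// map_inj_uniq ?enum_uniq//.
exact: tuple_of_ffun_inj.
Qed.

End TupleBall.

Section Genericity.
Context (R : realType) (X : finType) (fl : letter X -> seq 'I_3) (N : nat).
Hypothesis flV : forall l, fl (inv_letter l) = rev (fl l).
Hypothesis rank : (4 <= #|{: letter X}|)%N.
Hypothesis surj : forall u : seq 'I_3, ~~ odd (size u) ->
  exists e : word X, nf (flat fl e) = nf u.
Local Open Scope ring_scope.
Local Notation Phi w := (nf (flat fl w)).
Local Notation q := (degree X).

Definition overlap L (w w' : word X) :=
  [|| take L (Phi w') == take L (Phi w), take L (Phi w') == take L (rev (Phi w)),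
      take L (rev (Phi w')) == take L (Phi w) |
      take L (rev (Phi w')) == take L (rev (Phi w))].

(** L may depend on the tuple: it serves the analysis, and the machine never computes it. *)
Definition separated_tuple : set (N.-tuple (freeword X)) := fun T =>
  exists L, (forall j, ~~ bad fl L (val (tnth T j))) /\
    (forall i j, i != j -> ~~ overlap L (val (tnth T i)) (val (tnth T j))).

Lemma exists_expr_le (x y : R) : 0 < x -> x < 1 -> 0 < y -> exists n, x ^+ n <= y.
Proof.
move=> x0 x1 y0; pose a := x^-1 - 1.
have a0 : 0 < a by rewrite subr_gt0 invf_gt1.
have xa : x^-1 = 1 + a by rewrite /a; ring.
have ge n : 1 + n%:R * a <= x^-1 ^+ n.
  rewrite xa; elim: n => [|n IH]; first by rewrite mul0r addr0 expr0.
  rewrite exprS; apply: le_trans (ler_wpM2l _ IH); last by lra.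
  have : 0 <= n%:R * a ^+ 2 by rewrite mulr_ge0 ?ler0n ?sqr_ge0.
  by rewrite -natr1; nra.
have [n h] : exists n, y^-1 / a < n%:R.
  exists (Num.bound (y^-1 / a)).
  by apply: archi_boundP; rewrite divr_ge0 ?invr_ge0// ltW.
exists n; rewrite ltr_pdivrMr// in h.
rewrite -[leLHS]invrK -exprVn -[y]invrK lef_pV2 ?posrE ?exprn_gt0 ?invr_gt0//.
apply: le_trans (ge _); apply: ltW; apply: lt_le_trans h _.
by rewrite lerDr.
Qed.

(** A union bound over N coordinates and N^2 pairs; each event is estimated by redrawing one
    coordinate with the others fixed. As k is r / c rounded down, rho <= delta^c gives rho^k <=
    delta^-c delta^r. *)
Lemma generic_separated_tuple : exponentially_generic R separated_tuple.
Proof.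
have q3 := degree_ge3 rank.
have [C [rho [C0 r2 r1 pB]]] := point_bound R flV rank surj.
have r0 : 0 < rho by apply: lt_le_trans r2; rewrite invr_gt0 ltr0n.
pose D := (\max_(l : letter X) size (fl l)).+1.
have flD l : (size (fl l) <= D)%N by apply: leqW; exact: leq_bigmax.
have D0 : (0 < D)%N by [].
have [cc ccP] : exists cc, 3 ^+ (2 * D) * rho ^+ cc <= rho.
  have p0 : 0 < 3 ^+ (2 * D) :> R by rewrite exprn_gt0.
  have [cc h] := exists_expr_le r0 r1 (divr_gt0 r0 p0).
  by exists cc; rewrite mulrC -ler_pdivlMr.
have [K [c [K0 c0 bounds]]] := ball_bounds flV flD D0 q3 C0 r2 r1 pB ccP.
have [delta [d1 d2 d3]] := exists_root c0 r0 r1.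
have dl0 : 0 < delta by apply: lt_le_trans d1.
pose M := (N%:R + N%:R * N%:R) * (4 * K) : R.
have M0 : 0 <= M by rewrite /M mulr_ge0 ?addr_ge0 ?mulr_ge0 ?ler0n// ltW.
exists ((1 + M) * delta ^- c), delta; split.
- by rewrite mulr_gt0 ?invr_gt0 ?exprn_gt0// ltr_wpDr.
- by rewrite dl0 d2.
move=> r; have dc0 : 0 < delta ^- c by rewrite invr_gt0 exprn_gt0.
have dr0 : 0 < delta ^+ r by rewrite exprn_gt0.
(* For r < c the claimed bound is at least 1. *)
case: (ltnP r c) => [rc|cr].
  apply: (@le_trans _ _ 1); first by rewrite gerBl divr_ge0 ?ler0n.
  have h : 1 <= delta ^- c * delta ^+ r.
    rewrite mulrC ler_pdivlMr ?exprn_gt0// mul1r.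
    by apply: ler_wiXn2l; [exact: ltW | exact: ltW | exact: ltnW].
  by rewrite -mulrA -[leLHS]mulr1; apply: ler_pM => //; lra.
have {bounds} := bounds r cr.
set k := (r %/ c)%N; set L := (D * k)%N; move=> [badB prefB].
set e := K * rho ^+ k in badB prefB.
have e0 : 0 <= e by rewrite mulr_ge0 ?exprn_ge0// ltW.
pose S := seq_sub (freeball X r); pose F := {ffun 'I_N -> S}.
have qS : q%:R ^+ r <= #|{: S}|%:R :> R by rewrite card_freeball; exact: size_ball_ge.
have S0 : 0 < #|{: S}|%:R :> R.
  by apply: lt_le_trans qS; rewrite exprn_gt0// ltr0n (leq_trans _ q3).
have event (j : 'I_N) (P : pred F) (b : R) : 0 <= b ->
    (forall f : F, #|[pred x | P (resample f j x)]|%:R <= b * e * q%:R ^+ r) ->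
    #|P|%:R <= b * e * #|{: F}|%:R.
  move=> b0 h; have := card_resample j P; move/(congr1 (fun n : nat => n%:R : R)).
  rewrite natrM natr_sum => E; rewrite -(ler_pM2r S0) E.
  apply: le_trans (ler_sum _ (fun f _ => h f)) _.
  rewrite sumr_const -[leLHS]mulr_natr; set t := b * e.
  have t0 : 0 <= t by exact: mulr_ge0.
  rewrite mulrAC; apply: ler_wpM2l => //; apply: mulr_ge0 => //; exact: ler0n.
pose w (f : F) j : word X := val (ssval (f j)).
pose P1 j : pred F := fun f => bad fl L (w f j).
(* The length condition gives the prefixes of the i-th image length exactly L, as [prefB] requires;
   tuples violating it belong to [P1 i]. *)
pose P2 i j : pred F := fun f =>
  [&& i != j, (2 * L <= size (Phi (w f i)))%N & overlap L (w f i) (w f j)].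
have sum4 (x1 x2 x3 x4 : nat) (b : R) : x1%:R <= b -> x2%:R <= b ->
    x3%:R <= b -> x4%:R <= b -> ((x1 + x2) + (x3 + x4))%N%:R <= 4 * b.
  by rewrite !natrD; lra.
have P1le j : #|P1 j|%:R <= (4 * e) * #|{: F}|%:R.
  apply: (event j) => // f.
  apply: le_trans (_ : (count (bad fl L) (ball X r))%:R <= _).
    rewrite -card_freeball_pred ler_nat; apply: subset_leq_card.
    by apply/fintype.subsetP => x; rewrite !inE /P1 /w /resample ffunE eqxx.
  apply: le_trans badB _; apply: ler_wpM2r; first by rewrite exprn_ge0.
  by apply: ler_peMl => //; rewrite (ler_nat R 1 4).
have P2le i j : #|P2 i j|%:R <= (4 * e) * #|{: F}|%:R.
  apply: (event j) => // f.
  have b0 : 0 <= 4 * e * q%:R ^+ r.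
    by apply: mulr_ge0; [exact: mulr_ge0 | rewrite exprn_ge0].
  case: (boolP ((i != j) && (2 * L <= size (Phi (w f i)))%N)) => [/andP[ij sz]|nij].
    have le2 : (L <= 2 * L)%N by rewrite leq_pmull.
    have s1 : size (take L (Phi (w f i))) = L by rewrite size_takel// (leq_trans le2).
    have s2 : size (take L (rev (Phi (w f i)))) = L.
      by rewrite size_takel// size_rev (leq_trans le2).
    have [a1 a2] := prefB _ s1; have [a3 a4] := prefB _ s2.
    apply: le_trans (_ : (count (overlap L (w f i)) (ball X r))%:R <= _).
      rewrite -card_freeball_pred ler_nat; apply: subset_leq_card.
      apply/fintype.subsetP => x; rewrite !inE /P2 /w /resample !ffunE eqxx (negPf ij).
      by case/and3P.
    apply: le_trans (_ : (
      (count (fun u => take L (Phi u) == take L (Phi (w f i))) (ball X r) +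
       count (fun u => take L (Phi u) == take L (rev (Phi (w f i)))) (ball X r)) +
      (count (fun u => take L (rev (Phi u)) == take L (Phi (w f i))) (ball X r) +
       count (fun u => take L (rev (Phi u)) == take L (rev (Phi (w f i)))) (ball X r)))%N%:R <= _).
      rewrite ler_nat; elim: (ball X r) => //= u s IH.
      rewrite /overlap; case: (_ == _); case: (_ == _); case: (_ == _); case: (_ == _);
      by rewrite /= ?add0n ?add1n ?addSn ?addnS ?ltnS ?(leq_trans IH)// ?leqW//.
    by rewrite -mulrA; exact: sum4.
  rewrite (_ : #|_| = 0%N) ?mulr0n//; apply: eq_card0 => x; rewrite inE /P2.
  apply/negbTE; apply: contra nij => /and3P[ij sz _]; rewrite ij /=.
  by move: sz; rewrite /w /resample ffunE (negPf ij).
have F0 : 0 < #|{: F}|%:R :> R.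
  by rewrite ltr0n card_ffun expn_gt0 -(ltr0n R) S0.
pose good : pred F := [pred f | `[< separated_tuple (tuple_of_ffun f) >]].
have badle : #|predC good|%:R <= (N%:R + N%:R * N%:R) * (4 * e * #|{: F}|%:R).
  apply: le_trans (_ : (\sum_(j < N) #|P1 j| +
      \sum_(i < N) \sum_(j < N) #|P2 i j|)%N%:R <= _).
    rewrite ler_nat.
    have sumE (P : pred F) : #|P| = (\sum_(f : F) P f)%N.
      by rewrite -sum1_card big_mkcond; apply: eq_bigr => f _; rewrite unfold_in; case: (P f).
    apply: leq_trans (_ : \sum_(f : F)
      (\sum_(j < N) P1 j f + \sum_(i < N) \sum_(j < N) P2 i j f) <= _)%N; last first.
      rewrite big_split /= leq_add//.
        by rewrite exchange_big /=; apply: leq_sum => j _; rewrite sumE.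
      rewrite exchange_big /=; apply: leq_sum => i _.
      by rewrite exchange_big /=; apply: leq_sum => j _; rewrite sumE.
    rewrite sumE; apply: leq_sum => f _; case: (boolP (predC good f)) => //= ng.
    rewrite lt0n addn_eq0 negb_and !sum_nat_eq0 !negb_forall.
    apply: contraNT ng; rewrite negb_or !negb_exists => /andP[/forallP h1 /forallP h2].
    apply/asboolP; exists L; split=> [j|i j ij]; rewrite !tnth_mktuple.
      by have := h1 j; rewrite /P1 /= eqb0 !negbK.
    have := h2 i; rewrite negbK sum_nat_eq0 => /forallP/(_ j) /=.
    rewrite eqb0 /P2 ij /= negb_and => /orP[|//].
    by have := h1 i; rewrite /P1 /= eqb0 negbK /bad negb_or -leqNgt => /andP[-> _].
  rewrite natrD !natr_sum mulrDl; apply: lerD.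
    apply: le_trans (ler_sum _ (fun j _ => P1le j)) _.
    by rewrite sumr_const card_ord -[leLHS]mulr_natl.
  apply: le_trans (_ : \sum_(i < N) (N%:R * (4 * e * #|{: F}|%:R)) <= _).
    apply: ler_sum => i _; rewrite natr_sum.
    apply: le_trans (ler_sum _ (fun j _ => P2le i j)) _.
    by rewrite sumr_const card_ord -[leLHS]mulr_natl.
  by rewrite sumr_const card_ord -[leLHS]mulr_natl mulrA.
have -> : #|` fset_set (@size_ball X N r)| = #|{: F}|.
  have := card_size_ball r (setT : set (N.-tuple (freeword X))).
  rewrite setIT => ->; apply: eq_card => f; rewrite !inE.
  exact/asboolP.
rewrite card_size_ball -/good.
have gE : #|good|%:R = #|{: F}|%:R - #|predC good|%:R :> R.
  by rewrite -(cardC good) natrD addrK.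
rewrite gE mulrBl divff ?gt_eqF// opprB addrC subrK ler_pdivrMr//.
apply: le_trans badle _.
have ed : rho ^+ k <= delta ^- c * delta ^+ r.
  apply: le_trans (_ : delta ^+ (c * k) <= _).
    rewrite exprM; apply: lerXn2r => //; rewrite ?nnegrE ?exprn_ge0// ltW//.
  rewrite [leRHS]mulrC ler_pdivlMr ?exprn_gt0// -exprD.
  apply: ler_wiXn2l; [exact: ltW|exact: ltW|].
  by rewrite mulnC addnC -mulSn ltnW// ltn_ceil.
have -> : (N%:R + N%:R * N%:R) * (4 * e * #|{: F}|%:R) = M * rho ^+ k * #|{: F}|%:R.
  by rewrite /M /e; ring.
rewrite ler_wpM2r ?ler0n// -mulrA; apply: ler_pM => //; first by rewrite exprn_ge0// ltW.
by rewrite lerDr.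
Qed.
End Genericity.

(** * A programming language for multitape machines *)

Section Programs.
Context (Sigma wk : finType).
Local Notation sym := (tape_symbol Sigma wk).

(* Programs act on one tape at a time; the state set of the compiled machine
   is the set of positions in the program text. *)
Inductive program : Type :=
| Op (i : nat) (f : sym -> sym * direction)
| Seq (c1 c2 : program)
| Switch (T : finType) (i : nat) (f : sym -> T) (c : T -> program)
| While (i : nat) (p : pred sym) (c : program).

(* A tape without the junk blanks at its ends: the symbols to the left of the
   head, nearest first, and those from the head rightwards. *)
Definition stape : Type := ((nat -> sym) * (nat -> sym))%type.

Definition scons (a : sym) (s : nat -> sym) : nat -> sym :=
  fun n => if n is n'.+1 then s n' else a.

Definition act (t : stape) (a : sym * direction) : stape :=
  match a.2 with
  | Left => (t.1 \o S, scons (t.1 0) (scons a.1 (t.2 \o S)))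
  | Stay => (t.1, scons a.1 (t.2 \o S))
  | Right => (scons a.1 t.1, t.2 \o S)
  end.

Definition stapes := nat -> stape.
Definition upd (T : stapes) (i : nat) (t : stape) : stapes :=
  fun j => if j == i then t else T j.
Definition reads (T : stapes) (i : nat) : sym := (T i).2 0.

Inductive exec : program -> stapes -> nat -> stapes -> Prop :=
| exec_op i f T : exec (Op i f) T 1 (upd T i (act (T i) (f (reads T i))))
| exec_seq c1 c2 T T1 T2 n1 n2 : exec c1 T n1 T1 -> exec c2 T1 n2 T2 ->
    exec (Seq c1 c2) T (n1 + n2) T2
| exec_switch (E : finType) i (f : sym -> E) c T T' n :
    exec (c (f (reads T i))) T n T' -> exec (Switch i f c) T n.+1 T'
| exec_while_stop i (p : pred sym) c T : ~~ p (reads T i) -> exec (While i p c) T 1 T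
| exec_while_step i (p : pred sym) c T T1 T2 n1 n2 : p (reads T i) ->
    exec c T n1 T1 -> exec (While i p c) T1 n2 T2 ->
    exec (While i p c) T (n1.+1 + n2) T2.

Fixpoint uses_tapes (n : nat) (c : program) : Prop :=
  match c with
  | Op i _ => i < n
  | Seq c1 c2 => uses_tapes n c1 /\ uses_tapes n c2
  | Switch _ i _ c => i < n /\ forall x, uses_tapes n (c x)
  | While i _ c => i < n /\ uses_tapes n c
  end.

(** For a switch or a loop, [None] is the test itself and [Some] a place inside a body. *)
Fixpoint pos (c : program) : finType :=
  match c with
  | Op _ _ => unit
  | Seq c1 c2 => (pos c1 + pos c2)%type
  | Switch E _ _ c => option {x : E & pos (c x)}
  | While _ _ c => option (pos c)
  end.

Fixpoint entry (c : program) : pos c :=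
  match c return pos c with
  | Op _ _ => tt
  | Seq c1 c2 => inl (entry c1)
  | Switch _ _ _ _ => None
  | While _ _ _ => None
  end.

Definition tape_action := option (nat * (sym * direction)).

(* The next position (None: exit) and the action performed. *)
Fixpoint next (c : program) (rd : nat -> sym) :
    pos c -> option (pos c) * tape_action :=
  match c return pos c -> option (pos c) * tape_action with
  | Op i f => fun _ => (None, Some (i, f (rd i)))
  | Seq c1 c2 => fun s =>
      match s with
      | inl s1 => let: (o, a) := next rd s1 in
                  (Some (if o is Some s' then inl s' else inr (entry c2)), a)
      | inr s2 => let: (o, a) := next rd s2 in (omap inr o, a)
      end
  | Switch E i f c => fun s =>
      match s with
      | None => (Some (Some (existT _ (f (rd i)) (entry (c (f (rd i)))))), None)
      | Some (existT x s') => let: (o, a) := next rd s' in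
          (omap (fun s'' => Some (existT (fun x => pos (c x) : Type) x s'')) o, a)
      end
  | While i p c => fun s =>
      match s with
      | None => (if p (rd i) then Some (Some (entry c)) else None, None)
      | Some s' => let: (o, a) := next rd s' in (Some o, a)
      end
  end.

Definition apply_action (T : stapes) (a : tape_action) : stapes :=
  if a is Some (i, b) then upd T i (act (T i) b) else T.

Inductive reach (c : program) : pos c -> stapes -> nat -> stapes -> Prop :=
| reach_exit s T a : next (reads T) s = (None, a) ->
    reach s T 1 (apply_action T a)
| reach_next s T s' a n T' : next (reads T) s = (Some s', a) ->
    reach s' (apply_action T a) n T' -> reach s T n.+1 T'.

Lemma reach_seq2 c1 c2 s T n T1 : @reach c2 s T n T1 ->
  @reach (Seq c1 c2) (inr s : pos (Seq c1 c2)) T n T1.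
Proof.
elim=> {s T n T1} [s T a e|s T s' a n T' e r IH].
  by apply: (@reach_exit (Seq c1 c2)) => /=; rewrite e.
by apply: (reach_next (c := Seq c1 c2)) IH; rewrite /= e.
Qed.

Lemma reach_seq1 c1 c2 s T n T1 n2 T2 : @reach c1 s T n T1 ->
  @reach c2 (entry c2) T1 n2 T2 ->
  @reach (Seq c1 c2) (inl s : pos (Seq c1 c2)) T (n + n2) T2.
Proof.
move=> r r2; elim: r => {s T n T1} [s T a e|s T s' a n T' e r IH] in r2 *.
  have e' : @next (Seq c1 c2) (reads T) (inl s) = (Some (inr (entry c2)), a).
    by rewrite /= e.
  exact: (reach_next e' (reach_seq2 _ r2)).
by apply: (reach_next (c := Seq c1 c2)) (IH r2); rewrite /= e.
Qed.

Lemma reach_switch (E : finType) i (f : sym -> E) (c : E -> program) x s T n T1 :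
  @reach (c x) s T n T1 ->
  @reach (Switch i f c) (Some (existT _ x s) : pos (Switch i f c)) T n T1.
Proof.
elim=> {s T n T1} [s T a e|s T s' a n T' e r IH].
  by apply: (@reach_exit (Switch i f c)) => /=; rewrite e.
by apply: (reach_next (c := Switch i f c)) IH; rewrite /= e.
Qed.

Lemma reach_while i p c s T n T1 n2 T2 : @reach c s T n T1 ->
  @reach (While i p c) (None : pos (While i p c)) T1 n2 T2 ->
  @reach (While i p c) (Some s : pos (While i p c)) T (n + n2) T2.
Proof.
move=> r r2; elim: r => {s T n T1} [s T a e|s T s' a n T' e r IH] in r2 *.
  by apply: (reach_next (c := While i p c)) r2; rewrite /= e.
by apply: (reach_next (c := While i p c)) (IH r2); rewrite /= e.
Qed.

Lemma exec_reach c T n T' : exec c T n T' -> reach (entry c) T n T'.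
Proof.
elim=> {c T n T'} [i f T|c1 c2 T T1 T2 n1 n2 _ IH1 _ IH2|E i f c T T' n _ IH
    |i p c T np|i p c T T1 T2 n1 n2 pT _ IH1 _ IH2].
- exact: (@reach_exit (Op i f) tt T (Some (i, f (reads T i)))).
- exact: reach_seq1 IH1 IH2.
- apply: (@reach_next (Switch i f c) None T _ None) => //.
  exact: reach_switch IH.
- apply: (@reach_exit (While i p c) None T None) => /=.
  by rewrite (negPf np).
- apply: (@reach_next (While i p c) None T (Some (entry c)) None).
    by rewrite /= pT.
  exact: reach_while IH1 IH2.
Qed.

(** The state [None] halts. A tape on which no action takes place rewrites the symbol it reads. *)
Definition compile (n : nat) (c : program) : machine Sigma :=
  @Machine Sigma n wk (option (pos c)) (Some (entry c)) (fun s => s == None)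
    (fun s rd =>
      if s is Some s' then
        let: (o, a) := next (fun i => nth None rd i) s' in
        (o, [tuple if a is Some (j, b) then
                     if j == i :> nat then b else (tnth rd i, Stay)
                   else (tnth rd i, Stay) | i < n.+1])
      else (None, [tuple (tnth rd i, Stay) | i < n.+1])).

Definition stape_of (t : tape Sigma wk) : stape := (nth None t.1, nth None t.2).

Lemma scons_head (f : nat -> sym) : scons (f 0) (f \o S) = f.
Proof. by apply/funext => -[|j]. Qed.

Lemma scons_nth a (s : seq sym) : scons a (nth None s) = nth None (a :: s).
Proof. by apply/funext => -[|j]. Qed.

Lemma nth_behead' (s : seq sym) : nth None s \o S = nth None (behead s).
Proof. by apply/funext => j /=; rewrite nth_behead. Qed.

Lemma nth0_head (s : seq sym) : nth None s 0 = head None s.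
Proof. by case: s. Qed.

Lemma stape_of_act t a : stape_of (tape_act t a) = act (stape_of t) a.
Proof.
case: t a => l r [x []]; rewrite /stape_of /tape_act /act /=.
- by rewrite !nth_behead' !scons_nth nth0_head.
- by rewrite !nth_behead' !scons_nth.
- by rewrite !nth_behead' !scons_nth.
Qed.

Lemma act_stay (t : stape) : act t (t.2 0, Stay) = t.
Proof. by case: t => l r; rewrite /act /= scons_head. Qed.

Definition represents n (ts : n.+1.-tuple (tape Sigma wk)) (T : stapes) :=
  forall i : 'I_n.+1, stape_of (tnth ts i) = T i.

Lemma tape_readE (t : tape Sigma wk) : tape_read t = (stape_of t).2 0.
Proof. by case: t => l []. Qed.

(** Links the infinitely many tapes of [stapes] with the finitely many of the machine: a program
    neither reads nor changes the others. *)
Lemma next_ext c n rd rd' (s : pos c) : uses_tapes n c ->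
  (forall i, i < n -> rd i = rd' i) ->
  next rd s = next rd' s /\
  (forall i b, (next rd s).2 = Some (i, b) -> i < n).
Proof.
move=> + rdE; elim: c s => [i f|c1 IH1 c2 IH2|E i f c IH|i p c IH] s /=.
- by move=> ni; split=> [|j b [<-]//]; rewrite rdE.
- case=> h1 h2; case: s => s.
    by have [<-] := IH1 s h1; case: (next rd s).
  by have [<-] := IH2 s h2; case: (next rd s).
- case=> ni h; case: s => [[x s]|]; last by rewrite rdE.
  by have [<-] := IH x s (h x); case: (next rd s).
- case=> ni h; case: s => [s|]; last by rewrite rdE.
  by have [<-] := IH s h; case: (next rd s).
Qed.

Lemma step_compile n c (s : pos c) ts T o a : uses_tapes n.+1 c ->
  represents ts T -> next (reads T) s = (o, a) ->
  exists ts', @step _ (compile n c) (Some s, ts) = (o, ts') /\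
    represents ts' (apply_action T a).
Proof.
move=> wf rep; rewrite /step /=.
have rdE i : i < n.+1 ->
    nth None (map_tuple (@tape_read _ _) ts) i = reads T i.
  move=> ni; rewrite -[i]/(val (Ordinal ni)) -tnth_nth tnth_map tape_readE.
  by rewrite rep.
have [eN iN] := next_ext s wf rdE.
rewrite eN; move=> e; move: iN; rewrite eN e /= => iN.
eexists; split; first by reflexivity.
move=> i; rewrite tnth_mktuple stape_of_act tnth_mktuple rep.
have stay : act (T i) (tape_read (tnth ts i), Stay) = T i.
  by rewrite tape_readE rep act_stay.
rewrite tnth_map; case: a iN {e} => [[j b]|] iN //=.
by rewrite /upd [in RHS]eq_sym; case: eqP => // ->.
Qed.

Lemma reach_compile n c (s : pos c) ts T t T' : uses_tapes n.+1 c ->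
  represents ts T -> reach s T t T' ->
  exists ts' : n.+1.-tuple (tape Sigma wk), iter t (@step _ (compile n c)) (Some s, ts) = (None, ts') /\
    represents ts' T'.
Proof.
move=> wf + r; elim: r ts => {s T t T'} [s T a e|s T s' a t T' e r IH] ts rep.
  exact: step_compile e.
have [ts1 [e1 rep1]] := step_compile wf rep e.
have [ts2 [e2 rep2]] := IH _ rep1.
by exists ts2; rewrite iterSr e1.
Qed.

Definition blank_stape : stape := (fun=> None, fun=> None).

Definition input_stapes (s : seq Sigma) : stapes :=
  upd (fun=> blank_stape) 0 (fun=> None, nth None [seq Some (inl x) | x <- s]).

Lemma run_compile n c s t T : uses_tapes n.+1 c ->
  exec c (input_stapes s) t T ->
  exists ts, run (compile n c) s t = (None, ts) /\ represents ts T.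
Proof.
move=> wf /exec_reach; apply: reach_compile => // i.
rewrite tnth_mktuple /input_stapes /upd /stape_of /=.
have e0 : nth None [::] = (fun=> None) :> (nat -> sym).
  by apply/funext => j; rewrite nth_nil.
by rewrite -val_eqE /=; case: eqP; rewrite e0.
Qed.

Lemma halts_within_mono (M : machine Sigma) s t t' : t <= t' ->
  halts_within M s t -> halts_within M s t'.
Proof.
move=> /subnK <-; rewrite /halts_within /run addnC; elim: (t' - t) => [|d IH].
  by rewrite addn0.
by move=> /IH h; rewrite addnS iterS /step h.
Qed.

Lemma input_prefix_nth (r : seq sym) (o : seq Sigma) :
  nth None r = nth None [seq Some (inl x) | x <- o] -> input_prefix r = o.
Proof.
elim: o r => [|x o IH] [|y r] /= E //; have /= := congr1 (fun f => f 0) E.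
- by move=> ->.
- by [].
- move=> ->; congr (_ :: _); apply: IH; apply/funext => j.
  exact: (congr1 (fun f => f j.+1) E).
Qed.

Lemma outputs_compile n c s t T o : uses_tapes n.+1 c ->
  exec c (input_stapes s) t T ->
  (T 0).2 = nth None [seq Some (inl x) | x <- o] ->
  outputs (compile n c) s o.
Proof.
move=> wf e E; have [ts [eq rep]] := run_compile wf e.
exists t; rewrite /halts_within eq /=; split=> //.
by apply: input_prefix_nth; rewrite -E; exact: (congr1 snd (rep ord0)).
Qed.

Lemma halts_compile n c s t t' T : uses_tapes n.+1 c ->
  exec c (input_stapes s) t T -> t <= t' -> halts_within (compile n c) s t'.
Proof.
move=> wf e le; apply: halts_within_mono le _.
by have [ts [eq _]] := run_compile wf e; rewrite /halts_within eq.
Qed.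

End Programs.

(** * Running times of sequences and loops *)

Section Loops.
Context (Sigma wk : finType).
Local Notation sym := (tape_symbol Sigma wk).
Local Notation prog := (program Sigma wk).
Local Notation stapes := (stapes Sigma wk).

Definition runs (c : prog) (T : stapes) (n : nat) (T' : stapes) : Prop :=
  exists2 n', n' <= n & exec c T n' T'.

Lemma runs_le c T n n' T' : n <= n' -> runs c T n T' -> runs c T n' T'.
Proof. by move=> le [t tn e]; exists t => //; exact: leq_trans le. Qed.

Lemma runs_eq c T n n' T1 T2 : runs c T n T1 -> n <= n' -> T1 = T2 ->
  runs c T n' T2.
Proof. by move=> r le <-; exact: runs_le r. Qed.

Lemma runs_seq c1 c2 T T1 T2 n1 n2 n : runs c1 T n1 T1 -> runs c2 T1 n2 T2 ->
  n1 + n2 <= n -> runs (Seq c1 c2) T n T2.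
Proof.
move=> [t1 le1 e1] [t2 le2 e2] le; exists (t1 + t2); first lia.
exact: exec_seq e1 e2.
Qed.

(** Hands the remaining time budget on, so that a long sequence leaves only simple inequalities. *)
Lemma runs_seq_sub c1 c2 T T1 T2 n1 n : runs c1 T n1 T1 -> n1 <= n ->
  runs c2 T1 (n - n1) T2 -> runs (Seq c1 c2) T n T2.
Proof. by move=> r1 le r2; apply: runs_seq r1 r2 _; lia. Qed.

Lemma runs_op i f T : runs (Op i f) T 1 (upd T i (act (T i) (f (reads T i)))).
Proof. by exists 1 => //; exact: exec_op. Qed.

Lemma runs_switch (E : finType) i (f : sym -> E) c T n T' :
  runs (c (f (reads T i))) T n T' -> runs (Switch i f c) T n.+1 T'.
Proof. by move=> [t le e]; exists t.+1 => //; exact: exec_switch. Qed.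

Lemma runs_while_stop i (p : pred sym) c T : ~~ p (reads T i) ->
  runs (While i p c) T 1 T.
Proof. by move=> np; exists 1 => //; exact: exec_while_stop. Qed.

Lemma runs_while_step i (p : pred sym) c T T1 T2 n1 n2 n : p (reads T i) ->
  runs c T n1 T1 -> runs (While i p c) T1 n2 T2 -> n1.+1 + n2 <= n ->
  runs (While i p c) T n T2.
Proof.
move=> pT [t1 le1 e1] [t2 le2 e2] le; exists (t1.+1 + t2); first lia.
exact: exec_while_step pT e1 e2.
Qed.

Definition lists (l r : seq sym) : stape Sigma wk := (nth None l, nth None r).

(** A head moving over the end of the written part leaves explicit blanks; as functions, the tapes
    are the same. *)
Lemma lists_blank_left r : lists [:: None] r = lists [::] r.
Proof. by congr pair; apply/funext => -[|[]]. Qed.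

Lemma lists_blank_right l r : lists l (rcons r None) = lists l r.
Proof.
congr pair; apply/funext => j; rewrite nth_rcons.
by case: ltnP => // le; rewrite nth_default//; case: ifP.
Qed.

Lemma act_left l r a :
  act (lists l r) (a, Left) = lists (behead l) (head None l :: a :: behead r).
Proof. by rewrite /act /lists /= !nth_behead' !scons_nth nth0_head. Qed.

Lemma act_right l r a : act (lists l r) (a, Right) = lists (a :: l) (behead r).
Proof. by rewrite /act /lists /= !nth_behead' !scons_nth. Qed.

Lemma act_stay_lists l r a : act (lists l r) (a, Stay) = lists l (a :: behead r).
Proof. by rewrite /act /lists /= !nth_behead' !scons_nth. Qed.

Lemma upd_upd (T : stapes) i t t' : upd (upd T i t) i t' = upd T i t'.
Proof. by apply/funext => j; rewrite /upd; case: eqP. Qed.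

Lemma upd_same (T : stapes) i : upd T i (T i) = T.
Proof. by apply/funext => j; rewrite /upd; case: eqP => // ->. Qed.

Lemma upd_at (T : stapes) i t : upd T i t i = t.
Proof. by rewrite /upd eqxx. Qed.

Definition move_keep (d : direction) (y : sym) := (y, d).
Definition move_if (er : bool) (d : direction) (y : sym) :=
  (if er then None else y, d).

Definition nop : prog := Op 0 (move_keep Stay).

Lemma runs_nop T : runs nop T 1 T.
Proof.
by have := runs_op 0 (move_keep Stay) T; rewrite act_stay upd_same.
Qed.

Definition for_right (p : pred sym) i er (body : sym -> prog) : prog :=
  While i p (Seq (Switch i id body) (Op i (move_if er Right))).

Definition for_left (p : pred sym) i er (body : sym -> prog) : prog :=
  Seq (Op i (move_keep Left))
   (Seq (While i p (Seq (Switch i id body) (Op i (move_if er Left))))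
        (Op i (move_keep Right))).

Section Fold.
Context (St : Type) (enc : St -> stapes) (g : St -> sym -> St) (n i : nat).
Context (er : bool) (p : pred sym) (body : sym -> prog).
Let correct x := forall s l r,
  runs (body x) (upd (enc s) i (lists l (x :: r))) n
                (upd (enc (g s x)) i (lists l (x :: r))).

Lemma runs_for_right s l r r' : (er -> l = [::]) -> all p r ->
  ~~ p (head None r') -> {in r, forall x, correct x} ->
  runs (for_right p i er body) (upd (enc s) i (lists l (r ++ r')))
    (size r * n.+3).+1
    (upd (enc (foldl g s r)) i (lists (if er then [::] else catrev r l) r')).
Proof.
move=> + + nr'; elim: r s l => [|x r IH] s l el.
  move=> _ _; have -> : (if er then [::] else catrev [::] l) = l.
    by case: er el => // ->.
  apply: runs_while_stop; rewrite /reads upd_at /=.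
  by case: r' nr'.
case/andP=> px pr cor.
set l' := if er then [::] else x :: l.
apply: (runs_while_step (T1 := upd (enc (g s x)) i (lists l' (r ++ r')))
   (n1 := n.+2) (n2 := (size r * n.+3).+1)); last by rewrite /=; lia.
- by rewrite /reads upd_at.
- apply: (runs_seq (n1 := n.+1) (n2 := 1)); last by lia.
    apply: runs_switch; rewrite /reads upd_at /=.
    exact: cor (mem_head _ _) _ _ _.
  have := runs_op i (move_if er Right)
    (upd (enc (g s x)) i (lists l (x :: r ++ r'))).
  rewrite /reads !upd_at upd_upd /= act_right /= /l'.
  by case: er el => [->//|_]; rewrite ?lists_blank_left.
- have -> : (if er then [::] else catrev (x :: r) l) =
            (if er then [::] else catrev r l').
    by rewrite /l'; case: er.
  apply: IH => //; first by rewrite /l'; case: er.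
  by move=> y yr; apply: cor; rewrite inE yr orbT.
Qed.

Lemma runs_for_left s l r : (er -> r = [::]) -> all p l -> ~~ p None ->
  {in l, forall x, correct x} ->
  runs (for_left p i er body) (upd (enc s) i (lists l r)) (size l * n.+3 + 3)
    (upd (enc (foldl g s l)) i (lists [::] (if er then [::] else catrev l r))).
Proof.
move=> er0 pl np cor.
(* During the loop the head is on the next symbol to treat, one cell left of where the statement
   places it; hence the extra moves before and after the loop. *)
set h := fun s l r => upd (enc s) i (lists (behead l) (head None l :: r)).
apply: (runs_seq (n1 := 1) (T1 := h s l r) (n2 := size l * n.+3 + 2)); last lia.
  have := runs_op i (move_keep Left) (upd (enc s) i (lists l r)).
  rewrite /reads !upd_at upd_upd /= act_left /h.
  case: r {er0} => // ; rewrite /=.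
  by rewrite (lists_blank_right _ [:: head None l]).
apply: (runs_seq (n1 := (size l * n.+3).+1) (n2 := 1)
  (T1 := h (foldl g s l) [::] (if er then [::] else catrev l r))); last lia.
  elim: l s r er0 pl cor => [|x l IH] s r er0.
    move=> _ _; have -> : (if er then [::] else catrev [::] r) = r.
      by case: er er0 => // ->.
    by apply: runs_while_stop; rewrite /reads /h upd_at.
  case/andP=> px pl cor.
  set r' := if er then [::] else x :: r.
  apply: (runs_while_step (T1 := h (g s x) l r')
     (n1 := n.+2) (n2 := (size l * n.+3).+1)); last by rewrite /=; lia.
  - by rewrite /reads /h upd_at.
  - apply: (runs_seq (n1 := n.+1) (n2 := 1)); last by lia.
      apply: runs_switch; rewrite /reads /h upd_at /=.
      exact: cor (mem_head _ _) _ _ _.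
    have := runs_op i (move_if er Left) (upd (enc (g s x)) i (lists l (x :: r))).
    rewrite /reads !upd_at upd_upd /= act_left /= /h /r'.
    case: er er0 => [->//|_//].
    by rewrite (lists_blank_right _ [:: head None l]).
  - have -> : (if er then [::] else catrev (x :: l) r) =
              (if er then [::] else catrev l r').
      by rewrite /r'; case: er.
    apply: IH => //; first by rewrite /r'; case: er.
    by move=> y yr; apply: cor; rewrite inE yr orbT.
have := runs_op i (move_keep Right)
  (h (foldl g s l) [::] (if er then [::] else catrev l r)).
by rewrite /reads /h !upd_at upd_upd /= act_right lists_blank_left.
Qed.
End Fold.
End Loops.

(** * The peeling machine *)

Section Machine.
Context (X : finType) (k m : nat) (fl : letter X -> seq 'I_3) (D : nat).
Hypothesis flV : forall l, fl (inv_letter l) = rev (fl l).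
Hypothesis flD : forall l, size (fl l) <= D.

Local Notation Sigma := (option (letter X)).
Local Notation sym := (tape_symbol Sigma 'I_3).
Local Notation prog := (program Sigma 'I_3).
Local Notation stapes := (stapes Sigma 'I_3).
Local Notation lists := (@lists Sigma 'I_3).
Implicit Types (T : stapes) (c : 'I_3) (x : letter X) (w : word X).

Definition symW c : sym := Some (inr c).
Definition symL x : sym := Some (inl (Some x)).
Definition symSep : sym := Some (inl None).
Definition is_symL (y : sym) := if y is Some (inl (Some _)) then true else false.

Definition on_letter (f : letter X -> prog) (y : sym) : prog :=
  if y is Some (inl (Some x)) then f x else nop _ _.
Definition on_color (f : 'I_3 -> prog) (y : sym) : prog :=
  if y is Some (inr c) then f c else nop _ _.

Arguments on_letter : simpl never.
Arguments on_color : simpl never.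

Definition seqs (cs : seq prog) : prog := foldr (@Seq _ _) (nop _ _) cs.
Definition write i y : prog := Op i (fun _ : sym => (y, Right)).
Definition move i d : prog := Op i (@move_keep Sigma 'I_3 d).
Definition pop i : prog := Seq (move i Left) (Op i (fun _ : sym => (None, Stay))).

(** A reduced word is stored as a stack with its top just left of the head, so [push] inspects a
    single cell. *)
Definition push_color i c : prog :=
  Seq (move i Left)
    (Switch i (fun y : sym => y == symW c)
       (fun b => if b then Op i (fun _ => (None, Stay))
                 else Seq (move i Right) (write i (symW c)))).

Definition push_colors i u := seqs (map (push_color i) u).
Definition write_colors i u := seqs (map (fun c => write i (symW c)) u).

Lemma runs_write i y T l : T i = lists l [::] ->
  runs (write i y) T 1 (upd T i (lists (y :: l) [::])).
Proof.
by move=> Ti; have := runs_op i (fun=> (y, Right)) T; rewrite Ti act_right.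
Qed.

Lemma runs_put i y T l r : T i = lists l r ->
  runs (Op i (fun _ : sym => (y, Stay))) T 1
    (upd T i (lists l (y :: behead r))).
Proof.
by move=> Ti; have := runs_op i (fun=> (y, Stay)) T; rewrite Ti act_stay_lists.
Qed.

Lemma runs_move_left i T l r : T i = lists l r ->
  runs (move i Left) T 1 (upd T i (lists (behead l) (head None l :: r))).
Proof.
move=> Ti; have := runs_op i (move_keep Left) T.
rewrite /reads Ti act_left; case: r {Ti} => //=.
by rewrite (lists_blank_right _ [:: _]).
Qed.

Lemma runs_move_right i T l y r : T i = lists l (y :: r) ->
  runs (move i Right) T 1 (upd T i (lists (y :: l) r)).
Proof.
by move=> Ti; have := runs_op i (move_keep Right) T; rewrite /reads Ti act_right.
Qed.

Lemma runs_pop i T l : T i = lists l [::] ->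
  runs (pop i) T 2 (upd T i (lists (behead l) [::])).
Proof.
move=> Ti; apply: (runs_seq (n2 := 1) (runs_move_left Ti)) => //.
have := runs_put None (upd_at T i (lists (behead l) [:: head None l])).
by rewrite upd_upd /= (lists_blank_right _ [::]).
Qed.

Lemma runs_push_color i c T s : T i = lists (map symW s) [::] ->
  runs (push_color i c) T 4 (upd T i (lists (map symW (push c s)) [::])).
Proof.
move=> Ti; apply: (runs_seq (n2 := 3) (runs_move_left Ti)) => //.
apply: runs_switch; rewrite {1}/reads upd_at /=.
case: s Ti => [|a s] Ti /=.
  apply: (runs_seq (n2 := 1) (runs_move_right (upd_at _ _ _))) => //.
  have := @runs_write i (symW c) (upd T i (lists [::] [::])) [::].
  by rewrite upd_at !upd_upd lists_blank_left => /(_ erefl).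
rewrite (_ : (symW a == symW c) = (c == a)); last first.
  by apply/eqP/eqP => [[->]|->].
case: eqP => _.
  have := runs_put None (upd_at T i (lists (map symW s) [:: symW a])).
  by rewrite upd_upd /= (lists_blank_right _ [::]); exact: runs_le.
apply: (runs_seq (n2 := 1) (runs_move_right (upd_at _ _ _))) => //.
have := @runs_write i (symW c) (upd T i (lists (symW a :: map symW s) [::]))
  (symW a :: map symW s).
by rewrite upd_at !upd_upd => /(_ erefl).
Qed.

Lemma runs_push_colors i u T s : T i = lists (map symW s) [::] ->
  runs (push_colors i u) T (4 * size u + 1)
    (upd T i (lists (map symW (foldl (fun s c => push c s) s u)) [::])).
Proof.
elim: u T s => [|c u IH] T s Ti /=; first by rewrite -Ti upd_same; exact: runs_nop.
apply: (runs_seq (runs_push_color c Ti) (n2 := 4 * size u + 1)); last lia.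
have := IH _ _ (upd_at T i (lists (map symW (push c s)) [::])).
by rewrite upd_upd.
Qed.

Lemma runs_write_colors i u T l : T i = lists l [::] ->
  runs (write_colors i u) T (size u + 1)
    (upd T i (lists (catrev (map symW u) l) [::])).
Proof.
elim: u T l => [|c u IH] T l Ti /=; first by rewrite -Ti upd_same; exact: runs_nop.
apply: (runs_seq (runs_write _ Ti) (n2 := size u + 1)); last lia.
have := IH _ _ (upd_at T i (lists (symW c :: l) [::])).
by rewrite upd_upd.
Qed.

(** Tape 0: input, then output. Tape 1: the current conjugate. Tape 2: the product under
    construction. Tape 3: a copy of the conjugate, for comparing lengths. Tape 4: the clock, one
    symbol per pass. Tapes 5 and up: the words a_i. *)
Definition mk (io v b r q : stape Sigma 'I_3) (rw : stapes) : stapes :=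
  fun i => match i with
  | 0 => io | 1 => v | 2 => b | 3 => r | 4 => q | j.+4.+1 => rw j end.

Lemma upd_mk io v b r q rw t :
  ((upd (mk io v b r q rw) 0 t = mk t v b r q rw) *
   (upd (mk io v b r q rw) 1 t = mk io t b r q rw) *
   (upd (mk io v b r q rw) 2 t = mk io v t r q rw) *
   (upd (mk io v b r q rw) 3 t = mk io v b t q rw) *
   (upd (mk io v b r q rw) 4 t = mk io v b r t rw) *
   (forall i, upd (mk io v b r q rw) i.+4.+1 t = mk io v b r q (upd rw i t)))%type.
Proof.
by do ![split] => *; apply/funext => -[|[|[|[|[|j]]]]].
Qed.

Definition go_right i := for_right isSome i false (fun=> nop Sigma 'I_3).
Definition go_left i := for_left isSome i false (fun=> nop Sigma 'I_3).
Definition erase_left i := for_left isSome i true (fun=> nop Sigma 'I_3).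
Definition erase_right i := for_right isSome i true (fun=> nop Sigma 'I_3).

Lemma upd_id_eq T i t : T i = t -> upd T i t = T.
Proof. by move=> <-; exact: upd_same. Qed.

Lemma runs_go_right i T r : all isSome r -> T i = lists [::] r ->
  runs (go_right i) T (size r * 4).+1 (upd T i (lists (rev r) [::])).
Proof.
move=> ar Ti.
have := @runs_for_right _ _ unit (fun=> T) (fun s _ => s) 1 i false isSome
  (fun=> nop _ _) tt [::] r [::] _ ar isT (fun _ _ _ _ _ => runs_nop _).
by rewrite cats0 (upd_id_eq Ti); apply.
Qed.

Lemma runs_go_left i T l : all isSome l -> T i = lists l [::] ->
  runs (go_left i) T (size l * 4 + 3) (upd T i (lists [::] (rev l))).
Proof.
move=> ar Ti.
have := @runs_for_left _ _ unit (fun=> T) (fun s _ => s) 1 i false isSome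
  (fun=> nop _ _) tt l [::] _ ar isT (fun _ _ _ _ _ => runs_nop _).
by rewrite (upd_id_eq Ti); apply.
Qed.

Lemma runs_erase_left i T l : all isSome l -> T i = lists l [::] ->
  runs (erase_left i) T (size l * 4 + 3) (upd T i (lists [::] [::])).
Proof.
move=> ar Ti.
have := @runs_for_left _ _ unit (fun=> T) (fun s _ => s) 1 i true isSome
  (fun=> nop _ _) tt l [::] _ ar isT (fun _ _ _ _ _ => runs_nop _).
by rewrite (upd_id_eq Ti); apply.
Qed.

Lemma runs_erase_right i T r : all isSome r -> T i = lists [::] r ->
  runs (erase_right i) T (size r * 4).+1 (upd T i (lists [::] [::])).
Proof.
move=> ar Ti.
have := @runs_for_right _ _ unit (fun=> T) (fun s _ => s) 1 i true isSome
  (fun=> nop _ _) tt [::] r [::] _ ar isT (fun _ _ _ _ _ => runs_nop _).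
by rewrite cats0 (upd_id_eq Ti); apply.
Qed.

Lemma all_isSome_L w : all isSome (map symL w).
Proof. by elim: w. Qed.
Lemma all_isSome_W (s : seq 'I_3) : all isSome (map symW s).
Proof. by elim: s. Qed.

(* [push_raw s] pushes the letters of [raw_letter s] on tape 2, moving on the
   raw tape from its left end to its right end if [s.2] is false, and back if
   [s.2] is true. *)
Definition push_raw (s : letter 'I_k) : prog :=
  let i := (val s.1).+4.+1 in
  if s.2 then for_left isSome i false
                (on_letter (fun x => push_colors 2 (fl (inv_letter x))))
  else for_right isSome i false (on_letter (fun x => push_colors 2 (fl x))).

(** The output grows leftwards and the head stays on its first letter, where [outputs] starts
    reading. *)
Definition output_letter x : prog :=
  Seq (move 0 Left) (Op 0 (fun _ : sym => (symL x, Stay))).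

Definition output_raw (s : letter 'I_k) : prog :=
  let i := (val s.1).+4.+1 in
  if s.2 then Seq (for_right isSome i false
                    (on_letter (fun x => output_letter (inv_letter x))))
                  (go_left i)
  else Seq (go_right i) (for_left isSome i false (on_letter output_letter)).

Definition copy_pushing : prog :=
  for_right isSome 1 false
    (on_color (fun c => Seq (push_color 2 c) (write 3 (symW c)))).

Definition accept s : prog :=
  Seq (erase_left 1)
  (Seq (for_right isSome 2 true (on_color (fun c => write 1 (symW c))))
  (Seq (go_left 1) (output_raw s))).

Definition reject : prog := Seq (erase_right 2) (go_left 1).

(** The raw tape is scanned once in each direction. For an inverse letter the first scan starts at
    the right end, hence the two conditional moves. A symbol left on tape 3 after the comparison
    means that the new word is shorter. *)
Definition try_letter (s : letter 'I_k) : prog :=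
  let i := (val s.1).+4.+1 in
  Seq (if s.2 then go_right i else nop _ _)
  (Seq (push_raw s)
  (Seq copy_pushing
  (Seq (push_raw (inv_letter s))
  (Seq (if s.2 then go_left i else nop _ _)
  (Seq (for_left isSome 2 false (fun=> pop 3))
  (Seq (move 3 Left)
  (Seq (Switch 3 isSome
         (fun b => Seq (move 3 Right) (if b then accept s else reject)))
       (erase_left 3)))))))).

Lemma runs_output_letter x T r : T 0 = lists [::] r ->
  runs (output_letter x) T 2 (upd T 0 (lists [::] (symL x :: r))).
Proof.
move=> Ti.
apply: (runs_seq (n2 := 1) (runs_move_left Ti)) => //=.
have := runs_put (symL x) (upd_at T 0 (lists [::] (None :: r))).
by rewrite upd_upd.
Qed.

Section Raw.
Context (raw : 'I_k -> word X) (rw : stapes) (i : 'I_k).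
Hypothesis rwi : rw i = lists [::] (map symL (raw i)).

Lemma foldl_push_raw (f : letter X -> seq 'I_3) w s :
  foldl (fun s y => if y is Some (inl (Some x)) then
            foldl (fun s c => push c s) s (f x) else s) s (map symL w) =
  foldl (fun s c => push c s) s (flatten (map f w)).
Proof. by elim: w s => //= x w IH s; rewrite foldl_cat. Qed.

Definition raw_at (b : bool) : stape Sigma 'I_3 :=
  if b then lists (rev (map symL (raw i))) [::]
  else lists [::] (map symL (raw i)).

Lemma runs_push_raw b io v r q s :
  runs (push_raw (i, b))
    (mk io v (lists (map symW s) [::]) r q (upd rw i (raw_at b)))
    (size (raw i) * (4 * D + 4) + 3)
    (mk io v
       (lists (map symW (foldl (fun s c => push c s) s
          (flat fl (raw_letter raw (i, b))))) [::])
       r q (upd rw i (raw_at (~~ b)))).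
Proof.
set enc := fun s => mk io v (lists (map symW s) [::]) r q rw.
have cor f x s0 l r0 : (forall x, size (f x) <= D) ->
    runs (on_letter (fun x => push_colors 2 (f x)) (symL x))
      (upd (enc s0) i.+4.+1 (lists l (symL x :: r0))) (4 * D + 1)
      (upd (enc (foldl (fun s c => push c s) s0 (f x))) i.+4.+1
        (lists l (symL x :: r0))).
  move=> fD; rewrite /enc /= !upd_mk.
  refine (runs_eq (@runs_push_colors 2 (f x) _ s0 _) _ _) => //.
    by have := fD x; lia.
  by rewrite upd_mk.
have im (r0 : seq sym) : r0 =i map symL (raw i) -> forall y, y \in r0 ->
    exists x, y = symL x.
  by move=> r0E y; rewrite r0E => /mapP[x _ ->]; exists x.
have flV' x : size (fl (inv_letter x)) <= D by rewrite flV size_rev.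
rewrite /push_raw /= /raw_at; case: b => /=.
- set f := fun x => fl (inv_letter x).
  have := @runs_for_left _ _ _ enc (fun s y => if y is Some (inl (Some x)) then
            foldl (fun s c => push c s) s (f x) else s)
    (4 * D + 1) i.+4.+1 false isSome
    (on_letter (fun x => push_colors 2 (f x))) s
    (rev (map symL (raw i))) [::] _ _ isT.
  rewrite /enc !upd_mk -/(rev (rev _)) revK all_rev all_isSome_L => /(_ _ isT).
  move=> h; refine (runs_eq (h _ _) _ _) => //.
  + move=> y /im[]; first exact: mem_rev.
    by move=> x -> s0 l r0; have := cor f x s0 l r0 flV'; rewrite /enc !upd_mk.
  + by rewrite size_rev size_map; lia.
  + rewrite -map_rev foldl_push_raw /raw_letter /flat /inv_word /=.
    by rewrite !map_rev -map_comp.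
- have := @runs_for_right _ _ _ enc (fun s y => if y is Some (inl (Some x)) then
            foldl (fun s c => push c s) s (fl x) else s)
    (4 * D + 1) i.+4.+1 false isSome
    (on_letter (fun x => push_colors 2 (fl x))) s
    [::] (map symL (raw i)) [::] _ (all_isSome_L _) isT.
  rewrite /enc !upd_mk cats0 => h; refine (runs_eq (h _ _) _ _) => //.
  + move=> y /im[] // x -> s0 l r0.
    by have := cor fl x s0 l r0 flD; rewrite /enc !upd_mk.
  + by rewrite size_map; lia.
  + by rewrite foldl_push_raw.
Qed.

Lemma runs_copy_pushing io (q : stape Sigma 'I_3) (s V : seq 'I_3) T0 :
  runs copy_pushing
    (mk io (lists [::] (map symW V)) (lists (map symW s) [::])
        (lists [::] [::]) q T0)
    (size V * 8 + 1)
    (mk io (lists (rev (map symW V)) [::])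
       (lists (map symW (foldl (fun s c => push c s) s V)) [::])
       (lists (rev (map symW V)) [::]) q T0).
Proof.
set enc := fun p : seq 'I_3 * seq sym =>
  mk io (lists [::] [::]) (lists (map symW p.1) [::]) (lists p.2 [::]) q T0.
set g := fun (p : seq 'I_3 * seq sym) (y : sym) =>
  if y is Some (inr c) then (push c p.1, y :: p.2) else p.
have := @runs_for_right _ _ _ enc g 5 1 false isSome
  (on_color (fun c => Seq (push_color 2 c) (write 3 (symW c)))) (s, [::])
  [::] (map symW V) [::] _ (all_isSome_W _) isT.
rewrite /enc !upd_mk cats0 /= => h; refine (runs_eq (h _ _) _ _) => //.
- move=> y /mapP[c _ ->] [s0 t0] l r /=; rewrite !upd_mk.
  refine (runs_seq (n2 := 1) (@runs_push_color 2 c _ s0 _) _ _) => //.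
  rewrite upd_mk; refine (runs_eq (@runs_write 3 _ _ t0 _) _ _) => //.
  by rewrite upd_mk.
- by rewrite size_map; lia.
- have -> : forall s t, foldl g (s, t) (map symW V) =
      (foldl (fun s c => push c s) s V, catrev (map symW V) t).
    by elim: V {h} => //= c V IH s0 t0; rewrite IH.
  by [].
Qed.

(* The comparison of the sizes of two reduced words: [pop 3] is executed once
   for each letter on tape 2. *)
Lemma runs_compare io v (q : stape Sigma 'I_3) (s : seq 'I_3) t T0 :
  runs (for_left isSome 2 false (fun=> pop 3))
    (mk io v (lists (map symW s) [::]) (lists t [::]) q T0)
    (size s * 5 + 3)
    (mk io v (lists [::] (rev (map symW s)))
       (lists (drop (size s) t) [::]) q T0).
Proof.
set enc := fun t : seq sym =>
  mk io v (lists [::] [::]) (lists t [::]) q T0.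
have := @runs_for_left _ _ _ enc (fun t _ => behead t) 2 2 false isSome
  (fun=> pop 3) t (map symW s) [::] _ (all_isSome_W _) isT.
rewrite /enc !upd_mk /= => h; refine (runs_eq (h _ _) _ _) => //.
- move=> y _ t0 l r; rewrite !upd_mk.
  by refine (runs_eq (@runs_pop 3 _ t0 _) _ _) => //; rewrite upd_mk.
- by rewrite size_map.
- congr (mk _ _ _ (lists _ _) _ _).
  by elim: s t {h} => [|c s IH] t /=; rewrite ?drop0// IH; case: t.
Qed.

Lemma runs_output_raw b io v r0 (q t : stape Sigma 'I_3) :
  runs (output_raw (i, b)) (mk (lists [::] (map symL io)) v r0 t q rw)
    (size (raw i) * 9 + 7)
    (mk (lists [::] (map symL (raw_letter raw (i, b) ++ io))) v r0 t q rw).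
Proof.
set enc := fun w => mk (lists [::] (map symL w)) v r0 t q rw.
have cor f x w l r1 :
    runs (on_letter (fun x => output_letter (f x)) (symL x))
      (upd (enc w) i.+4.+1 (lists l (symL x :: r1))) 2
      (upd (enc (f x :: w)) i.+4.+1 (lists l (symL x :: r1))).
  rewrite /enc /= !upd_mk.
  by refine (runs_eq (@runs_output_letter _ _ (map symL w) _) _ _); rewrite ?upd_mk.
have im (l : seq sym) : l =i map symL (raw i) -> forall y, y \in l ->
    exists x, y = symL x.
  by move=> lE y; rewrite lE => /mapP[x _ ->]; exists x.
have fold (f : letter X -> letter X) u w : foldl (fun w y =>
      if y is Some (inl (Some x)) then f x :: w else w) w (map symL u) =
    catrev (map f u) w.
  by elim: u w => //= x u IH w; rewrite IH.
rewrite /output_raw /=; case: b => /=.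
- refine (runs_seq (n1 := (size (raw i) * 5).+1) (n2 := size (raw i) * 4 + 3)
    (T1 := upd (enc (catrev (map (@inv_letter X) (raw i)) io)) i.+4.+1
            (lists (rev (map symL (raw i))) [::])) _ _ _); last lia.
    have := @runs_for_right _ _ _ enc (fun w y =>
        if y is Some (inl (Some x)) then inv_letter x :: w else w)
      2 i.+4.+1 false isSome
      (on_letter (fun x => output_letter (inv_letter x))) io
      [::] (map symL (raw i)) [::] _ (all_isSome_L _) isT.
    rewrite cats0 fold size_map upd_id_eq /enc //= => h; apply: h => //.
    by move=> y /im[] // x -> w l r1; exact: cor.
  rewrite /enc upd_mk.
  refine (runs_eq (@runs_go_left i.+4.+1 _ (rev (map symL (raw i))) _ _) _ _).
  + by rewrite all_rev all_isSome_L.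
  + by rewrite /= upd_at.
  + by rewrite size_rev size_map.
  + by rewrite upd_mk upd_upd revK upd_id_eq// /raw_letter /= catrevE.
- refine (runs_seq (@runs_go_right i.+4.+1 _ (map symL (raw i)) _ _) (n2 := size (raw i) * 5 + 3) _ _) => //.
  + exact: all_isSome_L.
  + have := @runs_for_left _ _ _ enc (fun w y =>
        if y is Some (inl (Some x)) then x :: w else w)
      2 i.+4.+1 false isSome (on_letter output_letter) io
      (rev (map symL (raw i))) [::] _ _ isT.
    rewrite -/(rev (rev _)) revK all_rev all_isSome_L => /(_ _ isT).
    rewrite -map_rev (fold id) map_id size_map size_rev.
    rewrite map_rev => h; refine (runs_eq (h _ _) _ _) => //.
    * move=> y /im[]; first by move=> z; rewrite mem_rev.
      by move=> x -> w l r1; exact: (cor id).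
    * by rewrite (@upd_id_eq (enc _) i.+4.+1 _ rwi) /enc catrevE revK.
  + by rewrite size_map; lia.
Qed.

Lemma runs_copy_back io (r0 q : stape Sigma 'I_3) (s : seq 'I_3) T0 :
  runs (for_right isSome 2 true (on_color (fun c => write 1 (symW c))))
    (mk io (lists [::] [::]) (lists [::] (map symW s)) r0 q T0)
    (size s * 4 + 1)
    (mk io (lists (rev (map symW s)) [::]) (lists [::] [::]) r0 q T0).
Proof.
set enc := fun t : seq sym => mk io (lists t [::]) (lists [::] [::]) r0 q T0.
have := @runs_for_right _ _ _ enc (fun t y => y :: t) 1 2 true isSome
  (on_color (fun c => write 1 (symW c))) [::] [::] (map symW s) [::] _
  (all_isSome_W _) isT.
rewrite /enc !upd_mk cats0 /= => h; refine (runs_eq (h _ _) _ _) => //.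
- move=> y /mapP[c _ ->] t l r; rewrite !upd_mk.
  by refine (runs_eq (@runs_write 1 _ _ t _) _ _) => //; rewrite upd_mk.
- by rewrite size_map; lia.
- have -> : forall t, foldl (fun t y => y :: t) t (map symW s) =
      catrev (map symW s) t by elim: (map symW s) => //= a l IH t; rewrite IH.
  by [].
Qed.
End Raw.

Section Peel.
Context (raw : 'I_k -> word X) (rw : stapes).
Hypothesis rwE : forall i : 'I_k, rw i = lists [::] (map symL (raw i)).

Definition peel_state q (vo : seq 'I_3 * word X) : stapes :=
  mk (lists [::] (map symL vo.2)) (lists [::] (map symW vo.1)) (lists [::] [::])
     (lists [::] [::]) q rw.

(** A stack filled from left to right has the last letter of the normal form on top. *)
Lemma foldl_push_nf (u : seq 'I_3) :
  foldl (fun s c => push c s) [::] u = rev (nf u).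
Proof. by rewrite -nf_rev -{1}[u]revK foldl_rev. Qed.

(** The factor 100 is a generous bound for all the scans of one trial. *)
Definition try_cost (v r : nat) := 100 * (D * r + r + v + 1).

Lemma size_flat_raw s : size (flat fl (raw_letter raw s)) <= D * size (raw s.1).
Proof.
by case: s => i []; rewrite /raw_letter/= ?flat_inv// ?size_rev size_flat.
Qed.

Lemma runs_try q s vo :
  runs (try_letter s) (peel_state q vo)
    (try_cost (size vo.1) (size (raw s.1)))
    (peel_state q (peel_step fl raw s vo)).
Proof.
case: vo s => V O [i b] /=; set r := size (raw i).
pose B := nf (flat fl (raw_letter raw (i, b)) ++ V ++
              rev (flat fl (raw_letter raw (i, b)))).
have szBr : @size 'I_3 (rev B) = @size 'I_3 B by exact: size_rev.
have szB : @size 'I_3 B <= D * r + D * r + @size 'I_3 V.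
  apply: leq_trans (size_nf _) _; rewrite !size_cat size_rev.
  have := size_flat_raw (i, b); rewrite /= -/r.
  by set a := size (flat _ _); set sv := size V => le; lia.
pose u := foldl (fun s c => push c s) [::] (flat fl (raw_letter raw (i, b))).
pose u1 := foldl (fun s c => push c s) u V.
have uB : foldl (fun s c => push c s) u1
    (flat fl (raw_letter raw (inv_letter (i, b)))) = rev B.
  by rewrite /u1 /u -!foldl_cat foldl_push_nf raw_letter_inv flat_inv// catA.
have rw' : upd (upd rw i (raw_at raw i b)) i (lists [::] (map symL (raw i))) = rw.
  by rewrite upd_upd upd_id_eq.
set n := try_cost _ _; have nE : n = 100 * (D * r + r + size V + 1) by [].
have Dr : r * (4 * D + 4) = 4 * (D * r) + 4 * r by nia.
have {}Dr : r * (4 * D + 4) + 3 <= 4 * (D * r) + 4 * r + 3 by rewrite Dr.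
rewrite /try_letter /peel_state /=.
set t := mk _ _ _ _ _ _.
apply: (@runs_seq_sub _ _ _ _ _ (upd t i.+4.+1 (raw_at raw i b)) _ (r * 4 + 1));
  [ | lia | ].
  case: (b); rewrite /raw_at.
    apply: runs_le (@runs_go_right i.+4.+1 t (map symL (raw i)) _ _) => //.
    - by rewrite size_map; lia.
    - exact: all_isSome_L.
    - exact: rwE.
  rewrite upd_id_eq; last exact: rwE.
  by apply: runs_le (runs_nop _); lia.
rewrite /t upd_mk.
apply: (runs_seq_sub (runs_le Dr (runs_push_raw raw rw i b _ _ _ _ [::])));
  first lia.
apply: (runs_seq_sub (runs_copy_pushing _ _ u V _)); first lia.
apply: (runs_seq_sub (runs_le Dr (runs_push_raw raw rw i (~~ b) _ _ _ _ u1)));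
  first lia.
rewrite negbK -[(i, ~~ b)]/(inv_letter (i, b)) uB.
apply: (@runs_seq_sub _ _ _ _ _ (mk (lists [::] (map symL O))
  (lists (rev (map symW V)) [::]) (lists (map symW (rev B)) [::])
  (lists (rev (map symW V)) [::]) q rw) _ (r * 4 + 3)); [ | lia | ].
  case: (b) rw'; rewrite /raw_at => rw'.
    refine (runs_eq (@runs_go_left i.+4.+1 _ (rev (map symL (raw i))) _ _) _ _).
    - by rewrite all_rev all_isSome_L.
    - by rewrite /= upd_at.
    - by rewrite size_rev size_map.
    - by rewrite upd_mk revK rw'.
  rewrite upd_id_eq; last exact: rwE.
  by apply: runs_le (runs_nop _); lia.
apply: (runs_seq_sub (runs_compare _ _ _ _ _ _)); first by rewrite szBr; lia.
rewrite map_rev revK szBr.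
set k0 := drop _ _.
have k0E : isSome (head None k0) = (size B < size V).
  have <- : (0 < size k0) = (size B < size V).
    by rewrite /k0 size_drop size_rev size_map subn_gt0.
  have : all isSome k0 by rewrite /k0 -map_rev -map_drop all_isSome_W.
  by case: (k0) => //= y ? /andP[].
have k0S : all isSome k0 by rewrite /k0 -map_rev -map_drop all_isSome_W.
have k0sz : size k0 <= @size 'I_3 V.
  by rewrite /k0 size_drop size_rev size_map leq_subr.
apply: (runs_seq_sub (@runs_move_left 3 _ k0 [::] erefl)); first lia.
rewrite upd_mk; set vo' := peel_step _ _ _ _.
apply: (runs_seq_sub (n1 := 9 * r + 8 * @size 'I_3 V + 4 * @size 'I_3 B + 20)
  (T1 := mk (lists [::] (map symL vo'.2)) (lists [::] (map symW vo'.1))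
    (lists [::] [::]) (lists k0 [::]) q rw)); last first.
- refine (runs_eq (@runs_erase_left 3 _ k0 k0S erefl) _ _).
    by apply: leq_trans (leq_add (leq_mul k0sz (leqnn 4)) (leqnn 3)) _; lia.
  by rewrite upd_mk.
- lia.
apply: runs_le (runs_switch (n := 9 * r + 8 * @size 'I_3 V + 4 * @size 'I_3 B + 19) _).
  lia.
apply: (runs_seq_sub (n1 := 1) (T1 := mk (lists [::] (map symL O))
  (lists (rev (map symW V)) [::]) (lists [::] (map symW B))
  (lists k0 [::]) q rw)); [|lia|].
  refine (runs_eq (@runs_move_right 3 _ _ (head None k0) [::] erefl) _ _) => //.
  by rewrite upd_mk; case: (k0) => //=; rewrite lists_blank_left.
rewrite /= k0E /vo' /peel_step /= -/B.
case: ifP => szBV.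
  apply: (runs_seq_sub (@runs_erase_left 1 _ (rev (map symW V)) _ erefl)).
  - by rewrite -map_rev all_isSome_W.
  - by rewrite size_rev size_map; lia.
  rewrite upd_mk; apply: (runs_seq_sub (runs_copy_back _ _ _ B _)).
  - by rewrite size_rev size_map; lia.
  apply: (runs_seq_sub (@runs_go_left 1 _ (rev (map symW B)) _ erefl)).
  - by rewrite -map_rev all_isSome_W.
  - by rewrite !size_rev !size_map; lia.
  rewrite upd_mk revK.
  apply: runs_le (runs_output_raw (rwE i) b _ _ _ _ _).
  by rewrite !size_rev !size_map -/r; lia.
apply: (runs_seq_sub (@runs_erase_right 2 _ (map symW B) _ erefl)).
- exact: all_isSome_W.
- by rewrite size_map; lia.
rewrite upd_mk.
refine (runs_eq (@runs_go_left 1 _ (rev (map symW V)) _ erefl) _ _).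
- by rewrite -map_rev all_isSome_W.
- by rewrite size_rev !size_map; lia.
- by rewrite upd_mk revK.
Qed.

Lemma size_peel_step s (vo : seq 'I_3 * word X) :
  size (peel_step fl raw s vo).1 <= size vo.1.
Proof. by rewrite /peel_step; case: ifP => // /ltnW. Qed.

Lemma size_peel_pass ls (vo : seq 'I_3 * word X) :
  size (peel_pass fl raw ls vo).1 <= size vo.1.
Proof.
elim: ls vo => //= s ls IH vo.
by apply: leq_trans (IH _) (size_peel_step _ _).
Qed.

Definition pass (ls : seq (letter 'I_k)) : prog := seqs (map try_letter ls).

Lemma try_cost_le v v' r r' : v <= v' -> r <= r' ->
  try_cost v r <= try_cost v' r'.
Proof.
by move=> vv rr; rewrite leq_mul2l /= !leq_add// leq_mul2l rr orbT.
Qed.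

Lemma runs_pass q ls vo v r : size vo.1 <= v -> (forall i, size (raw i) <= r) ->
  runs (pass ls) (peel_state q vo) (size ls * try_cost v r + 1)
    (peel_state q (peel_pass fl raw ls vo)).
Proof.
move=> + rr; elim: ls vo => [|s ls IH] vo vv; first exact: runs_nop.
refine (runs_seq (runs_try q s vo) (IH _ _) _).
  exact: leq_trans (size_peel_step _ _) vv.
by rewrite addnA leq_add2r mulSn leq_add2r try_cost_le.
Qed.

(** Each clock symbol is erased after one pass, so the number of passes does not depend on the
    success of the peeling. *)
Definition passes ls : prog := for_left isSome 4 true (fun=> pass ls).

Lemma runs_passes ls vo v r l : all isSome l ->
  size vo.1 <= v -> (forall i, size (raw i) <= r) ->
  runs (passes ls) (peel_state (lists l [::]) vo)
    (size l * (size ls * try_cost v r + 1).+3 + 3)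
    (peel_state (lists [::] [::]) (iter (size l) (peel_pass fl raw ls) vo)).
Proof.
move=> al vv rr.
(* That the conjugate never gets longer is put into the type of states, so that one time bound fits
   all passes. *)
pose St := {vo : seq 'I_3 * word X | size vo.1 <= v}.
pose g (s : St) (y : sym) : St := exist _ (peel_pass fl raw ls (sval s))
  (leq_trans (size_peel_pass ls (sval s)) (svalP s)).
pose enc (s : St) := peel_state (lists [::] [::]) (sval s).
have := @runs_for_left _ _ _ enc g (size ls * try_cost v r + 1) 4 true isSome
  (fun=> pass ls) (exist _ vo vv) l [::] _ al isT.
rewrite /enc /peel_state !upd_mk => h; refine (runs_eq (h _ _) _ _) => //.
  move=> y _ [s sv] l0 r0; rewrite !upd_mk.
  exact: (runs_pass (lists l0 (y :: r0)) ls (vo := s) sv rr).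
have -> // : forall s, sval (foldl g s l) =
    iter (size l) (peel_pass fl raw ls) (sval s).
by elim: (l) => // y l0 IH s; rewrite [size _]/= iterSr; exact: IH.
Qed.
End Peel.

(** The input is erased while it is read, separator included, so that tape 0 is blank when the
    output begins. *)
Definition read_word (body : sym -> prog) : prog :=
  Seq (for_right is_symL 0 true body) (write 0 None).

Lemma runs_read_word (St : Type) (enc : St -> stapes) g n body s w rest :
  {in map symL w, forall y s l r,
    runs (body y) (upd (enc s) 0 (lists l (y :: r))) n
         (upd (enc (g s y)) 0 (lists l (y :: r)))} ->
  runs (read_word body)
    (upd (enc s) 0 (lists [::] (rcons (map symL w) symSep ++ rest)))
    (size w * n.+3 + 2)
    (upd (enc (foldl g s (map symL w))) 0 (lists [::] rest)).
Proof.
move=> cor; rewrite cat_rcons.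
have aL : all is_symL (map symL w) by elim: (w).
have h := @runs_for_right _ _ St enc g n 0 true is_symL body s [::] _
  (symSep :: rest) (fun=> erefl) aL isT cor.
refine (runs_seq (n2 := 1) h _ _); last by rewrite size_map; lia.
have := runs_op 0 (fun _ : sym => (None, Right))
  (upd (enc (foldl g s (map symL w))) 0 (lists [::] (symSep :: rest))).
by rewrite /reads !upd_at upd_upd act_right lists_blank_left.
Qed.

Definition raws_of (ws : seq (word X)) : stapes :=
  fun i => lists [::] (map symL (nth [::] ws i)).

Definition read_raw i : prog :=
  Seq (read_word (fun y => write i.+4.+1 y)) (go_left i.+4.+1).

Definition encode_words (ws : seq (word X)) : seq sym :=
  flatten [seq rcons (map symL w) symSep | w <- ws].

Local Notation blank := (lists [::] [::]).

Lemma runs_read_raw us w rest :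
  runs (read_raw (size us))
    (mk (lists [::] (rcons (map symL w) symSep ++ rest)) blank blank blank blank
      (raws_of us))
    (size w * 8 + 5)
    (mk (lists [::] rest) blank blank blank blank (raws_of (rcons us w))).
Proof.
pose enc (t : seq sym) :=
  mk blank blank blank blank blank (upd (raws_of us) (size us) (lists t [::])).
have h := @runs_read_word _ enc (fun t y => y :: t) 1
  (fun y => write (size us).+4.+1 y) [::] w rest.
have T0 : upd (raws_of us) (size us) blank = raws_of us.
  by rewrite upd_id_eq// /raws_of nth_default.
move: h; rewrite /enc !upd_mk T0 => h.
refine (runs_seq (h _) (n2 := size w * 4 + 3) _ _); last lia.
  move=> y _ t l r; rewrite !upd_mk.
  refine (runs_eq (@runs_write _ _ _ t _) _ _) => //; first by rewrite /= upd_at.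
  by rewrite upd_mk upd_upd.
have -> : foldl (fun t y => y :: t) [::] (map symL w) = rev (map symL w).
  rewrite -[RHS]cats0 -catrevE; move: [::].
  by elim: (map symL w) => //= a l IH t; rewrite IH.
refine (runs_eq (@runs_go_left _ _ (rev (map symL w)) _ _) _ _).
- by rewrite all_rev all_isSome_L.
- by rewrite /= upd_at.
- by rewrite size_rev size_map.
- rewrite upd_mk upd_upd revK; congr mk; apply/funext => j.
  rewrite /upd /raws_of nth_rcons; case: ltngtP => // h'.
  by rewrite nth_default// ltnW.
Qed.

Lemma runs_read_raws us ws rest :
  runs (seqs [seq read_raw i | i <- iota (size us) (size ws)])
    (mk (lists [::] (encode_words ws ++ rest)) blank blank blank blank
      (raws_of us))
    (sumn (map size ws) * 8 + 5 * size ws + 1)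
    (mk (lists [::] rest) blank blank blank blank (raws_of (us ++ ws))).
Proof.
elim: ws us => [|w ws IH] us; first by rewrite cats0; exact: runs_nop.
rewrite /encode_words /= -/(encode_words ws) -catA.
have {}IH := IH (rcons us w); rewrite size_rcons cat_rcons in IH.
by refine (runs_seq (runs_read_raw us w _) IH _); lia.
Qed.

Definition skip_words n : prog := seqs (nseq n (read_word (fun=> nop _ _))).

Lemma runs_skip_words T ws rest :
  runs (skip_words (size ws)) (upd T 0 (lists [::] (encode_words ws ++ rest)))
    (sumn (map size ws) * 4 + 2 * size ws + 1)
    (upd T 0 (lists [::] rest)).
Proof.
elim: ws => [|w ws IH]; first exact: runs_nop.
rewrite /encode_words /= -/(encode_words ws) -catA.
refine (runs_seq (@runs_read_word _ (fun=> T) (fun _ _ => tt) 1 _ tt _ _ _) IH _).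
  by move=> y _ s l r; exact: runs_nop.
by lia.
Qed.

(** Tape 1 receives the normal form; tape 4 receives the unreduced image, whose length bounds the
    number of letters to peel. *)
Definition read_conjugate : prog :=
  read_word (on_letter (fun x =>
    Seq (push_colors 1 (fl x)) (write_colors 4 (fl x)))).

Lemma runs_read_conjugate w rest (rw : stapes) :
  runs read_conjugate
    (mk (lists [::] (rcons (map symL w) symSep ++ rest)) blank blank blank blank rw)
    (size w * (5 * D + 5) + 2)
    (mk (lists [::] rest) (lists (map symW (rev (nf (flat fl w)))) [::])
      blank blank (lists (rev (map symW (flat fl w))) [::]) rw).
Proof.
pose enc (p : seq 'I_3 * seq sym) := mk blank (lists (map symW p.1) [::])
  blank blank (lists p.2 [::]) rw.
pose g (p : seq 'I_3 * seq sym) (y : sym) :=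
  if y is Some (inl (Some x)) then
    (foldl (fun s c => push c s) p.1 (fl x), catrev (map symW (fl x)) p.2)
  else p.
have := @runs_read_word _ enc g (5 * D + 2)
  (on_letter (fun x => Seq (push_colors 1 (fl x)) (write_colors 4 (fl x))))
  ([::], [::]) w rest.
rewrite /enc !upd_mk => h; refine (runs_eq (h _) _ _).
- move=> y /mapP[x _ ->] [s t] l r /=; rewrite !upd_mk.
  refine (runs_seq (@runs_push_colors 1 (fl x) _ s _) (n2 := size (fl x) + 1) _ _) => //.
    rewrite upd_mk.
    refine (runs_eq (@runs_write_colors 4 (fl x) _ t _) _ _) => //.
    by rewrite upd_mk.
  by have := flD x; lia.
- by lia.
- have -> : forall p, foldl g p (map symL w) =
      (foldl (fun s c => push c s) p.1 (flat fl w),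
       catrev (map symW (flat fl w)) p.2).
    elim: (w) => [|x u IH] [s t] //=.
    by rewrite IH /flat /= foldl_cat map_cat !catrevE rev_cat catA.
  by rewrite /= foldl_push_nf.
Qed.

Definition peeling_program : prog :=
  Seq (seqs [seq read_raw i | i <- iota 0 k])
  (Seq (skip_words m)
  (Seq read_conjugate
  (Seq (skip_words m.-1)
  (Seq (go_left 1) (passes (enum {: letter 'I_k})))))).

(** The last line is the quadratic part: at most D n passes, each trying 2 k letters in linear
    time. *)
Definition peeling_time n :=
  (8 * n + 5 * k + 1) + ((4 * n + 2 * m + 1) + ((n * (5 * D + 5) + 2) +
  ((4 * n + 2 * m + 1) + ((4 * (D * n) + 3) +
  (D * n * ((#|{: letter 'I_k}| * (100 * (D * n + n + D * n + 1)) + 1).+3) + 3))))).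

Lemma runs_peeling_program aws uws v vws :
  size aws = k -> size uws = m -> size vws = m.-1 ->
  let ws := aws ++ uws ++ v :: vws in
  runs peeling_program
    (mk (lists [::] (encode_words ws)) blank blank blank blank (raws_of [::]))
    (peeling_time (sumn (map size ws)))
    (peel_state (raws_of aws) blank
      (iter (size (flat fl v))
        (peel_pass fl (fun i : 'I_k => nth [::] aws i) (enum {: letter 'I_k}))
        (nf (flat fl v), [::]))).
Proof.
move=> sa su sv ws.
have encE : encode_words ws = encode_words aws ++ (encode_words uws ++
    (rcons (map symL v) symSep ++ (encode_words vws ++ [::]))).
  by rewrite /ws /encode_words !map_cat /= !flatten_cat /= cats0.
set n := sumn _.
have nE : n = sumn (map size aws) + (sumn (map size uws) + (size v +
    sumn (map size vws))) by rewrite /n /ws !map_cat !sumn_cat.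
have vD : size (flat fl v) <= D * n.
  by apply: leq_trans (size_flat v flD) (leq_mul (leqnn D) (_ : size v <= n)); lia.
rewrite encE.
set rest1 := rcons _ _ ++ _; set rest2 := encode_words vws ++ _ in rest1 *.
have r1 := runs_read_raws [::] aws (encode_words uws ++ rest1).
have r2 := runs_skip_words
  (mk blank blank blank blank blank (raws_of aws)) uws rest1.
have r3 := runs_read_conjugate v rest2 (raws_of aws).
set V := nf (flat fl v) in r3 *; set q := lists (rev (map symW (flat fl v))) [::] in r3.
have r4 := runs_skip_words
  (mk blank (lists (map symW (rev V)) [::]) blank blank q (raws_of aws)) vws [::].
have Vs : all isSome (map symW (rev V)) by exact: all_isSome_W.
have r5 := @runs_go_left 1 (mk blank (lists (map symW (rev V)) [::]) blank blank q
  (raws_of aws)) _ Vs erefl.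
have rawE (i : 'I_k) : raws_of aws i = lists [::] (map symL (nth [::] aws i)).
  by [].
have qs : all isSome (rev (map symW (flat fl v))).
  by rewrite all_rev all_isSome_W.
have rR (i : 'I_k) : size (nth [::] aws i) <= n.
  rewrite nE; apply: leq_trans (leq_addr _ _).
  elim: (aws) (val i) => [|w l IH] [|j] //=; first exact: leq_addr.
  exact: leq_trans (IH j) (leq_addl _ _).
have r6 := runs_passes rawE (enum {: letter 'I_k}) (vo := (V, [::])) qs (leqnn _) rR.
rewrite upd_mk -map_rev revK in r5.
rewrite /peel_state !upd_mk in r2 r4; rewrite sa in r1; rewrite su in r2; rewrite sv in r4.
rewrite size_rev size_map -cardE in r6.
refine (runs_le _ (runs_seq r1 (runs_seq r2 (runs_seq r3 (runs_seq r4
  (runs_seq r5 r6 (leqnn _)) (leqnn _)) (leqnn _)) (leqnn _)) (leqnn _))).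
rewrite /peeling_time size_map size_rev.
have szV : @size 'I_3 V <= D * n.
  by apply: leq_trans (size_nf _) vD.
apply: leq_add; first lia.
apply: leq_add; first lia.
apply: leq_add.
  by rewrite leq_add2r leq_mul2r; apply/orP; right; lia.
apply: leq_add; first lia.
apply: leq_add; first by rewrite leq_add2r mulnC leq_mul2l szV.
rewrite leq_add2r; apply: leq_mul => //; rewrite !ltnS leq_add2r leq_mul2l.
apply/orP; right; rewrite /try_cost leq_mul2l /=.
by rewrite leq_add2r leq_add2l.
Qed.

Lemma peeling_time_quadratic :
  exists c : nat, forall n, 0 < n -> peeling_time n <= c * n ^ 2.
Proof.
set L := #|{: letter 'I_k}|.
pose a := 5 * k + 4 * m + 11.
pose b := 21 + 9 * D + L * D * 100 + 4 * D.
pose c := D * L * (100 * (2 * D + 1)).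
exists (a + b + c) => n n0.
have -> : peeling_time n = a + b * n + c * n ^ 2.
  by rewrite /peeling_time -/L /a /b /c; lia.
have n2 : n <= n ^ 2 by rewrite leq_pmulr.
rewrite 2!mulnDl leq_add2r leq_add//; last by rewrite leq_mul2l n2 orbT.
by rewrite leq_pmulr// expn_gt0 n0.
Qed.

Lemma uses_seqs n (T : eqType) (f : T -> prog) (l : seq T) : 0 < n ->
  {in l, forall z, uses_tapes n (f z)} -> uses_tapes n (seqs (map f l)).
Proof.
move=> n0; elim: l => [|z l IH] //= h; split; first exact: h (mem_head _ _).
by apply: IH => z' z'l; apply: h; rewrite inE z'l orbT.
Qed.

Lemma peeling_program_uses_tapes : uses_tapes k.+4.+1 peeling_program.
Proof.
have n0 : 0 < k.+4.+1 by [].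
have n1 : 1 < k.+4.+1 by [].
have n2 : 2 < k.+4.+1 by [].
have n3 : 3 < k.+4.+1 by [].
have n4 : 4 < k.+4.+1 by [].
have nk i : i < k -> i.+4.+1 < k.+4.+1 by [].
have letterU f y : (forall x, uses_tapes k.+4.+1 (f x)) ->
    uses_tapes k.+4.+1 (on_letter f y).
  by rewrite /on_letter; case: y => [[[x|]|]|] //= h.
have colorU f y : (forall z, uses_tapes k.+4.+1 (f z)) ->
    uses_tapes k.+4.+1 (on_color f y).
  by rewrite /on_color; case: y => [[]|] //= h.
have pushU i u : i < k.+4.+1 -> uses_tapes k.+4.+1 (push_colors i u).
  by move=> ni; apply: uses_seqs => // x _; do ?split => //; case.
have writeU i u : i < k.+4.+1 -> uses_tapes k.+4.+1 (write_colors i u).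
  by move=> ni; apply: uses_seqs.
have skipU n : uses_tapes k.+4.+1 (skip_words n).
  by elim: n => //= n IH; do ?split.
have tryU s : uses_tapes k.+4.+1 (try_letter s).
  case: s => i b; have ni := nk _ (ltn_ord i).
  have rawU b' : uses_tapes k.+4.+1 (push_raw (i, b')).
    by case: b'; (do ?split) => // y; apply: letterU => x; exact: pushU.
  have acceptU : uses_tapes k.+4.+1 (accept (i, b)).
    split; first by do ?split.
    split; first by (do ?split) => // y; apply: colorU.
    split; first by do ?split.
    by case: b; (do ?split) => // y; apply: letterU => x; do ?split.
  split; first by case: b {acceptU}; do ?split.
  split; first exact: rawU.
  split; first by (do ?split) => // y; apply: colorU => x; do ?split => //; case.
  split; first exact: rawU.
  split; first by case: b {acceptU}; do ?split.
  split; first by do ?split.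
  split; first by [].
  split; last by do ?split.
  by split=> // -[]; split=> //; do ?split.
split; last split; last split; last split; last split => //.
- by apply: uses_seqs => // i; rewrite mem_iota => /nk ni; do ?split.
- exact: skipU.
- by (do ?split) => // y; apply: letterU => x; split; [exact: pushU | exact: writeU].
- exact: skipU.
- by (do ?split) => // _; apply: uses_seqs.
Qed.
End Machine.

(** * Morphisms to the free product *)

Local Open Scope group_scope.
Local Open Scope quotient_scope.

(** Elements of the free product are reduced words, with product [nf (u ++ v)]. *)
Definition coxeter_morphism (G : groupType) (h : G -> seq 'I_3) : Prop :=
  (forall g, irr (h g)) /\ (forall g g', h (g * g') = nf (h g ++ h g')).

(** The words 01 and 12 generate all elements of even length. *)
Definition nonabelian_quotient (G : groupType) : Prop :=
  exists h : G -> seq 'I_3, coxeter_morphism h /\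
    exists a b, h a = [:: inord 0; inord 1] /\ h b = [:: inord 1; inord 2].

Lemma coxeter_morphism1 (G : groupType) (h : G -> seq 'I_3) :
  coxeter_morphism h -> h 1 = [::].
Proof.
move=> [hi hM]; have := hM 1 1; rewrite mulg1 => E.
have : nf (rev (h 1) ++ h 1) = nf (rev (h 1) ++ (h 1 ++ h 1)).
  by rewrite {2}E nf_nf_catr.
by rewrite nf_invl (nf_id (hi 1)) => <-; have := nf_invl (h 1) [::]; rewrite cats0.
Qed.

Lemma coxeter_morphismV (G : groupType) (h : G -> seq 'I_3) :
  coxeter_morphism h -> forall g, h g^-1 = rev (h g).
Proof.
move=> hh g; have [hi hM] := hh; have := hM g g^-1.
rewrite mulgV (coxeter_morphism1 hh) => E.
have : nf (rev (h g) ++ [::]) = nf (rev (h g) ++ (h g ++ h g^-1)).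
  by rewrite E nf_nf_catr.
by rewrite nf_invl cats0 (nf_id (hi _)) nf_id ?irr_rev// => ->.
Qed.

Lemma nonabelian_quotient_isomorphic (G H : groupType) :
  isomorphic G H -> nonabelian_quotient H -> nonabelian_quotient G.
Proof.
move=> [f [f' fK f'K]] [h [[hi hM] [a [b [ha hb]]]]].
exists (h \o f); split; first by split=> [g|g g'] /=; rewrite ?gmulfM.
by exists (f' a), (f' b); rewrite /= !f'K.
Qed.

Lemma ord3_neq i j : i < 3 -> j < 3 -> (inord i == inord j :> 'I_3) = (i == j).
Proof.
move=> i3 j3; apply/eqP/eqP => [/(congr1 val)|->//]; by rewrite /= !inordK.
Qed.

Section Presented.
Context (I : choiceType) (R : word I -> word I -> Prop).

Lemma presented_pi_cat (u v : word I) :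
  \pi_(presented R) (u ++ v) = \pi_(presented R) u * \pi_(presented R) v.
Proof.
apply/presentedP; apply: pres_sym.
by apply: pres_cat; apply: repr_presented.
Qed.

Lemma presented_pi_eval (u : word I) :
  \pi_(presented R) u = eval (@pres_gen I R) u.
Proof.
elim: u => [|[i b] u IH]; first by rewrite /eval big_nil.
rewrite -cat1s presented_pi_cat IH /eval big_cons; congr (_ * _).
rewrite /eval_letter /=; case: b => //.
apply: (mulgI (pres_gen R i)); rewrite mulgV -presented_pi_cat.
by apply/presentedP; exact: (pres_cancel _ (i, false)).
Qed.

End Presented.

Lemma commute_eval (G : groupType) (I : Type) (f : I -> G) (u v : word I) :
  (forall i j, commute (f i) (f j)) -> commute (eval f u) (eval f v).
Proof.
move=> fC; have letterC l l' : commute (eval_letter f l) (eval_letter f l').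
  case: l l' => [i []] [j []]; rewrite /eval_letter /=.
  - by apply: commuteV; apply/commute_sym; apply: commuteV.
  - by apply/commute_sym; apply: commuteV.
  - exact: commuteV.
  - exact: fC.
apply: commute_prod => l _; apply/commute_sym; apply: commute_prod => l' _.
exact: letterC.
Qed.

(** * Partially commutative groups *)

Section Raag.
Context (V : finType) (e : rel V).
Hypothesis esym : symmetric e.
Hypothesis eirr : irreflexive e.

Lemma nonabelian_quotient_raag :
  (exists g h : partially_commutative e, g * h != h * g) ->
  nonabelian_quotient (partially_commutative e).
Proof.
move=> [g [h gh]].
(* Otherwise all generators commute. *)
have [v [w [vw evw]]] : exists v w, v != w /\ ~~ e v w.
  apply: contrapT => nex; move/eqP: gh; apply.
  rewrite -[g]reprK -[h]reprK !presented_pi_eval; apply: commute_eval => i j.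
  have [->|ij] := eqVneq i j; first exact: commute_refl.
  rewrite /commute -!presented_pi_cat; apply/presentedP; apply: pres_rel.
  apply: commutation_edge; apply: contrapT => /negP nij.
  by apply: nex; exists i, j.
pose f x : seq 'I_3 := if x == v then [:: inord 0; inord 1]
  else if x == w then [:: inord 1; inord 2] else [::].
pose fl (l : letter V) := if l.2 then rev (f l.1) else f l.1.
have flV l : fl (inv_letter l) = rev (fl l).
  by case: l => x []; rewrite /fl /= ?revK.
(* No edge joins v to w or a vertex to itself, so in every commutation relation one of the two
   images is empty. *)
have inv u u' : pres_eq (commutation_rel e) u u' ->
    nf (flat fl u) = nf (flat fl u').
  elim=> {u u'} [_ _ [x y exy]|l|//|u u' _ ->//|u u' u'' _ -> _ ->//|u u' u1 u1' _ IH _ IH1].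
  - rewrite /flat /= !cats0 /fl /= /f.
    case: (eqVneq x v) exy => [->|xv] exy.
      case: (eqVneq y v) exy => [->|yv] exy; first by rewrite eirr in exy.
      by case: (eqVneq y w) exy evw => [-> ->|yw _ _]; rewrite ?cats0.
    case: (eqVneq x w) exy => [->|xw] exy; last by rewrite cats0.
    case: (eqVneq y v) exy => [->|yv] exy; first by rewrite esym (negPf evw) in exy.
    by case: (eqVneq y w) exy => [->|yw _]; rewrite ?cats0// eirr.
  - by rewrite /flat /= flV cats0 -[rev _]cats0 nf_invr.
  - by rewrite !flat_cat -nf_cat_nf IH IH1 nf_cat_nf.
exists (fun x => nf (flat fl (repr x))); split; first split.
- by move=> x; exact: nf_irr.
- move=> x y; rewrite nf_cat_nf -flat_cat; apply: inv.
  rewrite -{1}[x]reprK -{1}[y]reprK -presented_pi_cat; exact: repr_presented.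
exists (pres_gen _ v), (pres_gen _ w).
split; rewrite (inv _ _ (repr_presented _ _)) /flat /= cats0 /fl /f /= ?eqxx.
  by rewrite nf_id// /irr /= ord3_neq.
by rewrite eq_sym (negPf vw) nf_id// /irr /= ord3_neq.
Qed.

End Raag.

(** * Pure braid groups *)

Section PureBraid.
Context (n : nat).
Hypothesis n3 : 3 <= n.
Implicit Types (q : 'I_n -> nat) (u v : word 'I_n.-1).

Let lpos (i : 'I_n.-1) : 'I_n := widen_ord (leq_pred n) i.
Let rpos (i : 'I_n.-1) : 'I_n := Ordinal (braid_ord_proof i).

(* The strand standing at position j is [q j].  A crossing of two of the three
   strands 0, 1, 2 contributes the name of the strand that comes from the
   left (from the right for the inverse generators).  This is the cocycle of
   the morphism sending sigma_i to s_i (i, i+1) in the semidirect product of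
   the Coxeter group and the symmetric group. *)
Definition crossing q (l : letter 'I_n.-1) : seq 'I_3 :=
  if (q (lpos l.1) < 3) && (q (rpos l.1) < 3) then
    [:: inord (if l.2 then q (rpos l.1) else q (lpos l.1))]
  else [::].

Definition swap q (i : 'I_n.-1) : 'I_n -> nat := q \o braid_transposition i.

Fixpoint cocycle q u : seq 'I_3 :=
  if u is l :: u' then crossing q l ++ cocycle (swap q l.1) u' else [::].

Lemma cocycle_cat q u v : cocycle q (u ++ v) =
  cocycle q u ++ cocycle (q \o (eval (@braid_transposition n) u)^-1) v.
Proof.
elim: u q => [|[i b] u IH] q /=.
  rewrite /eval big_nil invg1; congr cocycle.
  by apply/funext => j; rewrite /= perm1.
rewrite IH catA; congr (_ ++ cocycle _ _); apply/funext => j /=.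
rewrite /swap /= /eval big_cons invMg permM; congr (q _).
by rewrite /eval_letter /=; case: b; rewrite ?invgK /braid_transposition ?tpermV.
Qed.

Lemma swapE q i : [/\ swap q i (lpos i) = q (rpos i),
  swap q i (rpos i) = q (lpos i) &
  forall j, j != lpos i -> j != rpos i -> swap q i j = q j].
Proof.
rewrite /swap /braid_transposition /=; split; rewrite ?tpermL ?tpermR//.
by move=> j jl jr; rewrite tpermD// eq_sym.
Qed.

(** Let a, b, c be the strands from left to right. If all three are recorded, the sides are a a b
    and b a a, both equal to b. Otherwise at most one crossing is recorded, with the same name on
    both sides. *)
Lemma cocycle_near q (i j : 'I_n.-1) : j = i.+1 :> nat ->
  nf (cocycle q [:: (i, false); (j, false); (i, false)]) =
  nf (cocycle q [:: (j, false); (i, false); (j, false)]).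
Proof.
move=> ij; have rl : lpos j = rpos i by apply: val_inj; rewrite /= ij.
have li : lpos i != rpos i by rewrite -val_eqE /=; lia.
have lj : lpos i != rpos j by rewrite -val_eqE /=; lia.
have rr : rpos i != rpos j by rewrite -val_eqE /=; lia.
have [i1 i2 i3] := swapE q i; have [j1 j2 j3] := swapE q j.
have [ij1 ij2 ij3] := swapE (swap q i) j; have [ji1 ji2 ji3] := swapE (swap q j) i.
rewrite rl in j1 j2 j3 ij1 ij2 ij3.
rewrite /= !cats0 /crossing /= rl ij1 ij3// ji2 ji3 1?eq_sym//.
rewrite i1 i2 i3 1?eq_sym// j1 j2 j3//.
case: (q (lpos i) < 3); case: (q (rpos i) < 3); case: (q (rpos j) < 3) => //=.
set x := inord _; set y := inord (q (rpos i)).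
exact: etrans (nf_cancel x [::] [:: y]) (esym (nf_cancel x [:: y] [::])).
Qed.

(** Disjoint crossings involve four strands, and only three are recorded, so at most one of the
    crossings contributes. *)
Lemma cocycle_far q (i j : 'I_n.-1) : injective q -> i.+1 < j ->
  nf (cocycle q [:: (i, false); (j, false)]) =
  nf (cocycle q [:: (j, false); (i, false)]).
Proof.
move=> qi ij.
have d1 : lpos i != lpos j by rewrite -val_eqE /=; lia.
have d2 : lpos i != rpos j by rewrite -val_eqE /=; lia.
have d3 : rpos i != lpos j by rewrite -val_eqE /=; lia.
have d4 : rpos i != rpos j by rewrite -val_eqE /=; lia.
have d5 : lpos i != rpos i by rewrite -val_eqE /=; lia.
have d6 : lpos j != rpos j by rewrite -val_eqE /=; lia.
have [_ _ i3] := swapE q i; have [_ _ j3] := swapE q j.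
rewrite /= !cats0 /crossing /= !i3 1?eq_sym// !j3//.
case: ifP; case: ifP => //; rewrite ?cats0//.
have h a b : a != b -> q a <> q b by move=> /eqP ab /qi.
move=> /andP[h1 h2] /andP[h3 h4].
have := h _ _ d1; have := h _ _ d2; have := h _ _ d3; have := h _ _ d4.
have := h _ _ d5; have := h _ _ d6; lia.
Qed.

Lemma cocycle_invariant u v : pres_eq (@braid_rel n) u v ->
  forall q, injective q -> nf (cocycle q u) = nf (cocycle q v).
Proof.
elim=> {u v} [u v [i j /orP[/eqP ij|/eqP ij]|i j /orP[ij|ij]] q qi|[i b] q _|//
    |u v _ IH q qi|u v w _ IH1 _ IH2 q qi|u u' v v' uu' IHu _ IHv q qi].
- exact: cocycle_near.
- by apply/esym; exact: cocycle_near.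
- exact: cocycle_far.
- by apply/esym; exact: cocycle_far.
- have [h1 h2 _] := swapE q i; rewrite /= cats0 /crossing /= h1 h2 andbC.
  by case: ifP => // _; case: b; rewrite /nf /= eqxx.
- by rewrite IH.
- by rewrite IH1// IH2.
- rewrite !cocycle_cat -nf_cat_nf IHu// -[RHS]nf_cat_nf.
  rewrite (eval_pres_eq (@braid_transposition_rel n) uu') IHv//.
  by apply: inj_comp => //; exact: perm_inj.
Qed.

Lemma nonabelian_quotient_pure_braid : nonabelian_quotient (pure_braid n).
Proof.
pose q0 : 'I_n -> nat := val.
have qi : injective q0 := val_inj.
have inv u v := fun h => @cocycle_invariant u v h q0 qi.
pose h (x : pure_braid n) := nf (cocycle q0 (repr (val x))).
exists h; split; first split.
- by move=> x; exact: nf_irr.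
- move=> x y; rewrite /h nf_cat_nf.
  have x1 : eval (@braid_transposition n) (repr (val x)) = 1.
    by apply/eqP; exact: (valP x).
  have -> : cocycle q0 (repr (val y)) = cocycle (q0 \o (eval (@braid_transposition n)
      (repr (val x)))^-1) (repr (val y)).
    by rewrite x1 invg1; congr cocycle; apply/funext => j; rewrite /= perm1.
  rewrite -cocycle_cat; apply: inv.
  by apply/presentedP; rewrite reprK presented_pi_cat !reprK.
have lt0 : 0 < n.-1 by lia.
have lt1 : 1 < n.-1 by lia.
have pure (i : 'I_n.-1) : is_pure (\pi_(braid n) [:: (i, false); (i, false)]).
  rewrite /is_pure /braid_perm (pres_lift_pi (@braid_transposition_rel n)).
  by rewrite /eval !big_cons big_nil /eval_letter /= mulg1 tperm2.
(* In the square of a generator each of the two strands comes from the left once. *)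
have hE (i : 'I_n.-1) : i.+1 < 3 -> h (Sub _ (pure i)) = [:: inord i; inord i.+1].
  move=> i3.
  have E := @cocycle_invariant _ _ (repr_presented (@braid_rel n)
    [:: (i, false); (i, false)]) q0 qi.
  refine (etrans E _) => /=.
  have [h1 h2 _] := swapE q0 i.
  rewrite /crossing /= h1 h2 /q0 /= i3 (ltnW i3) /=.
  by rewrite ord3_neq ?(ltnW i3)// ltn_eqF.
exists (Sub _ (pure (Ordinal lt0))), (Sub _ (pure (Ordinal lt1))).
by rewrite !hE.
Qed.

End PureBraid.

(** * Solving the conjugacy problem *)

Local Open Scope classical_set_scope.

Section Quotient.
Context (G : groupType) (X : {fset G}) (h : G -> seq 'I_3).
Hypothesis hh : coxeter_morphism h.
Hypothesis hX : forall g : G, subgroup_gen (incl X) g.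

Definition letter_image (l : letter X) : seq 'I_3 :=
  if l.2 then rev (h (incl X l.1)) else h (incl X l.1).

Lemma letter_imageV l : letter_image (inv_letter l) = rev (letter_image l).
Proof. by case: l => x []; rewrite /letter_image /= ?revK. Qed.

Lemma nf_flat_letter_image (w : word X) :
  nf (flat letter_image w) = h (eval (incl X) w).
Proof.
have [hi hM] := hh; elim: w => [|l w IH].
  by rewrite /eval big_nil (coxeter_morphism1 hh).
rewrite /eval big_cons hM -/(eval (incl X) w) -IH nf_nf_catr.
congr (nf (_ ++ _)); case: l => x []; rewrite /letter_image /eval_letter //=.
by rewrite (coxeter_morphismV hh).
Qed.

Context (a b : G).
Hypothesis ha : h a = [:: inord 0; inord 1].
Hypothesis hb : h b = [:: inord 1; inord 2].

(** Cut u into pairs: 02 is 01 times 12, and the other pairs are trivial or inverses of these. *)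
Lemma even_word_image (u : seq 'I_3) : ~~ odd (size u) ->
  exists g, h g = nf u.
Proof.
have [hi hM] := hh.
have cat u1 u2 : (exists g, h g = nf u1) -> (exists g, h g = nf u2) ->
    exists g, h g = nf (u1 ++ u2).
  by move=> [g1 e1] [g2 e2]; exists (g1 * g2); rewrite hM e1 e2 nf_cat_nf.
have rv u1 : (exists g, h g = nf u1) -> exists g, h g = nf (rev u1).
  by move=> [g e]; exists g^-1; rewrite (coxeter_morphismV hh) e nf_rev.
have e0 : exists g, h g = nf [::] by exists 1; rewrite (coxeter_morphism1 hh).
have e01 : exists g, h g = nf [:: inord 0; inord 1].
  by exists a; rewrite -ha nf_id.
have e12 : exists g, h g = nf [:: inord 1; inord 2].
  by exists b; rewrite -hb nf_id.
have e02 : exists g, h g = nf [:: inord 0; inord 2].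
  have [g e] := cat _ _ e01 e12; exists g.
  by rewrite e (nf_cancel (inord 1) [:: inord 0] [:: inord 2]).
have two c d : exists g, h g = nf [:: c; d].
  have ordE (i : 'I_3) : [\/ i = inord 0, i = inord 1 | i = inord 2].
    case: i => [[|[|[|//]]]] p; [apply: Or31|apply: Or32|apply: Or33];
    by apply: val_inj; rewrite /= inordK.
  have ecc (i : 'I_3) : exists g, h g = nf [:: i; i].
    by case: e0 => g e; exists g; rewrite e; exact: esym (nf_cancel i [::] [::]).
  case: (ordE c) => ->; case: (ordE d) => -> //.
  - exact: rv e01.
  - exact: rv e02.
  - exact: rv e12.
elim: (size u) {-2}u (leqnn (size u)) => [|n IH] {}u.
  by rewrite leqn0 => /nilP ->.
case: u => [|c [|d u]] //=; rewrite ltnS negbK => sz ou.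
by apply: (cat [:: c; d]) => //; apply: IH => //; exact: ltnW.
Qed.

Lemma even_word_lift (u : seq 'I_3) : ~~ odd (size u) ->
  exists e : word X, nf (flat letter_image e) = nf u.
Proof.
move=> /even_word_image[g gE]; have [e _ eE] := hX g.
by exists e; rewrite nf_flat_letter_image eE.
Qed.

(** With at most one generator G would be abelian, but 01 and 12 do not commute. *)
Lemma card_letters_ge4 : 4 <= #|{: letter X}|.
Proof.
have [hi hM] := hh; rewrite card_prod card_bool.
suff X1 : 1 < #|{: X}| by rewrite (@leq_mul 2 2).
rewrite ltnNge; apply/negP => /card_le1_eqP X1.
have [u _ uE] := hX a; have [v _ vE] := hX b.
have ab : a * b = b * a.
  rewrite -uE -vE; apply: commute_eval => i j.
  by rewrite (X1 i j).
have := hM a b; rewrite ab hM ha hb.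
rewrite (nf_cancel (inord 1) [:: inord 0] [:: inord 2]) !nf_id ?/irr /= ?ord3_neq//.
Qed.

End Quotient.

Lemma eval_free_reduce (G : groupType) (I : finType) (f : I -> G) (w : word I) :
  eval f (free_reduce w) = eval f w.
Proof.
have cancel l u : eval f (cancel_letter l u) = eval_letter f l * eval f u.
  case: u => [|l' u]; first by rewrite /eval big_cons.
  rewrite /cancel_letter; case: eqP => [->|_]; rewrite /eval !big_cons//.
  by case: l => i []; rewrite /eval_letter /= mulgA ?mulVg ?mulgV mul1g.
by elim: w => //= l w IH; rewrite cancel IH /eval big_cons.
Qed.

Lemma eval_inv_word (G : groupType) (I : choiceType) (f : I -> G) (w : word I) :
  eval f (inv_word w) = (eval f w)^-1.
Proof.
elim: w => [|l w IH]; first by rewrite /eval !big_nil invg1.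
rewrite -cat1s inv_word_cat eval_cat IH eval_cat invMg; congr (_ * _).
rewrite /eval !big_cons big_nil !mulg1.
by case: l => i []; rewrite /eval_letter /= ?invgK.
Qed.

Lemma eval_raw_word (G : groupType) (X : finType) (x : X -> G) (I : choiceType)
    (raw : I -> word X) (w : word I) :
  eval x (raw_word raw w) = eval (fun i => eval x (raw i)) w.
Proof.
elim: w => [|l w IH]; first by rewrite /eval !big_nil.
rewrite /raw_word /= -/(raw_word raw w) eval_cat IH [in RHS]/eval big_cons.
congr (_ * _); case: l => i []; rewrite /raw_letter /eval_letter//=.
exact: eval_inv_word.
Qed.

(** The four clauses of [overlap] match the four choices of exponents; a letter is separated from
    its own inverse by the negation of [bad]. *)
Lemma prefix_separated_tuple (X : finType) k m (fl : letter X -> seq 'I_3)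
    (T : (k + m).-tuple (freeword X)) (i : 'I_m) :
  (forall l, fl (inv_letter l) = rev (fl l)) -> separated_tuple fl T ->
  exists L, prefix_separated fl (fun j : 'I_k => val (tnth T (lshift m j))) L
    (nf (flat fl (val (tnth T (rshift k i))))).
Proof.
move=> flV [L [good sep]]; exists L.
pose Phi j := nf (flat fl (val (tnth T j))).
have [szP revP] : (forall j, (2 * L <= size (Phi j))%N) /\
    forall j, take L (Phi j) != take L (rev (Phi j)).
  by split=> j; have := good j; rewrite /bad negb_or -leqNgt => /andP[].
have {}sep j j' : j != j' -> [/\ take L (Phi j') != take L (Phi j),
    take L (Phi j') != take L (rev (Phi j)),
    take L (rev (Phi j')) != take L (Phi j) &
    take L (rev (Phi j')) != take L (rev (Phi j))].
  by move=> /sep; rewrite /overlap !negb_or => /and4P[].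
set raw := fun j => _.
have genE s : nf (flat fl (raw_letter raw s)) =
    if s.2 then rev (Phi (lshift m s.1)) else Phi (lshift m s.1).
  by case: s => j [] //=; rewrite /raw_letter/= flat_inv// nf_rev.
split.
- exact: nf_irr.
- exact: szP.
- by move=> s; rewrite genE; case: ifP; rewrite ?size_rev szP.
- move=> s; rewrite genE.
  have [] := sep (rshift k i) (lshift m s.1); first by rewrite eq_sym eq_lrshift.
  by case: s.2.
- move=> [j b] [j' b']; rewrite !genE xpair_eqE /=.
  case: (eqVneq j' j) => [->|jj'] /=.
    by case: b; case: b' => //= _; rewrite // eq_sym.
  move=> _; have [] := sep (lshift m j') (lshift m j); first by rewrite (inj_eq (@lshift_inj _ _)).
  by case: b; case: b'.
Qed.

Lemma input_stapes_encode (X : finType) k m (i : scsp_pair X k m) :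
  input_stapes 'I_3 (encode i) =
  mk (lists [::] (encode_words (map val (scsp_words i))))
     (lists [::] [::]) (lists [::] [::]) (lists [::] [::]) (lists [::] [::])
     (raws_of [::]).
Proof.
have eE : [seq Some (inl x) | x <- encode i] =
    encode_words (map val (scsp_words i)).
  rewrite /encode /encode_words map_flatten -!map_comp; congr flatten.
  by apply: eq_map => w /=; rewrite map_rcons -map_comp.
apply/funext => -[|[|[|[|[|j]]]]]; rewrite /input_stapes /upd //= /lists.
- by rewrite eE; congr (_, _); apply/funext => -[].
all: by congr (_, _); apply/funext => p; rewrite ?nth_nil.
Qed.

Theorem corollary6p11 (R : realType) (G : groupType)
  (hG : (exists n : nat, (3 <= n)%N /\ isomorphic G (pure_braid n)) \/
        (exists (V : finType) (e : rel V), symmetric e /\ irreflexive e /\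
           isomorphic G (partially_commutative e) /\
           exists g h : G, g * h != h * g))
  (X : {fset G}) (hX : forall g : G, subgroup_gen (incl X) g)
  (k m : nat) (hk : (0 < k)%N) (hm : (0 < m)%N) :
  exists M : machine (option (letter X)),
    (exists S : set (scsp_pair X k m),
       [/\ S `<=` scsp_inputs (incl X) k m,
           generic_inputs (incl X) R S &
           solves_on (incl X) M S]) /\
    quadratic_time (incl X) k m M.
Proof.
have [h [hh [a [b [ha hb]]]]] : nonabelian_quotient G.
  case: hG => [[n [n3 iso]]|[V [e [es [ei [iso [g [g' gg']]]]]]]].
    exact: nonabelian_quotient_isomorphic iso (nonabelian_quotient_pure_braid n3).
  apply: (nonabelian_quotient_isomorphic iso).
  apply: nonabelian_quotient_raag => //; have [f fb] := iso.
  exists (f g), (f g'); rewrite -!gmulfM (inj_eq (bij_inj fb)).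
  exact: gg'.
pose fl := letter_image h (X := X).
have flV l : fl (inv_letter l) = rev (fl l) := letter_imageV h l.
have surj := even_word_lift hh hX ha hb.
have rank := card_letters_ge4 hh hX ha hb.
pose D := \max_(l : letter X) size (fl l).
have flD l : (size (fl l) <= D)%N by exact: leq_bigmax.
pose M := compile k.+4 (peeling_program k m fl).
have uses : uses_tapes k.+4.+1 (peeling_program k m fl).
  exact: peeling_program_uses_tapes.
pose raw (i : scsp_pair X k m) (j : 'I_k) : word X := val (tnth i.1 (lshift m j)).
pose v0 (i : scsp_pair X k m) : word X := val (tnth i.2 (Ordinal hm)).
pose ls := enum {: letter 'I_k}.
pose out i := (iter (size (flat fl (v0 i))) (peel_pass fl (raw i) ls)
  (nf (flat fl (v0 i)), [::])).2.
have run i : exists T, runs (peeling_program k m fl)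
      (input_stapes 'I_3 (encode i)) (peeling_time k m D (input_size i)) T /\
    (T 0%N).2 = nth None [seq Some (inl x) | x <- [seq Some x | x <- out i]].
  pose aws : seq (word X) := map val (take k i.1).
  pose uws : seq (word X) := map val (drop k i.1).
  pose vws : seq (word X) := behead (map val i.2).
  have sa : size aws = k by rewrite size_map size_takel// size_tuple leq_addr.
  have su : size uws = m by rewrite size_map size_drop size_tuple addKn.
  have sv : size vws = m.-1 by rewrite size_behead size_map size_tuple.
  have wsE : aws ++ uws ++ v0 i :: vws = map val (scsp_words i).
    rewrite catA -map_cat cat_take_drop /scsp_words map_cat; congr (_ ++ _).
    rewrite /v0 /vws (tnth_nth (exist (@reduced X) [::] isT)) /=.
    by case: (tval i.2) (size_tuple i.2) => // e; have := hm; rewrite -[in (0 < m)%N]e.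
  have := runs_peeling_program flV flD (v0 i) sa su sv.
  rewrite /= wsE -input_stapes_encode.
  have -> : sumn (map size (map val (scsp_words i))) = input_size i.
    by rewrite sumnE !big_map.
  set T := peel_state _ _ _; move=> rT; exists T; split=> //.
  rewrite /T /peel_state /= -map_comp /=; congr (nth _ (map _ _)).
  rewrite /out; congr ((iter _ (peel_pass _ _ _) _).2).
  apply/funext => j; rewrite /raw (nth_map (exist (@reduced X) [::] isT)).
    by rewrite nth_take// (tnth_nth (exist (@reduced X) [::] isT)).
  by rewrite size_takel ?size_tuple ?leq_addr.
(* The clock gives the time bound on all inputs, separated or not. *)
exists M; split; last first.
  have [c cP] := peeling_time_quadratic k m D.
  exists (peeling_time k m D); split; first by exists c, 1%N.
  move=> i _; have [T [[t tle rT] _]] := run i.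
  exact: halts_compile uses rT tle.
exists [set i | scsp_inputs (incl X) k m i /\ separated_tuple fl i.1]; split.
- by move=> i [].
- by exists (@separated_tuple _ fl _); split=> //; apply: generic_separated_tuple.
move=> i [[g [[w _ wg] sol]] /(prefix_separated_tuple (Ordinal hm) flV)[L sep]].
exists (out i); have [T [[t _ rT] oT]] := run i.
split; first exact: outputs_compile uses rT oT.
(* Any solution g will do: peeling returns the expansion of a reduced word for g over the a_i, so
   the output evaluates to g itself and satisfies all m equations, although only the first one was
   exploited. *)
pose w0 := free_reduce w.
pose u := val (tnth i.1 (rshift k (Ordinal hm))).
have w0g : eval (incl X) (raw_word (raw i) w0) = g.
  by rewrite eval_raw_word eval_free_reduce -wg.
have [hi hM] := hh.
have v0E : nf (flat fl (v0 i)) = nf (rev (flat fl (raw_word (raw i) w0)) ++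
    nf (flat fl u) ++ flat fl (raw_word (raw i) w0)).
  rewrite -[RHS]nf_cat3_nf (nf_id (nf_irr _)) nf_cat3_nf -flat_inv//.
  rewrite -!flat_cat !nf_flat_letter_image//.
  have := sol (Ordinal hm); rewrite /feval conjgE => <-.
  by rewrite !eval_cat eval_inv_word w0g mulgA.
have -> : out i = raw_word (raw i) w0.
  rewrite /out v0E; apply: (peel_correct flV sep).
  - by move=> s; rewrite mem_enum.
  - exact: reduced_free_reduce.
  - by rewrite -v0E size_nf.
rewrite w0g; split=> //; exists w => //.
Qed.
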